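(* Suppose that $H\in\mathcal C_+$, write $H(x)=P_{\varphi(x)}$ for almost every $x>0$, with $\varphi:(0,\infty)\to\mathbb{R}$ a decreasing function satisfying $\pi/2\ge\varphi(0+)\ge\varphi(\infty)\ge-\pi/2$, and let \[ B=\liminf_{x\to\infty}x\,(\varphi(x)-\varphi(\infty)) . \] Then $\min\sigma_{ess}(H)\le 1/(4B)$, with the conventions $\min\emptyset=\infty$, $1/0=\infty$, $1/\infty=0$.
   Context: $J=\begin{pmatrix}0&-1\\1&0\end{pmatrix}$. For $\alpha\in\mathbb{R}$, $e_\alpha=(\cos\alpha,\sin\alpha)^t$ and $P_\alpha=e_\alpha e_\alpha^*$ (projection onto $e_\alpha$). ''Decreasing'' means non-increasing, $\varphi(0+)=\lim_{x\to0+}\varphi(x)$, $\varphi(\infty)=\lim_{x\to\infty}\varphi(x)$. A half line canonical system is the equation $Ju'(x)=-zH(x)u(x)$, $x\in[0,\infty)$, where $H$ is a measurable function with values in the real symmetric $2\times2$ matrices, $H(x)\ge0$, $\operatorname{tr}H(x)=1$ for a.e. $x$; the boundary condition $u_2(0)=0$ is always imposed. $L^2_H(0,\infty)$ is the Hilbert space of measurable $f:(0,\infty)\to\mathbb{C}^2$ with $\int_0^\infty f^*Hf\,dx<\infty$, modulo functions with $\int f^*Hf\,dx=0$. The system generates the self-adjoint relation $\mathcal S$ of all pairs $(f,g)\in L^2_H\times L^2_H$ such that $f$ has a representative $f_0$, locally absolutely continuous on $[0,\infty)$, with $Jf_0'=-Hg$ a.e. and second component $f_{0,2}(0)=0$.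 Its multi-valued part is $\mathcal S(0)=\{g:(0,g)\in\mathcal S\}$, and $\overline{D(\mathcal S)}=\mathcal S(0)^\perp$. The self-adjoint operator $S$ of the system acts on $\overline{D(\mathcal S)}$ and has graph $\mathcal S\cap(\overline{D(\mathcal S)}\times\overline{D(\mathcal S)})$. $\sigma(H)$ and $\sigma_{ess}(H)$ denote the spectrum and essential spectrum of $S$ (empty if $\overline{D(\mathcal S)}=0$). $\mathcal C_+$ is the set of such coefficient functions $H$ on $(0,\infty)$ with $\sigma(H)\subseteq[0,\infty)$. By a theorem of Winkler and Woracek, $H\in\mathcal C_+$ if and only if $H=P_\varphi$ a.e. for some $\varphi$ as in the claim, so such a $\varphi$ exists. *)

(* Defs.v *)
From HB Require Import structures.
From mathcomp Require Import all_boot all_order all_algebra.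
From mathcomp Require Import all_classical all_reals all_analysis.
From mathcomp Require Import measurable_realfun complex.
Set Implicit Arguments.
Unset Strict Implicit.
Unset Printing Implicit Defensive.
Import Order.TTheory GRing.Theory Num.Theory.
Import numFieldNormedType.Exports.
Local Open Scope classical_set_scope.
Local Open Scope complex_scope.
Local Open Scope ring_scope.

Section canonical_systems.
Variable R : realType.
Notation C := R[i].
Notation mu := (@lebesgue_measure R).
Notation halfline := (`]0, +oo[%classic : set R).

Implicit Types (H : R -> 'M[R]_2) (f g h : R -> 'cV[C]_2) (z w : C).

Definition Jmx : 'M[R]_2 :=
  \matrix_(i, j) (if (i == 0) && (j == 1) then -1
                  else if (i == 1) && (j == 0) then 1 else 0).

Definition evec (a : R) : 'cV[R]_2 := \col_i (if i == 0 then cos a else sin a).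

Definition Pmx (a : R) : 'M[R]_2 := evec a *m (evec a)^T.

Definition tocplx (m n : nat) (A : 'M[R]_(m, n)) : 'M[C]_(m, n) :=
  map_mx (real_complex R) A.

Definition adjmx (m n : nat) (A : 'M[C]_(m, n)) : 'M[C]_(n, m) :=
  map_mx (@conjc R) A^T.

(* [completed_algebra_gen mu] consists of the Borel sets modified by subsets
   of null sets, i.e. of the Lebesgue measurable sets; [measurable_fun] on
   [R] itself would mean Borel measurability. *)
Definition lebesgue_measurable (D : set R) (u : R -> R) : Prop :=
  @measurable_fun _ _ (g_sigma_algebraType (completed_algebra_gen mu)) R D u.

Definition psd (A : 'M[R]_2) : Prop :=
  forall v : 'cV[R]_2, 0 <= (v^T *m A *m v) 0 0.

Definition coefficient H : Prop :=
  [/\ forall i j, lebesgue_measurable halfline (fun x => H x i j),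
      forall x, 0 < x -> (H x)^T = H x &
      {ae mu, forall x, 0 < x -> psd (H x) /\ \tr (H x) = 1}].

(* The number f(x)^* H(x) f(x) is real, since H(x) is real symmetric. *)
Definition qform H f (x : R) : R :=
  complex.Re ((adjmx (f x) *m tocplx (H x) *m f x) 0 0).

Definition sqnorm H f : \bar R := (\int[mu]_(x in halfline) (qform H f x)%:E)%E.

(* L^2_H is represented by functions, not by classes: equality in L^2_H is
   [L2eq].  As every Lebesgue measurable function is a.e. equal to a Borel
   function, all classes have Borel representatives, so only these are used.
   Values outside the open half line are irrelevant. *)
Definition L2 H f : Prop :=
  (forall i, measurable_fun halfline (fun x : R => complex.Re (f x i 0)) /\
             measurable_fun halfline (fun x : R => complex.Im (f x i 0))) /\
  (sqnorm H f < +oo)%E.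

Definition L2norm H f : R := Num.sqrt (fine (sqnorm H f)).

Definition L2eq H f g : Prop := sqnorm H (fun x => f x - g x) = 0%E.

Definition abs_continuous (a b : R) (u : R -> R) : Prop :=
  forall e : R, 0 < e -> exists2 d : R, 0 < d &
  forall (n : nat) (s t : 'I_n -> R),
    (forall i, a <= s i /\ s i <= t i /\ t i <= b) ->
    (forall i j, i != j -> t i <= s j \/ t j <= s i) ->
    \sum_i (t i - s i) < d -> \sum_i `|u (t i) - u (s i)| < e.

Definition loc_abs_continuous f : Prop :=
  forall (b : R) i, abs_continuous 0 b (fun x => complex.Re (f x i 0)) /\
                    abs_continuous 0 b (fun x => complex.Im (f x i 0)).

Definition is_deriv f (x : R) (d : 'cV[C]_2) : Prop :=
  forall i, is_derive x 1 (fun t : R => complex.Re (f t i 0)) (complex.Re (d i 0)) /\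
            is_derive x 1 (fun t : R => complex.Im (f t i 0)) (complex.Im (d i 0)).

Definition relS H f g : Prop :=
  [/\ L2 H f, L2 H g &
      exists f0 : R -> 'cV[C]_2,
        [/\ L2eq H f f0,
            loc_abs_continuous f0,
            {ae mu, forall x, 0 < x -> exists2 d, is_deriv f0 x d &
                      tocplx Jmx *m d = - (tocplx (H x) *m g x)} &
            f0 0 1 0 = 0]].

Definition closureD H f : Prop :=
  L2 H f /\
  forall e : R, 0 < e ->
    exists h k, relS H h k /\ L2norm H (fun x => f x - h x) < e.

Definition opS H f g : Prop := [/\ relS H f g, closureD H f & closureD H g].

(* S - z maps D(S) bijectively onto the closure of D(S), with bounded inverse;
   the norm bound includes injectivity. *)
Definition resolvent_set H : set C := [set z |
  (forall h, closureD H h ->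
     exists f g, opS H f g /\ L2eq H (fun x => g x - z *: f x) h) /\
  (exists c : R, forall f g, opS H f g ->
     L2norm H f <= c * L2norm H (fun x => g x - z *: f x))].

Definition spectrum H : set C := ~` resolvent_set H.

Definition eigenfun H z f : Prop := opS H f (fun x => z *: f x).

Definition eigenvalue H z : Prop :=
  exists2 f, eigenfun H z f & ~ L2eq H f (fun=> 0).

Definition finite_multiplicity H z : Prop :=
  exists (n : nat) (b : 'I_n -> R -> 'cV[C]_2),
    (forall i, eigenfun H z (b i)) /\
    forall f, eigenfun H z f ->
      exists c : 'I_n -> C, L2eq H f (fun x => \sum_i c i *: b i x).

Definition isolated_in (A : set C) z : Prop :=
  exists2 e : R, 0 < e & forall w, A w -> `|w - z| < e%:C -> w = z.

Definition discrete_spectrum H : set C := [set z |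
  [/\ spectrum H z, isolated_in (spectrum H) z,
      eigenvalue H z & finite_multiplicity H z]].

Definition ess_spectrum H : set C := spectrum H `\` discrete_spectrum H.

(* In the order of R[i], [0 <= z] says that z is real and nonnegative. *)
Definition Cplus H : Prop :=
  coefficient H /\ forall z, spectrum H z -> 0 <= z.

(* [m] is the minimum of [A], where the minimum of the empty set is +oo.  In
   the order of R[i], [x%:C <= z] says that z is real and at least x. *)
Definition is_min (A : set C) (m : \bar R) : Prop :=
  match m with
  | EFin x => A x%:C /\ forall z, A z -> x%:C <= z
  | EPInf => A = set0
  | ENInf => False
  end.

End canonical_systems.

(* Main.v *)
(* Writing [H = P_phi], the complex space L^2_H becomes a pair of copies of the
   real L^2(0, oo) through [F = e_phi . f], so a real form of the relation S can
   be studied.  If S had no essential spectrum in [[0, L]] then, as the spectrum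
   is nonnegative, [(S + 1)^-1] would have only finitely many eigenvalues above
   [1 / (1 + L)]; on a subspace of finite codimension one would have
   [<f, g> >= L ||f||^2], hence [L <f, g> <= ||g||^2], for all [(f, g)] in S.
   Trial pairs with disjoint supports contradict this as soon as
   [kappa ||g||^2 <= <f, g>] with [kappa L > 1].  With [psi = phi - phi(oo)],
   a pair of this kind is determined by a scalar function [w] of compact support,
   with [int tan(psi) w' = 0], by [g = w' / cos psi], and then
   [<f, g> = 2 int tan(psi) w w'].  For [w = sqrt x - sqrt a] on a long interval
   [[a, b]] this is at least about [B log (b/a)], while [||g||^2] is about
   [log (b/a) / 4]; so every [kappa < 4 B] can be reached. *)

Require Import Defs.
From HB Require Import structures.
From mathcomp Require Import all_boot all_order all_algebra.
From mathcomp Require Import all_classical all_reals all_analysis.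
From mathcomp Require Import measurable_realfun complex ring lra.
Import Order.TTheory GRing.Theory Num.Theory.
Import numFieldNormedType.Exports.
Local Open Scope classical_set_scope.
Local Open Scope ring_scope.

(** * Semi-bounded relations with discrete spectrum *)

(** No spectral theorem is used. All bounds are obtained for quadratic forms, from two facts about a
    bounded symmetric operator: a lower bound of its form persists along an interval at whose points
    the shifted operator is bounded below, and a gap [(0, e)] above [0] together with a trivial
    kernel lifts the lower bound from [0] to [e]. The second fact allows an isolated eigenvalue to
    be crossed once its eigenvectors are split off. Only real spectral points enter, as the spectrum
    lies in [[0, oo)]; this is why the complex space can be treated as a real one.

    The relation may have a multi-valued part, and the trial pairs are only known to belong to the
    relation: their [g] may lie outside the closure of the domain, in which case [f] is not
    literally the resolvent applied to [f + g]. The bound [L <f, g> <= ||g||^2] has to cover such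
    pairs and is therefore derived from weak identities.

    That the minimum exists is a separate point: it rests on the essential spectrum being closed. *)

Lemma discriminant_le (R : realFieldType) (a b c : R) : 0 <= c ->
  (forall t, 0 <= a + 2 * t * b + t ^+ 2 * c) -> b ^+ 2 <= a * c.
Proof.
rewrite le_eqVlt => /predU1P[<-|c0] h.
  have [->|b0] := eqVneq b 0; first by rewrite expr0n mulr0.
  have := h (- (a + 1) / (2 * b)); rewrite mulr0 addr0.
  have -> : 2 * (- (a + 1) / (2 * b)) * b = - (a + 1) by field.
  by lra.
have := h (- b / c).
have -> : a + 2 * (- b / c) * b + (- b / c) ^+ 2 * c = (a * c - b ^+ 2) / c.
  by field; rewrite gt_eqF.
by rewrite pmulr_lge0 ?invr_gt0// subr_ge0.
Qed.

Section semi_inner_product.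
Variables (R : realType) (V : lmodType R) (ip : V -> V -> R).
Hypothesis ipC : forall u v, ip u v = ip v u.
Hypothesis ipDl : forall u v w, ip (u + v) w = ip u w + ip v w.
Hypothesis ipZl : forall a u w, ip (a *: u) w = a * ip u w.
Hypothesis ip_ge0 : forall u, 0 <= ip u u.

Implicit Types (u v f g h x y : V) (K X : pred V) (T A : V -> V).

Lemma ipDr u v (w : V) : ip w (u + v) = ip w u + ip w v.
Proof. by rewrite ipC ipDl !(ipC w). Qed.
Lemma ipZr a u (w : V) : ip w (a *: u) = a * ip w u.
Proof. by rewrite ipC ipZl (ipC w). Qed.
Lemma ipNl u (w : V) : ip (- u) w = - ip u w.
Proof. by rewrite -scaleN1r ipZl mulN1r. Qed.
Lemma ipNr u (w : V) : ip w (- u) = - ip w u.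
Proof. by rewrite ipC ipNl ipC. Qed.
Lemma ip0l (w : V) : ip 0 w = 0.
Proof. by rewrite -(scale0r 0) ipZl mul0r. Qed.
Lemma ip0r (w : V) : ip w 0 = 0.
Proof. by rewrite ipC ip0l. Qed.
Definition ipE := (ipDl, ipDr, ipNl, ipNr, ipZl, ipZr, ip0l, ip0r).

Local Notation sq u := (ip u u).

Lemma ip_cauchy_schwarz u v : ip u v ^+ 2 <= sq u * sq v.
Proof.
apply: discriminant_le => [//|t]; have := ip_ge0 (u + t *: v).
by rewrite !ipE (ipC v u); congr (0 <= _); ring.
Qed.

(** Cauchy-Schwarz. Vectors at distance zero can thus be exchanged inside [ip], which takes the
    place of passing to the quotient by the null vectors. *)
Lemma sqB_null u v x : sq (u - v) = 0 -> ip u x = ip v x.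
Proof.
move=> uv; have := ip_cauchy_schwarz (u - v) x.
rewrite uv mul0r => h; have : ip (u - v) x = 0.
  by apply/eqP; rewrite -sqrf_eq0 eq_le h sqr_ge0.
by rewrite !ipE => /eqP; rewrite subr_eq0 => /eqP.
Qed.

Lemma sq_eq_null u v : sq (u - v) = 0 -> sq u = sq v.
Proof. by move=> uv; rewrite (sqB_null _ _ _ uv) ipC (sqB_null _ _ _ uv). Qed.

Lemma sqD_le u v : sq (u + v) <= 2 * sq u + 2 * sq v.
Proof. by have := ip_ge0 (u - v); rewrite !ipE (ipC v u); lra. Qed.

Lemma sqB_le u v : sq (u - v) <= 2 * sq u + 2 * sq v.
Proof. by have := sqD_le u (- v); rewrite ipNl ipNr opprK. Qed.

Lemma sqBC u v : sq (u - v) = sq (v - u).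
Proof. by rewrite !ipE (ipC v u); ring. Qed.

Lemma sqZ a u : sq (a *: u) = a ^+ 2 * sq u.
Proof. by rewrite !ipE; ring. Qed.

Definition cvgsq (u : nat -> V) (v : V) := forall e : R, 0 < e ->
  exists N : nat, forall n, (N <= n)%N -> sq (u n - v) < e.

Definition cauchysq (u : nat -> V) := forall e : R, 0 < e ->
  exists N : nat, forall m n, (N <= m)%N -> (N <= n)%N -> sq (u m - u n) < e.

(** * Bounded symmetric operators: lower bounds of the form and spectral gaps *)

Definition subspace K := K 0 /\ forall a u v, K u -> K v -> K (a *: u + v).

Definition sqclosed K := forall (u : nat -> V) v, (forall n, K (u n)) -> cvgsq u v -> K v.

Lemma subspaceZ K a u : subspace K -> K u -> K (a *: u).
Proof. by move=> [K0 KD] Ku; rewrite -[_ *: _]addr0; apply: KD. Qed.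
Lemma subspaceD K u v : subspace K -> K u -> K v -> K (u + v).
Proof. by move=> [K0 KD] Ku Kv; rewrite -[u]scale1r; apply: KD. Qed.
Lemma subspaceB K u v : subspace K -> K u -> K v -> K (u - v).
Proof.
by move=> sK Ku Kv; apply: subspaceD => //; rewrite -scaleN1r; apply: subspaceZ.
Qed.

(** [T] is a bare function, since resolvents will arise by choice. On a subspace [K], symmetry makes
    it linear up to null vectors, because [T (u + v) - T u - T v] is an element of [K] orthogonal to
    [K]. *)
Definition symop K T := (forall f, K f -> K (T f)) /\
  (forall f g, K f -> K g -> ip (T f) g = ip f (T g)).

Definition bounded_on K T := exists M : R, forall f, K f -> sq (T f) <= M * sq f.

Definition bounded_below K T :=
  exists2 c : R, 0 < c & forall f, K f -> c * sq f <= sq (T f).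

Definition invertible K T :=
  (forall f, K f -> exists2 h, K h & sq (T h - f) = 0) /\ bounded_below K T.

Definition opshift T (w : R) f := T f - w *: f.

Lemma symop_opshift K T (w : R) : subspace K -> symop K T -> symop K (opshift T w).
Proof.
move=> sK [TK Ts]; split=> [f Kf|f g Kf Kg].
  by apply: subspaceB => //; [exact: TK|exact: subspaceZ].
by rewrite /opshift !ipE Ts.
Qed.

Lemma bounded_opshift K T (w : R) : bounded_on K T -> bounded_on K (opshift T w).
Proof.
move=> [M hM]; exists (2 * M + 2 * w ^+ 2) => f Kf.
apply: le_trans (sqB_le _ _) _; rewrite sqZ.
by have := hM _ Kf; lra.
Qed.

(** [2 |<T f, f>| <= ||T f||^2 + ||f||^2], from the squares of [T f + f] and [T f - f]. *)
Lemma bounded_form K T : bounded_on K T ->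
  exists2 N : R, 0 < N & forall f, K f -> `|ip (T f) f| <= N * sq f.
Proof.
move=> [M hM]; exists ((`|M| + 1) / 2) => [|f Kf].
  by have := normr_ge0 M; lra.
have h1 := ip_ge0 (T f + f); have h2 := ip_ge0 (T f - f).
have := hM _ Kf; have := ler_norm M; have := ip_ge0 f.
move: h1 h2; rewrite !ipE (ipC f (T f)) => h1 h2 f0 hM0 hf.
have : M * sq f <= `|M| * sq f by exact: ler_wpM2r.
by rewrite ler_norml; lra.
Qed.

(** Typically used with [u = T (f - g)] and [v = T f - T g], whose equality is known only when
    tested against [K]. *)
Lemma weak_sq K u v : K u -> K v -> (forall x, K x -> ip u x = ip v x) ->
  sq u = sq v.
Proof. by move=> Ku Kv uv; rewrite uv// ipC uv. Qed.

Lemma symop_form_cs K T f g : subspace K -> symop K T ->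
  (forall x, K x -> 0 <= ip (T x) x) -> K f -> K g ->
  ip (T f) g ^+ 2 <= ip (T f) f * ip (T g) g.
Proof.
move=> sK [TK Ts] T0 Kf Kg; apply: discriminant_le => [|t]; first exact: T0.
have Kfg : K (f + t *: g) by apply: subspaceD => //; apply: subspaceZ.
have := T0 _ Kfg; rewrite Ts// !ipE -!Ts// !ipE (Ts g f)// (ipC g).
by congr (0 <= _); ring.
Qed.

(** Cauchy-Schwarz for the form [<T f, g>] at [g = T f] gives [||T f||^4 <= <T f, f> <T T f, T f> <=
    N <T f, f> ||T f||^2], so the form controls [||T f||^2]. *)
Lemma form_bounded_below K T : subspace K -> symop K T -> bounded_on K T ->
  (forall x, K x -> 0 <= ip (T x) x) -> bounded_below K T ->
  exists2 c : R, 0 < c & forall f, K f -> c * sq f <= ip (T f) f.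
Proof.
move=> sK sT bT T0 [c c0 hc]; have [N N0 hN] := bounded_form _ _ bT.
exists (c / N) => [|f Kf]; first exact: divr_gt0.
have KTf : K (T f) by case: sT => h _; exact: h.
have h1 := symop_form_cs _ _ f (T f) sK sT T0 Kf KTf.
have h2 := le_trans (ler_norm _) (hN _ KTf).
have h3 : sq (T f) <= N * ip (T f) f.
  have [e|/eqP ne] := pselect (sq (T f) = 0).
    by rewrite e mulr_ge0 ?T0// ltW.
  have p : 0 < sq (T f) by rewrite lt_neqAle eq_sym ne ip_ge0.
  rewrite -(ler_pM2r p) -expr2; apply: le_trans h1 _.
  by rewrite [leRHS]mulrAC [leRHS]mulrC; apply: ler_wpM2l; [exact: T0|].
rewrite mulrAC ler_pdivrMr// [leRHS]mulrC.
exact: le_trans (hc _ Kf) h3.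
Qed.

(* The set of lower bounds of the form is closed, and open at every point at
   which the shifted operator is bounded below. *)
Lemma form_ge_extend K T (a b : R) : subspace K -> symop K T -> bounded_on K T ->
  (forall f, K f -> a * sq f <= ip (T f) f) ->
  (forall w, a <= w < b -> bounded_below K (opshift T w)) ->
  a <= b -> forall f, K f -> b * sq f <= ip (T f) f.
Proof.
move=> sK sT bT Ta inv ab.
pose B := [set w : R | w <= b /\ forall f, K f -> w * sq f <= ip (T f) f]%classic.
have Ba : B a by [].
have ubB : has_sup B by split; [exists a|exists b => w []].
pose s := sup B.
have as_ : a <= s by apply: ub_le_sup => //; case: ubB.
have sb : s <= b by apply: ge_sup; [exists a|move=> w []].
have hs f : K f -> s * sq f <= ip (T f) f.
  move=> Kf; have [e|/eqP ne] := pselect (sq f = 0).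
    by rewrite e mulr0; have := Ta _ Kf; rewrite e mulr0.
  have p : 0 < sq f by rewrite lt_neqAle eq_sym ne ip_ge0.
  rewrite -ler_pdivlMr//; apply: ge_sup; first by exists a.
  by move=> w [_ hw]; rewrite ler_pdivlMr//; apply: hw.
have [->//|sltb] := eqVneq b s.
have {}sltb : s < b by rewrite lt_neqAle eq_sym sltb.
have [||||c c0 hc] := form_bounded_below K (opshift T s) sK _ _ _ (inv s _).
- exact: symop_opshift.
- exact: bounded_opshift.
- by move=> x Kx; rewrite /opshift !ipE subr_ge0; exact: hs.
- by rewrite as_.
exfalso; pose d := Num.min c (b - s).
have d0 : 0 < d by rewrite lt_min c0 subr_gt0.
suff : B (s + d) by move=> /(ub_le_sup ubB.2); rewrite -/s; lra.
have dc : d <= c by rewrite ge_min lexx.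
have db : d <= b - s by rewrite ge_min lexx orbT.
split; first lra.
move=> f Kf; have := hc _ Kf; rewrite /opshift !ipE => h.
have : d * sq f <= c * sq f by exact: ler_wpM2r.
by lra.
Qed.

Lemma bounded_below_comp K T U : (forall f, K f -> K (U f)) ->
  bounded_below K T -> bounded_below K U -> bounded_below K (fun f => T (U f)).
Proof.
move=> KU [c c0 hc] [d d0 hd]; exists (c * d) => [|f Kf]; first exact: mulr_gt0.
rewrite -mulrA; apply: le_trans (hc _ (KU _ Kf)).
by apply: ler_wpM2l; [exact: ltW|exact: hd].
Qed.

Lemma bounded_on_comp K T U : (forall f, K f -> K (U f)) ->
  bounded_on K T -> bounded_on K U -> bounded_on K (fun f => T (U f)).
Proof.
move=> KU [c hc] [d hd]; exists (`|c| * `|d|) => f Kf.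
apply: le_trans (hc _ (KU _ Kf)) _.
apply: (@le_trans _ _ (`|c| * sq (U f))); first exact/ler_wpM2r/ler_norm.
rewrite -mulrA; apply: ler_wpM2l => //; apply: le_trans (hd _ Kf) _.
exact/ler_wpM2r/ler_norm.
Qed.

Definition sqcomplete K := forall u : nat -> V, (forall n, K (u n)) ->
  cauchysq u -> exists2 v, K v & cvgsq u v.

(* For [w = e / 2] every [q < w ^+ 2] is a point at which [(T - w) ^ 2 - q]
   factors into two operators that are bounded below. *)
Lemma sq_ge_gap K T (e : R) : subspace K -> symop K T -> bounded_on K T ->
  0 < e -> (forall w, 0 < w < e -> bounded_below K (opshift T w)) ->
  forall f, K f -> e * ip (T f) f <= sq (T f).
Proof.
move=> sK sT bT e0 inv f Kf; pose w := e / 2; pose U := opshift T w.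
have sU : symop K U by exact: symop_opshift.
have KU : forall f, K f -> K (U f) by case: sU.
have sC : symop K (fun f => U (U f)).
  by split=> [g Kg|g h Kg Kh]; [exact/KU/KU|rewrite (sU.2 (U g)) ?(sU.2 g) ?KU//; exact/KU].
have bC : bounded_on K (fun f => U (U f)).
  by apply: bounded_on_comp => //; exact: bounded_opshift.
(* Expanded, [(T - w)^2 >= w^2] reads [T^2 >= 2 w T], and [2 w = e]. *)
suff : w ^+ 2 * sq f <= ip (U (U f)) f.
  by rewrite sU.2 ?KU// /U /opshift !ipE (ipC f (T f)) /w; nra.
apply: (form_ge_extend K (fun f => U (U f)) 0 (w ^+ 2)) => // [g Kg|q /andP[q0 qw]|].
- by rewrite mul0r sU.2 ?KU.
- pose r := Num.sqrt q.
  have rq : r ^+ 2 = q by rewrite sqr_sqrtr.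
  have r0 : 0 <= r by exact: sqrtr_ge0.
  have w0 : 0 < w by rewrite /w; lra.
  have rw : r < w by rewrite -(ltr_pXn2r (n := 2)) ?nnegrE// ?rq// ltW.
  have KT a g : K g -> K (opshift T a g) by case: (symop_opshift K T a sK sT) => + _; apply.
  have [||| c c0 hc] := bounded_below_comp K (opshift T (w + r)) (opshift T (w - r)).
  + by move=> g; exact: KT.
  + by apply: inv; move: rw; rewrite /w; lra.
  + by apply: inv; move: rw; rewrite /w; lra.
  exists c => // g Kg; apply: le_trans (hc _ Kg) _; rewrite le_eqVlt; apply/orP; left.
  apply/eqP/(weak_sq K) => [||x Kx]; first exact/KT/KT.
    by apply: subspaceB => //; [exact/KU/KU|exact: subspaceZ].
  rewrite (symop_opshift K T (w + r) sK sT).2//; last exact: KT.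
  rewrite {3}/opshift ipDl ipNl ipZl sU.2 ?KU// -rq /U /opshift !ipE -(sT.2 g x)//.
  by ring.
- by rewrite exprn_ge0// /w; lra.
Qed.

(* On the range of [T] the bound follows from [T ^ 2 >= e T] by
   Cauchy-Schwarz. If [h] solves [(T - d) h = f], then [T h - f = d h] tends
   to a null vector of [T] as [d] tends to 0, so the range is dense. *)
Lemma form_ge_gap K T (e : R) : subspace K -> sqcomplete K -> symop K T ->
  bounded_on K T -> (forall f, K f -> 0 <= ip (T f) f) -> 0 < e ->
  (forall w, 0 < w < e -> invertible K (opshift T w)) ->
  (forall f, K f -> sq (T f) = 0 -> sq f = 0) ->
  forall f, K f -> e * sq f <= ip (T f) f.
Proof.
move=> sK cK sT bT T0 e0 inv ker.
have KT : forall f, K f -> K (T f) by case: sT.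
have gap f : K f -> e * ip (T f) f <= sq (T f).
  by move=> Kf; apply: (sq_ge_gap K) => // w /inv[].
(* Here [u] is [T h] up to a null vector. Then [||u||^2 = <T h, u>], and Cauchy-Schwarz for the form
   of [T] bounds [||u||^4] by [<T h, h> <T u, u> <= ||u||^2 <T u, u> / e]. *)
have ran u h : K u -> K h -> (forall x, K x -> ip u x = ip h (T x)) ->
    e * sq u <= ip (T u) u.
  move=> Ku Kh uh.
  have uu : sq u = ip (T h) u by rewrite uh// sT.2.
  have Thh : e * ip (T h) h <= sq u.
    rewrite (_ : sq u = sq (T h)); first exact: gap.
    by apply: (weak_sq K) => // [|x Kx]; [exact: KT|rewrite uh// sT.2].
  have := symop_form_cs K T h u sK sT T0 Kh Ku; rewrite -uu => cs.
  have [->|/eqP ne] := pselect (sq u = 0); first by rewrite mulr0; exact: T0.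
  have p : 0 < sq u by rewrite lt_neqAle eq_sym ne ip_ge0.
  rewrite -(ler_pM2r p) -mulrA -expr2.
  have Tuu := T0 _ Ku; have h1 : e * (ip (T h) h * ip (T u) u) <= sq u * ip (T u) u.
    by rewrite mulrA; apply: ler_wpM2r.
  rewrite [leRHS]mulrC; apply: le_trans h1.
  by apply: ler_wpM2l => //; exact: ltW.
have ranT u h : K u -> K h -> (forall x, K x -> ip u x = ip h (T x)) ->
    e ^+ 2 * sq u <= sq (T u).
  move=> Ku Kh uh; have h1 := ran _ _ Ku Kh uh; have h2 := gap _ Ku.
  by rewrite expr2 -mulrA; apply: le_trans h2; apply: ler_wpM2l => //; exact: ltW.
move=> f Kf.
(* A null sequence inside the gap, with [2 d <= e] from the first term on. *)
pose d n : R := e / (n%:R + 3).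
have d0 n : 0 < d n by rewrite divr_gt0// ltr_wpDl.
have de n : 2 * d n <= e.
  rewrite /d mulrCA -[leRHS]mulr1; apply: ler_wpM2l; first exact: ltW.
  by rewrite ler_pdivrMr ?ltr_wpDl// mul1r; have := ler0n R n; lra.
have /choice[h hh] : forall n, exists h, K h /\ sq (opshift T (d n) h - f) = 0.
  move=> n; case: (inv (d n)); first by have := d0 n; have := de n; lra.
  by move=> + _ => /(_ _ Kf)[h Kh e1]; exists h.
have Kh n : K (h n) := (hh n).1.
have [p pE] : exists p : nat -> V, forall n, p n = d n *: h n by eexists.
have Kp n : K (p n) by rewrite pE; exact: subspaceZ.
have hfx n x : ip (T (h n)) x - ip (p n) x = ip f x.
  by have := sqB_null _ _ x (hh n).2; rewrite /opshift pE !ipE.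
have Th n x : ip (T (h n)) x = ip f x + ip (p n) x by rewrite -(hfx n); ring.
(* [||f||^2 = ||T h - d h||^2 = ||T h||^2 - 2 d <T h, h> + ||p||^2], and the first two terms have a
   nonnegative sum by [gap] and [2 d <= e]. *)
have sqp n : sq (p n) <= sq f.
  rewrite -(sq_eq_null _ _ (hh n).2) /opshift pE !ipE (ipC (h n) (T _)).
  have := gap _ (Kh n); have := T0 _ (Kh n); have := de n; nra.
(* [T p = d T h = d (f + p)] with [p] bounded, so [T (p n)] tends to 0. *)
have Tp n x : K x -> ip (T (p n)) x = d n * ip (f + p n) x.
  by move=> Kx; rewrite sT.2// {1}pE ipZl -sT.2// Th ipDl.
have sqTp n : sq (T (p n)) <= 4 * d n ^+ 2 * sq f.
  rewrite (_ : sq (T (p n)) = d n ^+ 2 * sq (f + p n)).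
    have := sqD_le f (p n); have := sqp n; have := sqr_ge0 (d n).
    move: (d n ^+ 2) => D D0 h1 h2; rewrite -mulrA mulrCA; apply: ler_wpM2l => //; lra.
  by rewrite Tp ?KT// ipC Tp ?subspaceD// expr2 mulrA.
have dlt r : 0 < r -> exists N, forall n, (N <= n)%N -> d n ^+ 2 < r.
  move=> r0; have [N hN] : exists N, e ^+ 2 / r < N%:R.
    exists (Num.bound (e ^+ 2 / r)).
    by have := archi_boundP (_ : 0 <= e ^+ 2 / r); apply; rewrite divr_ge0 ?sqr_ge0 ?ltW.
  exists N => n Nn; rewrite /d expr_div_n ltr_pdivrMr ?exprn_gt0 ?ltr_wpDl//.
  rewrite mulrC -ltr_pdivrMr//; apply: lt_trans hN _.
  have : (N%:R : R) <= n%:R by rewrite ler_nat.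
  have := ler0n R n; nra.
have f0 := ip_ge0 f.
have cau : cauchysq p.
  move=> r r0.
  have [|N hN] := dlt (e ^+ 2 * r / (16 * (sq f + 1))).
    by rewrite divr_gt0// ?mulr_gt0// ?exprn_gt0//; lra.
  exists N => m n Nm Nn.
  have Kk : K (p m - p n) by exact: subspaceB.
  (* As [T (h n) = f + p n], the difference [p m - p n] is [T (h m - h n)] and belongs to the range,
     where [T] is bounded below. *)
  have h1 : e ^+ 2 * sq (p m - p n) <= sq (T (p m - p n)).
    apply: (ranT _ (h m - h n)) => // [|x Kx]; first exact: subspaceB.
    by rewrite !ipE -!sT.2// !Th; ring.
  have h2 : sq (T (p m - p n)) = sq (T (p m) - T (p n)).
    apply: (weak_sq K) => [||x Kx]; [exact: KT|apply: subspaceB; rewrite ?KT//|].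
    by rewrite sT.2// !ipE !sT.2.
  have h3 := sqB_le (T (p m)) (T (p n)).
  have h4 := sqTp m; have h5 := sqTp n.
  have {hN} [hm hn] := (hN _ Nm, hN _ Nn).
  rewrite -(ltr_pM2l (_ : 0 < e ^+ 2)) ?exprn_gt0//.
  apply: le_lt_trans h1 _; rewrite h2; apply: le_lt_trans h3 _.
  have q0 : 0 < 16 * (sq f + 1) by lra.
  move: hm hn; rewrite !ltr_pdivlMr//.
  have := sqr_ge0 (d m); have := sqr_ge0 (d n); nra.
have [q Kq pq] := cK p Kp cau.
have Tq : sq (T q) = 0.
  have [M hM] := bT.
  apply/eqP; rewrite eq_le ip_ge0 andbT; apply/ler_addgt0Pl => r r0; rewrite addr0.
  have [|N1 hN1] := pq (r / (4 * (`|M| + 1))).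
    by rewrite divr_gt0// mulr_gt0// ltr_wpDl.
  have [|N2 hN2] := dlt (r / (16 * (sq f + 1))).
    by rewrite divr_gt0//; lra.
  pose n := maxn N1 N2.
  have {hN1} h1 := hN1 n (leq_maxl _ _); have {hN2} h2 := hN2 n (leq_maxr _ _).
  have Kpq : K (p n - q) by exact: subspaceB.
  have h3 : sq (T q) = sq (T (p n) - T (p n - q)).
    apply: (weak_sq K) => [||x Kx]; [exact: KT|apply: subspaceB; rewrite ?KT//|].
    by rewrite !ipE !sT.2// !ipE; ring.
  rewrite h3; apply: le_trans (sqB_le _ _) _.
  have h4 := sqTp n; have h5 := hM _ Kpq.
  move: h1 h2; rewrite !ltr_pdivlMr; [|lra|by have := normr_ge0 M; lra] => h1 h2.
  have := ler_norm M; have := ip_ge0 (p n - q); have := sqr_ge0 (d n); nra.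
have q0 := ker _ Kq Tq.
have sU := symop_opshift K T e sK sT.
suff : 0 <= ip (opshift T e f) f by rewrite /opshift !ipE subr_ge0.
have [M M0 hM] := bounded_form _ _ (bounded_opshift K T e bT).
apply/ler_addgt0Pl => r r0.
have [s s0 h3] : exists2 s, 0 < s & s * sq (opshift T e f) <= r / 2.
  exists (r / (2 * (sq (opshift T e f) + 1))).
    by rewrite divr_gt0// mulr_gt0// ltr_wpDl.
  rewrite mulrAC ler_pdivrMr ?mulr_gt0 ?ltr_wpDl//.
  have := ip_ge0 (opshift T e f); nra.
have [|N hN] := pq (r / (2 * (s^-1 + M))).
  by rewrite divr_gt0// mulr_gt0// addr_gt0// invr_gt0.
have {hN} := hN N (leqnn _).
have qx x : ip q x = 0 by rewrite (sqB_null q 0) ?subr0// ip0l.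
have -> : sq (p N - q) = sq (p N) by rewrite !ipE (ipC _ q) !qx; ring.
rewrite ltr_pdivlMr ?mulr_gt0 ?addr_gt0 ?invr_gt0// => hp.
(* [T (h N) = f + p N] is in the range and close to [f], since [p] tends to the null vector [q]; the
   bound on the range passes to [f] in the limit. *)
pose y := T (h N).
have Ky : K y by exact: KT.
have yran : 0 <= ip (opshift T e y) y.
  rewrite /opshift !ipE subr_ge0; apply: (ran _ (h N)) => // x Kx.
  by rewrite /y sT.2.
have yE : ip (opshift T e y) y
    = ip (opshift T e f) f + 2 * ip (opshift T e f) (p N) + ip (opshift T e (p N)) (p N).
  rewrite sU.2// /y Th ipC -/y.
  have -> : ip (opshift T e y) f + ip (p N) (opshift T e y)
      = ip y (opshift T e f) + ip y (opshift T e (p N)).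
    by rewrite sU.2// (ipC (p N)) sU.2.
  by rewrite /y !Th (ipC f) (ipC (p N)) (ipC (p N)) -(sU.2 f (p N))//; ring.
have h1 := le_trans (ler_norm _) (hM _ (Kp N)).
have h2 : 2 * ip (opshift T e f) (p N) <= s * sq (opshift T e f) + s^-1 * sq (p N).
  have := ip_ge0 (s *: opshift T e f - p N).
  move: (opshift T e f) => v; rewrite !ipE (ipC (p N)) => h2.
  rewrite -(ler_pM2l s0) [leRHS]mulrDr mulVKf ?gt_eqF//; lra.
move: yran; rewrite yE; have := ip_ge0 (p N); lra.
Qed.

(** * Splitting off finitely many eigenvectors *)

Definition orth (E : seq V) f := all (fun e => ip f e == 0) E.

Lemma orth_cat E F f : orth (E ++ F) f = orth E f && orth F f.
Proof. exact: all_cat. Qed.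

(** Each member of the list has its own eigenvalue [nu], and the eigenvalue equation is tested
    against [X], that is, taken up to null vectors. *)
Definition eigenvectors X A (E : seq V) := forall e, e \in E ->
  X e /\ exists nu, forall x, X x -> ip (A e) x = nu * ip e x.

Lemma subspace_orth X E : subspace X -> subspace (predI X (orth E)).
Proof.
move=> [X0 XD]; split=> [|a u v /andP[Xu /allP Eu] /andP[Xv /allP Ev]]/=.
  by rewrite X0; apply/allP => e _; rewrite ip0l.
rewrite XD//; apply/allP => e eE; rewrite !ipE.
by rewrite (eqP (Eu _ eE)) (eqP (Ev _ eE)) mulr0 addr0.
Qed.

Lemma sqcomplete_orth X E : sqcomplete X -> sqcomplete (predI X (orth E)).
Proof.
move=> cX u Ku cu; have [|v Xv uv] := cX u _ cu; first by move=> n; case/andP: (Ku n).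
exists v => //=; rewrite Xv; apply/allP => e eE; rewrite -sqrf_eq0 eq_le sqr_ge0 andbT.
apply/ler_addgt0Pl => r r0; rewrite addr0.
have [|N hN] := uv (r / (sq e + 1)); first by rewrite divr_gt0// ltr_wpDl.
have := hN N (leqnn _); rewrite ltr_pdivlMr ?ltr_wpDl// => h1.
have -> : ip v e = - ip (u N - v) e.
  by case/andP: (Ku N) => _ /allP/(_ _ eE)/eqP ue; rewrite !ipE ue; ring.
rewrite sqrrN; apply: le_trans (ip_cauchy_schwarz _ _) _.
by have := ip_ge0 (u N - v); lra.
Qed.

Lemma symop_orth X A E : symop X A -> eigenvectors X A E ->
  symop (predI X (orth E)) A.
Proof.
move=> [AX As] eE; split=> [f /andP[Xf /allP Ef]|f g /andP[Xf _] /andP[Xg _]].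
  rewrite /= AX//; apply/allP => e ee; have [Xe [nu he]] := eE _ ee.
  by rewrite As// ipC he// ipC (eqP (Ef _ ee)) mulr0.
exact: As.
Qed.

(** If [(A - w) h = f] with [f] orthogonal to [e], then [(nu - w) <h, e> = 0]. For [nu = w] the
    lower bound of [A - w] makes [e] itself null. *)
Lemma invertible_orth X A E w : subspace X -> symop X A -> eigenvectors X A E ->
  invertible X (opshift A w) -> invertible (predI X (orth E)) (opshift A w).
Proof.
move=> sX sA eE [surj [c c0 hc]]; split; last first.
  by exists c => // f /andP[Xf _]; exact: hc.
move=> f /andP[Xf /allP Ef]; have [h Xh hf] := surj _ Xf; exists h => //=.
rewrite Xh; apply/allP => e ee; have [Xe [nu he]] := eE _ ee.
have := sqB_null _ _ e hf; rewrite (eqP (Ef _ ee)) /opshift !ipE sA.2// ipC he//.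
rewrite (ipC e) -mulrBl => /eqP; rewrite mulf_eq0 => /orP[|//].
rewrite subr_eq0 => /eqP nuw.
have e0 : sq e = 0.
  apply/eqP; rewrite eq_le ip_ge0 andbT -(pmulr_rle0 _ c0).
  apply: le_trans (hc _ Xe) _; rewrite (weak_sq X _ 0) ?ip0l//.
  - by have [] := symop_opshift X A w sX sA => + _; apply.
  - by case: sX.
  - by move=> x Xx; rewrite /opshift !ipE he// nuw subrr.
by rewrite ipC (sqB_null e 0) ?subr0// ip0l.
Qed.

Lemma shift_opp A (s w : R) f :
  opshift (fun f => s *: f - A f) w f = - opshift A (s - w) f.
Proof. by rewrite /opshift scalerBl !opprB [LHS]addrAC addrC addrA addrAC. Qed.

Lemma invertible_opp K A (s w : R) : subspace K ->
  invertible K (opshift A (s - w)) -> invertible K (opshift (fun f => s *: f - A f) w).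
Proof.
move=> sK [surj [c c0 hc]]; split; last first.
  by exists c => // f Kf; rewrite shift_opp ipNl ipNr opprK; exact: hc.
move=> f Kf; have [|h Kh hf] := surj (- f).
  by rewrite -scaleN1r; exact: subspaceZ.
exists h => //; rewrite shift_opp -opprD ipNl ipNr opprK.
by rewrite -[f]opprK.
Qed.

(* As [E] consists of eigenvectors, its orthogonal complement is invariant
   under the symmetric operator [A]. *)
Definition finite_above X A (mu : R) := exists2 E, eigenvectors X A E &
  forall f, X f -> orth E f -> ip (A f) f <= mu * sq f.

(** A point of the resolvent set, or an isolated eigenvalue of finite multiplicity. Finite
    multiplicity is encoded by a finite list such that an eigenvector orthogonal to it is null,
    which avoids bases and dimensions. *)
Definition discrete_at X A (s : R) := exists2 eta : R, 0 < eta &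
  (forall w, 0 < `|w - s| < eta -> invertible X (opshift A w)) /\
  (exists2 E, eigenvectors X A E &
    forall f, X f -> sq (opshift A s f) = 0 -> orth E f -> sq f = 0).

(** On the complement of both lists the form of [s - A] is at least [s - mu]. This bound moves up to
    [0], since the points of [(s, mu]] are regular for [A]. Now [s - A] is nonnegative with trivial
    kernel and the gap [(0, eta)], hence at least [eta]. *)
Lemma finite_above_step X A (s mu : R) : subspace X -> sqcomplete X ->
  symop X A -> bounded_on X A -> forall eta, 0 < eta ->
  (forall w, 0 < `|w - s| < eta -> invertible X (opshift A w)) ->
  (exists2 E, eigenvectors X A E &
    forall f, X f -> sq (opshift A s f) = 0 -> orth E f -> sq f = 0) ->
  s <= mu < s + eta -> finite_above X A mu -> finite_above X A (s - eta).
Proof.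
move=> sX cX sA bA eta eta0 inv [F eF hF] /andP[smu mus] [E eE hE].
have eG : eigenvectors X A (E ++ F).
  by move=> e; rewrite mem_cat => /orP[/eE|/eF].
exists (E ++ F) => // f Xf Gf.
pose K := predI X (orth (E ++ F)).
have sK : subspace K by exact: subspace_orth.
have KA : symop K A by exact: symop_orth.
have bK : bounded_on K A by case: bA => M hM; exists M => g /andP[Xg _]; exact: hM.
have KS (r : R) : symop K (fun f => r *: f - A f) /\
    bounded_on K (fun f => r *: f - A f).
  have e g : r *: g - A g = (-1) *: opshift A r g by rewrite scaleN1r opprB.
  have [KH1 KH2] := symop_opshift K A r sK KA; split; first split.
  - by move=> g Kg; rewrite e; apply: subspaceZ => //; exact: KH1.
  - by move=> g h Kg Kh; rewrite !e ipZl ipZr KH2.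
  - have [M hM] := bounded_opshift K A r bK; exists M => g Kg.
    by rewrite e sqZ sqrrN expr1n mul1r; exact: hM.
have invK w : 0 < `|w - s| < eta -> invertible K (opshift A w).
  by move=> /inv; exact: invertible_orth.
pose T g := s *: g - A g.
have [sT bT] := KS s.
have T0 g : K g -> 0 <= ip (T g) g.
  move=> Kg; rewrite -(mul0r (sq g)).
  apply: (form_ge_extend K T (s - mu) 0) => //; last by rewrite subr_le0.
    move=> h /andP[Xh]; rewrite orth_cat => /andP[Eh _].
    by have := hE _ Xh Eh; rewrite /T !ipE; lra.
  move=> w /andP[w1 w2]; have [||//] := invertible_opp K A s w => //.
  apply: invK; rewrite (_ : s - w - s = - w); last by ring.
  by rewrite gtr0_norm; lra.
have := form_ge_gap K T eta sK _ sT bT T0 eta0 _ _ f.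
rewrite /T !ipE => H; suff : eta * sq f <= s * sq f - ip (A f) f by lra.
apply: H => [|w w0|g /andP[Xg]|].
- exact: sqcomplete_orth.
- apply: invertible_opp => //; apply: invK.
  have -> : s - w - s = - w by ring.
  by rewrite normrN gtr0_norm//; case/andP: w0.
- rewrite orth_cat => /andP[_ Fg] Tg; apply: hF => //.
  by rewrite /opshift sqBC.
- by rewrite /K/= Xf.
Qed.

Lemma finite_aboveW X A (mu nu : R) : mu <= nu -> finite_above X A mu ->
  finite_above X A nu.
Proof.
move=> munu [E eE hE]; exists E => // f Xf Ef; apply: le_trans (hE _ Xf Ef) _.
exact: ler_wpM2r.
Qed.

(** The empty list serves above the bound of the form. The infimum of the admissible bounds in
    [[mu, oo)] is a discrete point, and the preceding step passes below it; so the descent ends only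
    at [mu]. *)
Lemma discrete_finite_above X A (mu : R) : subspace X -> sqcomplete X ->
  symop X A -> bounded_on X A ->
  (forall s, mu <= s -> discrete_at X A s) -> finite_above X A mu.
Proof.
move=> sX cX sA bA disc.
pose B := [set s | mu <= s /\ finite_above X A s]%classic.
have [N N0 hN] := bounded_form _ _ bA.
have BN : B (Num.max mu N).
  split; first by rewrite le_max lexx.
  exists [::] => // f Xf _; apply: le_trans (ler_norm _) _.
  apply: le_trans (hN _ Xf) _; apply: ler_wpM2r => //.
  by rewrite le_max lexx orbT.
have infB : has_inf B by split; [exists (Num.max mu N)|exists mu => s []].
pose s := inf B.
have mus : mu <= s by apply: lb_le_inf; [case: infB|move=> r []].
have [eta eta0 [inv ker]] := disc _ mus.
have [r [mur Br] rs] : exists2 r, B r & r < s + eta by exact: inf_adherent.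
have sr : s <= r by apply: ge_inf => //; case: infB.
have P : finite_above X A (s - eta).
  by apply: (finite_above_step X A s r) => //; rewrite sr.
have [smu|mus'] := leP (s - eta) mu; first exact: finite_aboveW P.
have : B (s - eta) by split=> //; exact: ltW.
move=> /(ge_inf infB.2); rewrite -/s; lra.
Qed.

(** * Symmetric linear relations and their resolvents *)

Section symmetric_relation.
Variable Sr : V -> V -> Prop.
Hypothesis Sr0 : Sr 0 0.
Hypothesis Sr_lin : forall a f g f' g', Sr f g -> Sr f' g' ->
  Sr (a *: f + f') (a *: g + g').
Hypothesis Sr_sym : forall f g f' g', Sr f g -> Sr f' g' -> ip f g' = ip g f'.
Hypothesis Sr_null : forall f g f' g', Sr f g ->
  sq (f - f') = 0 -> sq (g - g') = 0 -> Sr f' g'.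
Hypothesis V_complete : sqcomplete predT.

Definition domcl : pred V := fun f =>
  `[< forall e : R, 0 < e -> exists h k, Sr h k /\ sq (f - h) < e >].

Lemma domclP f :
  reflect (forall e : R, 0 < e -> exists h k, Sr h k /\ sq (f - h) < e) (domcl f).
Proof. exact: asboolP. Qed.

Lemma Sr_domcl f g : Sr f g -> domcl f.
Proof.
by move=> fg; apply/domclP => e e0; exists f, g; rewrite subrr ip0l.
Qed.

Lemma subspace_domcl : subspace domcl.
Proof.
split=> [|a u v /domclP Xu /domclP Xv]; first exact: Sr_domcl Sr0.
apply/domclP => e e0.
have [|h [k [hk uh]]] := Xu (e / (4 * (a ^+ 2 + 1))).
  by rewrite divr_gt0// mulr_gt0// ltr_wpDl// sqr_ge0.
have [|h' [k' [hk' vh]]] := Xv (e / 4); first by rewrite divr_gt0.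
exists (a *: h + h'), (a *: k + k'); split; first exact: Sr_lin.
rewrite opprD addrACA -scalerBr; apply: le_lt_trans (sqD_le _ _) _.
move: uh vh; rewrite sqZ !ltr_pdivlMr ?mulr_gt0 ?ltr_wpDl ?sqr_ge0//.
by have := ip_ge0 (u - h); have := sqr_ge0 a; nra.
Qed.

Lemma sqclosed_domcl : sqclosed domcl.
Proof.
move=> u v Xu uv; apply/domclP => e e0.
have [|N hN] := uv (e / 4); first by rewrite divr_gt0.
have [|h [k [hk uh]]] := domclP _ (Xu N) (e / 4); first by rewrite divr_gt0.
exists h, k; split=> //; have -> : v - h = (u N - h) - (u N - v).
  by rewrite opprB [in RHS]addrC -addrA (addrA (- u N)) addNr sub0r.
apply: le_lt_trans (sqB_le _ _) _; have := hN N (leqnn _); lra.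
Qed.

Lemma sqcomplete_domcl : sqcomplete domcl.
Proof.
move=> u Xu /(V_complete u (fun=> isT))[v _ uv].
by exists v => //; exact: sqclosed_domcl uv.
Qed.

Lemma domcl_null f f' : domcl f -> sq (f - f') = 0 -> domcl f'.
Proof.
move=> Xf ff'; apply: (sqclosed_domcl (fun=> f)) => // e e0.
by exists 0%N => n _; rewrite ff'.
Qed.

(** Restricting the second entry to the closure of the domain discards the multi-valued part. *)
Definition relop f g := [/\ Sr f g, domcl f & domcl g].

Definition regular (l : R) :=
  (forall h, domcl h -> exists f g, relop f g /\ sq (g - l *: f - h) = 0) /\
  (exists c : R, forall f g, relop f g -> sq f <= c * sq (g - l *: f)).

Definition is_resolvent (l : R) T := [/\ symop domcl T, bounded_on domcl T,
  (forall h, domcl h -> relop (T h) (h + l *: T h)) &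
  (forall f g, relop f g -> sq (T (g - l *: f) - f) = 0)].

(** Solutions are chosen point by point; symmetry of the resulting function follows from that of the
    relation, applied to the pairs [(T h, h + l T h)]. *)
Lemma regular_resolvent l : regular l -> exists T, is_resolvent l T.
Proof.
move=> [surj [c hc]]; have sX := subspace_domcl.
have /choice[T hT] : forall h, exists f, domcl h -> relop f (h + l *: f).
  move=> h; have [Xh|nXh] := boolP (domcl h); last by exists 0.
  have [f [g [[fg Xf Xg] e]]] := surj _ Xh; exists f => _; split=> //.
    apply: Sr_null fg _ _; first by rewrite subrr ip0l.
    by rewrite opprD addrA addrAC.
  by apply: subspaceD => //; exact: subspaceZ.
exists T; split.
- split=> [f /hT[]//|f g /hT[h1 _ _] /hT[h2 _ _]].
  by have := Sr_sym _ _ _ _ h1 h2; rewrite !ipE => /addIr.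
- exists c => f Xf; have := hc _ _ (hT _ Xf).
  by rewrite addrK.
- exact: hT.
- move=> f g [fg Xf Xg].
  have [|h1 X1 X2] := hT (g - l *: f).
    by apply: subspaceB => //; exact: subspaceZ.
  set h := g - l *: f in h1 X1 X2 *.
  have : relop (T h - f) (h + l *: T h - g).
    split; [|exact: subspaceB|exact: subspaceB].
    by have := Sr_lin (-1) _ _ _ _ fg h1; rewrite !scaleN1r ![- _ + _]addrC.
  move=> /hc; have -> : sq (h + l *: T h - g - l *: (T h - f)) = 0.
    by move: (T h) => t; rewrite /h !ipE; ring.
  by rewrite mulr0 => h0; apply/eqP; rewrite eq_le h0 ip_ge0.
Qed.

Lemma relop_lin a f g f' g' : relop f g -> relop f' g' ->
  relop (a *: f + f') (a *: g + g').
Proof.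
have [X0 XD] := subspace_domcl.
by move=> [? ? ?] [? ? ?]; split; [exact: Sr_lin|exact: XD|exact: XD].
Qed.

Lemma relop_null f g f' g' : relop f g -> sq (f - f') = 0 -> sq (g - g') = 0 ->
  relop f' g'.
Proof.
move=> [fg Xf Xg] ff' gg'; split; first exact: Sr_null fg ff' gg'.
- exact: domcl_null ff'.
- exact: domcl_null gg'.
Qed.

(** With [d = l - l0] and [T] the resolvent at [l], the inverse of [A - 1 / d] is [- d (1 + d T)].
    For the lower bound, [A h] is estimated by regularity at [l], and then
    [h = d A h + (h - d A h)]. *)
Lemma resolvent_invertible l0 l A : is_resolvent l0 A -> regular l -> l != l0 ->
  invertible domcl (opshift A (l - l0)^-1).
Proof.
move=> [sA bA rA uA] rl ll0; have sX := subspace_domcl.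
have [T [sT bT rT uT]] := regular_resolvent _ rl.
have d0 : l - l0 != 0 by rewrite subr_eq0.
pose d := l - l0; have lE : l = l0 + d by rewrite /d; ring.
rewrite -/d in d0 *; split.
  move=> k Xk; have r := rT _ Xk; exists (- d *: (k + d *: T k)).
    apply: subspaceZ => //; apply: subspaceD => //; apply: subspaceZ => //.
    by case: r.
  have := uA _ _ r.
  have hx x : domcl x ->
      ip (A (- d *: (k + d *: T k))) x = - d * ip (A (k + l *: T k - l0 *: T k)) x.
    move=> Xx; case: r => _ XTk Xg.
    have XTl0 : domcl (l0 *: T k) by exact: subspaceZ.
    have X1 : domcl (k + d *: T k) by apply: subspaceD => //; exact: subspaceZ.
    rewrite !sA.2//; first by rewrite lE !ipE; ring.
    - exact: subspaceB.
    - exact: subspaceZ.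
  move=> h1; set h := _ *: _ in hx *.
  have Xh : domcl h.
    apply: subspaceZ => //; apply: subspaceD => //; apply: subspaceZ => //.
    by case: r.
  rewrite (weak_sq domcl _ 0) ?ip0l//.
  - apply: subspaceB => //; first exact: (symop_opshift domcl A d^-1 sX sA).1.
  - by case: sX.
  - move=> x Xx; rewrite /opshift ip0l ipDl ipNl ipDl ipNl ipZl hx//.
    rewrite (sqB_null _ _ x h1) /h !ipE; field.
    by rewrite d0.
have [c hc] := rl.2.
have C0 : 0 < 2 * d ^+ 2 * (`|c| * d ^+ 2 + 1).
  have D0 : 0 < d ^+ 2 by rewrite exprn_even_gt0.
  have c1 : 0 <= `|c| * d ^+ 2 by rewrite mulr_ge0// ltW.
  by rewrite mulr_gt0//; lra.
exists (2 * d ^+ 2 * (`|c| * d ^+ 2 + 1))^-1 => [|h Xh]; first by rewrite invr_gt0.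
have h1 := hc _ _ (rA _ Xh); rewrite ler_pdivrMl//.
have e1 : sq (h + l0 *: A h - l *: A h) = d ^+ 2 * sq (opshift A d^-1 h).
  by rewrite /opshift; move: (A h) => a; rewrite lE !ipE (ipC a h); field.
have e2 : sq (h - d *: A h) = d ^+ 2 * sq (opshift A d^-1 h).
  by rewrite /opshift; move: (A h) => a; rewrite !ipE (ipC a h); field.
move: h1; rewrite e1 => h1.
have h2 := sqD_le (d *: A h) (h - d *: A h); move: h2.
rewrite addrC subrK e2 sqZ; move: (ip_ge0 (opshift A d^-1 h)) h1.
move: (sq (opshift _ _ _)) (sq (A h)) (sqr_ge0 d) (ler_norm c) => N a.
move: (d ^+ 2) => D D0 cc N0 h1 h2; apply: le_trans h2 _.
have : c * (D * N) <= `|c| * (D * N) by apply: ler_wpM2r => //; exact: mulr_ge0.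
have : D * a <= D * (c * (D * N)) by exact: ler_wpM2l.
nra.
Qed.

(** [(S - l') f = k] is solved by [f = T h], where [h] is a fixed point of [h -> k + d T h] with
    [d = l' - l]. For small [d] this is a contraction, and the closure of the domain is complete. *)
Lemma regular_nbhs l : regular l ->
  exists2 eta : R, 0 < eta & forall l', `|l' - l| < eta -> regular l'.
Proof.
move=> rl; have sX := subspace_domcl.
have [T [sT [M0 hM0] rT uT]] := regular_resolvent _ rl.
pose M := `|M0| + 1; have M1 : 1 <= M by rewrite ler_wpDl.
have hM f : domcl f -> sq (T f) <= M * sq f.
  move=> Xf; apply: le_trans (hM0 _ Xf) _; apply: ler_wpM2r => //.
  by rewrite (le_trans (ler_norm _))// lerDl.
(* [M] bounds the square of the norm of [T]. As [M >= 1], [|d| <= 1 / (2 M)] gives [4 d^2 M <= 1],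
   so [d T] at least halves norms. *)
exists (2 * M)^-1 => [|l' ll']; first by rewrite invr_gt0; lra.
pose d := l' - l; have l'E : l' = l + d by rewrite /d; ring.
have dM : 4 * (d ^+ 2 * M) <= 1.
  have : `|d| * (2 * M) <= 1 by rewrite -ler_pdivlMr ?div1r ?ltW//; lra.
  rewrite -(real_normK (num_real d)); have := normr_ge0 d; nra.
split; last first.
  exists (4 * M) => f g fg; have [_ Xf Xg] := fg.
  have Xgf : domcl (g - l *: f) by apply: subspaceB => //; exact: subspaceZ.
  have := hM _ Xgf; rewrite (sq_eq_null _ _ (uT _ _ fg)).
  have := sqD_le (g - l' *: f) (d *: f).
  have -> : g - l' *: f + d *: f = g - l *: f.
    by rewrite -addrA -scaleNr -scalerDl l'E opprD subrK scaleNr.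
  rewrite sqZ; have := ip_ge0 f; have := sqr_ge0 d; nra.
move=> k Xk.
have XT h : domcl h -> domcl (T h) by case: sT => + _; apply.
pose Phi h := k + d *: T h.
have XPhi h : domcl h -> domcl (Phi h).
  by move=> Xh; apply: subspaceD => //; apply/subspaceZ/XT.
have contr h h' : domcl h -> domcl h' -> 4 * sq (Phi h - Phi h') <= sq (h - h').
  move=> Xh Xh'; have Xhh' : domcl (h - h') by exact: subspaceB.
  have -> : sq (Phi h - Phi h') = d ^+ 2 * sq (T (h - h')).
    rewrite -sqZ; apply: (weak_sq domcl) => [||x Xx].
    - by apply: subspaceB => //; exact: XPhi.
    - by apply: subspaceZ => //; exact: XT.
    by rewrite /Phi !ipE !sT.2// !ipE; ring.
  have := hM _ Xhh'; have := ip_ge0 (h - h'); have := sqr_ge0 d; nra.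
pose u n := iter n Phi k.
have Xu n : domcl (u n) by elim: n => //= n; exact: XPhi.
pose C := sq (u 1%N - u 0%N).
have step n : 4 ^+ n * sq (u n.+1 - u n) <= C.
  elim: n => [|n IH]; first by rewrite mul1r.
  apply: le_trans IH; rewrite exprSr -mulrA; apply: ler_wpM2l; first exact: exprn_ge0.
  exact: contr (Xu n.+1) (Xu n).
have steps p n : 4 ^+ n * sq (u (p + n)%N - u n) <= 4 * C.
  elim: p n => [|p IH] n; first by rewrite subrr ip0l mulr0 mulr_ge0// ip_ge0.
  have := sqD_le (u (p + n.+1)%N - u n.+1) (u n.+1 - u n).
  rewrite addrA subrK addSnnS => h1.
  apply: (@le_trans _ _ (4 ^+ n * (2 * sq (u (p + n.+1)%N - u n.+1) + 2 * sq (u n.+1 - u n)))).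
    by apply: ler_wpM2l => //; exact: exprn_ge0.
  have := IH n.+1; have := step n; rewrite exprS; lra.
have cau : cauchysq u.
  move=> r r0; pose N := Num.bound (16 * C / r).
  have hN : 16 * C < r * 4 ^+ N.
    rewrite [ltRHS]mulrC -ltr_pdivrMr//.
    have C16 : 0 <= 16 * C / r by rewrite divr_ge0 ?mulr_ge0 ?ip_ge0// ltW.
    apply: lt_trans (archi_boundP C16) _; rewrite -/N -natrX ltr_nat.
    exact: ltn_expl.
  have hu n : (N <= n)%N -> 4 ^+ N * sq (u n - u N) <= 4 * C.
    by move=> Nn; rewrite -(subnK Nn); exact: steps.
  exists N => m n Nm Nn.
  have -> : u m - u n = (u m - u N) - (u n - u N) by rewrite opprB addrA subrK.
  rewrite -(ltr_pM2l (_ : 0 < 4 ^+ N)) ?exprn_gt0//.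
  apply: le_lt_trans (_ : _ <= 16 * C) _; last by rewrite [ltRHS]mulrC.
  apply: (@le_trans _ _ (4 ^+ N * (2 * sq (u m - u N) + 2 * sq (u n - u N)))).
    by apply: ler_wpM2l (sqB_le _ _); exact: exprn_ge0.
  by have := hu _ Nm; have := hu _ Nn; lra.
have [h Xh uh] := sqcomplete_domcl u Xu cau.
have fix_h : sq (Phi h - h) = 0.
  apply/eqP; rewrite eq_le ip_ge0 andbT; apply/ler_addgt0Pl => r r0; rewrite addr0.
  have [|N hN] := uh (r / 4); first by rewrite divr_gt0.
  have -> : Phi h - h = (u N.+1 - h) - (Phi (u N) - Phi h).
    by rewrite (_ : u N.+1 = Phi (u N))// opprB [RHS]addrC addrA subrK.
  apply: le_trans (sqB_le _ _) _.
  have := hN N.+1 (leqnSn _); have := hN N (leqnn _).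
  by have := contr _ _ (Xu N) Xh; have := ip_ge0 (Phi (u N) - Phi h); lra.
exists (T h), (h + l *: T h); split; first exact: rT.
by rewrite -[RHS]fix_h /Phi; move: (T h) => t; rewrite l'E !ipE; ring.
Qed.

Definition discrete_or_regular (l : R) := exists2 eta : R, 0 < eta &
  (forall w, 0 < `|w - l| < eta -> regular w) /\
  (exists2 E : seq V, forall e, e \in E -> relop e (l *: e) &
    forall f, relop f (l *: f) -> orth E f -> sq f = 0).

Lemma regular_discrete l : regular l -> discrete_or_regular l.
Proof.
move=> rl; have [eta eta0 near] := regular_nbhs _ rl.
exists eta => //; split=> [w /andP[_ /near]//|]; exists [::] => // f ff _.
case: rl => _ [c hc]; apply/eqP; rewrite eq_le ip_ge0 andbT.
by apply: le_trans (hc _ _ ff) _; rewrite subrr ip0l mulr0.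
Qed.

(** The map [l -> 1 / (l - l0)] carries regular points and eigenvalues of the relation to those of
    its resolvent, with the same eigenvectors. *)
Lemma resolvent_discrete l0 l A : is_resolvent l0 A -> l0 < l ->
  discrete_or_regular l -> discrete_at domcl A (l - l0)^-1.
Proof.
move=> rA l0l [eta eta0 [near [E eE hE]]]; have [sA bA opA uA] := rA.
pose s := (l - l0)^-1; have s0 : 0 < s by rewrite invr_gt0 subr_gt0.
have lE : l = l0 + s^-1 by rewrite invrK; ring.
(* [w > s / 2] gives [|1 / w - 1 / s| = |w - s| / (s w) < 2 |w - s| / s^2 < eta]. *)
exists (Num.min (s / 2) (eta * s ^+ 2 / 2)).
  by rewrite lt_min !divr_gt0// mulr_gt0// exprn_gt0.
rewrite -/s; split=> [w|].
  rewrite lt_min => /andP[ws0 /andP[ws1 ws2]].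
  have w2 : s / 2 < w by move: ws1; rewrite ltr_norml => /andP[h _]; lra.
  have w0 : 0 < w by apply: lt_trans w2; rewrite divr_gt0.
  have -> : w = (l0 + w^-1 - l0)^-1 by rewrite addrC addKr invrK.
  apply: resolvent_invertible => //; last first.
    by rewrite -subr_eq0 addrC addKr invr_eq0 gt_eqF.
  apply: near; rewrite lE opprD addrACA subrr add0r.
  have -> : w^-1 - s^-1 = (s - w) / (s * w) by field; rewrite !gt_eqF.
  rewrite normrM distrC normfV (ger0_norm (ltW (mulr_gt0 s0 w0))).
  rewrite divr_gt0 ?mulr_gt0// ltr_pdivrMr ?mulr_gt0//.
  apply: lt_le_trans ws2 _; rewrite -mulrA; apply: ler_wpM2l; first exact: ltW.
  by rewrite expr2 -mulrA; apply: ler_wpM2l; exact: ltW.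
exists E => [e ee|f Xf Af Ef].
  have r := eE _ ee; have [_ Xe _] := r; split=> //.
  exists s => x Xx; have := sqB_null _ _ x (uA _ _ r).
  rewrite -scalerBl sA.2//; last exact: subspaceZ subspace_domcl Xe.
  rewrite !ipE -sA.2// => h.
  by rewrite /s -h mulKf// subr_eq0 gt_eqF.
apply: hE => //.
have [S1 X1 X2] := opA _ Xf.
have X0 : domcl 0 by case: subspace_domcl.
have r0 : relop 0 0 by split.
(* Since [A f = s f], the pair [(A f, f + l0 A f)] scaled by [1 / s] is [(f, l f)] up to null
   vectors. *)
have := relop_lin s^-1 _ _ _ _ (opA _ Xf) r0; rewrite !addr0 => r1.
have Aff : ip (A f) f = s * sq f by have := sqB_null _ _ f Af; rewrite ipZl.
have AfAf : sq (A f) = s * (s * sq f).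
  by have := sqB_null _ _ (A f) Af; rewrite ipZl (ipC f) Aff.
have s_neq0 : s != 0 by rewrite gt_eqF.
rewrite lE; move: (A f) Aff AfAf r1 => a aE aaE r1.
by apply: (relop_null _ _ _ _ r1); rewrite !ipE (ipC f a) aaE aE; field.
Qed.

(** With [A = (S + 1)^-1], which is at most [(1 + L)^-1] on the complement of [E], the claim is
    [||F||^2 <= (1 + L)^-1 <F + G, F>]. Were [F + G] in the closure of the domain, [F] would be
    [A (F + G)]; in general the identity [<F, k> = <F + G, A k>] replaces this. The inverse of [A],
    possibly unbounded, is approximated by that of [A + d]. *)
Lemma form_ge_finite_codim (L : R) : 0 <= L ->
  (forall l, l < 0 -> regular l) ->
  (forall l, 0 <= l <= L -> discrete_or_regular l) ->
  exists E, forall F G, Sr F G -> orth E F -> L * sq F <= ip G F.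
Proof.
move=> L0 neg disc; have sX := subspace_domcl.
have [A rA] := regular_resolvent (-1) (neg _ (ltrN10 R)).
have [sA bA opA uA] := rA.
have mu0 : 0 < (1 + L)^-1 by rewrite invr_gt0; lra.
have [|E eE hE] := discrete_finite_above domcl A (1 + L)^-1 sX sqcomplete_domcl sA bA.
  move=> s mus; have s0 : 0 < s by apply: lt_le_trans mus.
  have -> : s = (s^-1 - 1 - (-1))^-1 by rewrite opprK subrK invrK.
  apply: resolvent_discrete => //.
    by rewrite ltrBrDr addNr invr_gt0.
  have [h|h] := ltP (s^-1 - 1) 0; first exact/regular_discrete/neg.
  apply: disc; rewrite h lerBlDr addrC -[leRHS]invrK lef_pV2 ?posrE//.
have neg_inv w : w < 0 -> invertible domcl (opshift A w).
  move=> w0; have -> : w = (w^-1 - 1 - (-1))^-1 by rewrite opprK subrK invrK.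
  have : w^-1 < 0 by rewrite invr_lt0.
  by move=> h; apply: resolvent_invertible => //; [apply: neg; lra|rewrite lt_eqF//; lra].
have A0 f : domcl f -> 0 <= ip (A f) f.
  move=> Xf; rewrite -(mul0r (sq f)); have [M M0 hM] := bounded_form _ _ bA.
  apply: (form_ge_extend domcl A (- M) 0) => //.
  - by move=> g Xg; have := hM _ Xg; rewrite ler_norml mulNr => /andP[].
  - by move=> w /andP[_ /neg_inv[]].
  - by rewrite oppr_le0 ltW.
exists E => F G FG EF; have XF := Sr_domcl _ _ FG.
have [P PE] : exists P, P = F + G by eexists.
have FP k : domcl k -> ip F k = ip P (A k).
  move=> Xk; have [h _ _] := opA _ Xk; have := Sr_sym _ _ _ _ FG h.
  by rewrite PE !ipE => e; rewrite -e; ring.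
have P0 := ip_ge0 P; have F0 := ip_ge0 F.
(* With [h = (A + d)^-1 F], Cauchy-Schwarz for the form of [A + d] bounds [||F||^4] by
   [<F, h> <(A + d) F, F>], and [<F, h> = <P, F> - d <P, h>]. *)
have key d : 0 < d -> sq F <= ((1 + L)^-1 + d) * (ip P F + d * sq P).
  move=> d0; have [surj _] : invertible domcl (opshift A (- d)).
    by apply: neg_inv; rewrite oppr_lt0.
  have [h Xh hF] := surj _ XF; have [h2 Xh2 hh] := surj _ Xh.
  have Fx x : ip F x = ip (A h) x + d * ip h x.
    by rewrite -(sqB_null _ _ x hF) /opshift scaleNr opprK !ipE.
  have hx x : ip h x = ip (A h2) x + d * ip h2 x.
    by rewrite -(sqB_null _ _ x hh) /opshift scaleNr opprK !ipE.
  have hP : sq h = ip P (A h2).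
    by rewrite -FP// Fx sA.2// [LHS]hx (ipC (A h2)) (ipC h2).
  have Ah2h : sq (A h2) <= sq h.
    rewrite -(sq_eq_null _ _ hh) /opshift scaleNr opprK.
    have := A0 _ Xh2; have := ip_ge0 h2; move: (A h2) => a h1 h3.
    rewrite !ipE (ipC h2 a); have := mulr_ge0 (ltW d0) h3.
    have := mulr_ge0 (ltW d0) (mulr_ge0 (ltW d0) h1); lra.
  (* From [||h||^2 = <P, A h2>] and [||A h2|| <= ||h||]; so [h] stays bounded as [d] tends to 0. *)
  have h_le : sq h <= sq P.
    have [->//|/eqP ne] := pselect (sq h = 0).
    have p : 0 < sq h by rewrite lt_neqAle eq_sym ne ip_ge0.
    rewrite -(ler_pM2r p) -expr2 {1}hP; apply: le_trans (ip_cauchy_schwarz _ _) _.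
    by apply: ler_wpM2l.
  have sT := symop_opshift _ _ (- d) sX sA.
  have T0 x : domcl x -> 0 <= ip (opshift A (- d) x) x.
    move=> Xx; rewrite /opshift scaleNr opprK ipDl ipZl addr_ge0 ?A0//.
    by rewrite mulr_ge0// ltW.
  have := symop_form_cs domcl (opshift A (- d)) h F sX sT T0 Xh XF.
  rewrite !(sqB_null _ _ _ hF) => cs.
  have hFF : ip (opshift A (- d) F) F <= ((1 + L)^-1 + d) * sq F.
    by rewrite /opshift scaleNr opprK ipDl ipZl mulrDl lerD2r; exact: hE.
  have Fh0 : 0 <= ip F h by rewrite -(sqB_null _ _ h hF); exact: T0.
  have Fh : ip F h <= ip P F + d * sq P.
    have -> : ip F h = ip P F - d * ip P h.
      by rewrite FP// ![ip P _]ipC (Fx P); ring.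
    rewrite lerD2l -mulrN; apply: ler_wpM2l; first exact: ltW.
    have := ip_ge0 (P + h); rewrite !ipE (ipC h P).
    by lra.
  have mud : 0 <= (1 + L)^-1 + d by rewrite addr_ge0// ltW.
  have [->|/eqP ne] := pselect (sq F = 0).
    by apply: mulr_ge0 => //; exact: le_trans Fh.
  have p : 0 < sq F by rewrite lt_neqAle eq_sym ne.
  rewrite -(ler_pM2r p) -expr2; apply: le_trans cs _.
  apply: (@le_trans _ _ (ip F h * (((1 + L)^-1 + d) * sq F))).
    by apply: ler_wpM2l.
  by rewrite mulrCA mulrA; apply: ler_wpM2r => //; apply: ler_wpM2l.
have lim : sq F <= (1 + L)^-1 * ip P F.
  apply/ler_addgt0Pr => r r0.
  set m := (1 + L)^-1 in mu0 key *.
  pose C := `|ip P F| + (m + 1) * sq P + 1.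
  have C1 : 1 <= C.
    rewrite lerDr addr_ge0// mulr_ge0// addr_ge0// ltW//.
  pose d := Num.min 1 (r / C).
  have d0 : 0 < d by rewrite lt_min ltr01 divr_gt0//; lra.
  have d1 : d <= 1 by rewrite ge_min lexx.
  have dC : d * C <= r by rewrite -ler_pdivlMr ?ge_min ?lexx ?orbT//; lra.
  apply: le_trans (key _ d0) _.
  have := ler_norm (ip P F).
  have : d * d * sq P <= d * sq P.
    by apply: ler_wpM2r => //; rewrite ger_pMl.
  move: dC; rewrite /C; move: `|_| => N dC h1 h2.
  have : d * ip P F <= d * N by apply: ler_wpM2l => //; exact: ltW.
  by lra.
move: lim; rewrite -(ler_pM2l (_ : 0 < 1 + L)) ?mulVKf; [|lra|lra].
by rewrite PE !ipE; lra.
Qed.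

Lemma disjoint_trials_absurd (L kappa : R) : 0 <= L ->
  (forall l, l < 0 -> regular l) ->
  (forall l, 0 <= l <= L -> discrete_or_regular l) ->
  1 < kappa * L ->
  (forall n, exists F G : 'I_n -> V, [/\ forall i, Sr (F i) (G i),
    forall i, 0 < sq (G i), forall i, kappa * sq (G i) <= ip (F i) (G i) &
    forall i j, i != j -> ip (F i) (G j) = 0 /\ ip (G i) (G j) = 0]) ->
  False.
Proof.
move=> L0 neg disc kL trial.
have [E hE] := form_ge_finite_codim L L0 neg disc.
have [F [G [FG G0 Gk dis]]] := trial (size E).+1.
(* There is one pair more than there are conditions, so some nonzero combination of the pairs is
   orthogonal to all of [E]. *)
pose M := \matrix_(i < (size E).+1, j < size E) ip (F i) (nth 0 E j).
have [c cM c0] : exists2 c : 'rV[R]_(size E).+1, c *m M = 0 & c != 0.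
  have : kermx M != 0.
    by rewrite kermx_eq0 /row_free neq_ltn (leq_ltn_trans (rank_leq_col _)).
  by move=> /rowV0Pn[c /sub_kermxP cM c0]; exists c.
pose FF := \sum_i c 0 i *: F i; pose GG := \sum_i c 0 i *: G i.
have FFGG : Sr FF GG.
  rewrite /FF /GG; elim/big_rec2: _ => // i f g _ fg; exact: Sr_lin.
have ip_suml (n : nat) (u : 'I_n -> V) w : ip (\sum_i u i) w = \sum_i ip (u i) w.
  by elim/big_rec2: _ => [|i a b _ <-]; rewrite ?ip0l ?ipDl.
have ip_sumr (n : nat) (u : 'I_n -> V) w : ip w (\sum_i u i) = \sum_i ip w (u i).
  by rewrite ipC ip_suml; apply: eq_bigr => i _; rewrite ipC.
have diag (U : 'I_(size E).+1 -> V) : (forall i j, i != j -> ip (U i) (G j) = 0) ->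
    ip (\sum_i c 0 i *: U i) GG = \sum_i c 0 i ^+ 2 * ip (U i) (G i).
  move=> hU; rewrite ip_suml; apply: eq_bigr => i _.
  rewrite ip_sumr (bigD1 i)//= big1 ?addr0 => [|j ij].
    by rewrite ipZl ipZr mulrA expr2.
  by rewrite ipZl ipZr hU ?mulr0// eq_sym.
have FG_ge : kappa * sq GG <= ip FF GG.
  rewrite !diag; [|by move=> i j /dis[]..].
  rewrite mulr_sumr; apply: ler_sum => i _; rewrite mulrCA.
  by apply: ler_wpM2l => //; exact: sqr_ge0.
have GG0 : 0 < sq GG.
  rewrite diag; last by move=> i j /dis[].
  have [i ci] : exists i, c 0 i != 0.
    apply/existsP; apply: contra_neqT c0; rewrite negb_exists => /forallP h.
    by apply/rowP => i; rewrite mxE; apply/eqP; move: (h i); rewrite negbK.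
  rewrite (bigD1 i)//=; apply: ltr_pwDl; first by rewrite mulr_gt0 ?exprn_even_gt0.
  by apply: sumr_ge0 => j _; apply: mulr_ge0; [exact: sqr_ge0|exact: ip_ge0].
have EFF : orth E FF.
  apply/allP => e /(nthP 0)[j jE <-]; rewrite ip_suml.
  have /matrixP/(_ 0 (Ordinal jE)) := cM; rewrite !mxE => h.
  by apply/eqP; rewrite -[RHS]h; apply: eq_bigr => i _; rewrite ipZl mxE.
have := hE _ _ FFGG EFF; rewrite (ipC GG) => h1.
have := ip_cauchy_schwarz FF GG.
have := ip_ge0 FF.
have k0 : 0 < kappa.
  by rewrite ltNge; apply/negP => k0; have := mulr_le0_ge0 k0 L0; lra.
move: h1 FG_ge GG0; move: (ip FF GG) (sq GG) (sq FF) => q g f Lq kq g0 f0 qfg.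
have q0 : 0 < q by apply: lt_le_trans kq; exact: mulr_gt0.
(* Against Cauchy-Schwarz, [q^2 <= f g], this is absurd because [f g > 0] and [kappa L > 1]. *)
have : (kappa * L) * (f * g) <= q ^+ 2.
  have -> : kappa * L * (f * g) = (L * f) * (kappa * g) by ring.
  by rewrite expr2; apply: ler_pM => //; rewrite mulr_ge0// ltW.
have : 0 < f * g by apply: lt_le_trans qfg; rewrite exprn_gt0.
nra.
Qed.

End symmetric_relation.

End semi_inner_product.

Set Implicit Arguments.
Unset Strict Implicit.
Unset Printing Implicit Defensive.

(** * Square integrable functions *)

Section square_integrable.
Context d (T : measurableType d) (R : realType) (mu : {measure set T -> \bar R}).
Variables (D : set T) (mD : measurable D).
Implicit Types F G : T -> R.

Definition sqint F := measurable_fun D F /\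
  mu.-integrable D (EFin \o (fun x => F x ^+ 2)).

Lemma sqint_mul F G : sqint F -> sqint G ->
  mu.-integrable D (EFin \o (fun x => F x * G x)).
Proof.
move=> [mF iF] [mG iG]; have := integrableD mD iF iG.
apply: le_integrable => //; first exact/measurable_EFinP/measurable_funM.
move=> x Dx /=; rewrite lee_fin.
rewrite [leRHS]ger0_norm; last by rewrite addr_ge0 ?sqr_ge0.
by rewrite ler_norml; have := sqr_ge0 (F x - G x); have := sqr_ge0 (F x + G x); nra.
Qed.

Lemma sqintZ a F : sqint F -> sqint (fun x => a * F x).
Proof.
move=> [mF iF]; split; first exact: measurable_funM.
apply: eq_integrable (integrableZl mD (a ^+ 2) iF) => // x _ /=.
by rewrite -EFinM exprMn.
Qed.

Lemma sqintD F G : sqint F -> sqint G -> sqint (fun x => F x + G x).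
Proof.
move=> sF sG; have [[mF iF] [mG iG]] := (sF, sG).
split; first exact: measurable_funD.
have i1 := integrableZl mD 2 (sqint_mul sF sG).
apply: eq_integrable (integrableD mD (integrableD mD iF iG) i1) => // x _ /=.
by rewrite -EFinM -!EFinD; congr EFin; ring.
Qed.

Lemma sqint0 : sqint (fun=> 0).
Proof.
split; first exact: measurable_cst.
by under eq_fun do rewrite expr0n; exact: integrable0.
Qed.

Definition l2 : {pred T -> R} := fun F => `[< sqint F >].

Lemma l2_submod_closed : submod_closed l2.
Proof.
split; first exact/asboolP/sqint0.
move=> a F G /asboolP sF /asboolP sG; apply/asboolP.
exact: sqintD (sqintZ _ sF) sG.
Qed.

Lemma cvg_geometric_steps (v : nat -> R) (C : R) :
  (forall k, `|v k.+1 - v k| <= C * 2^-1 ^+ k) -> cvgn v.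
Proof.
move=> hv.
have geo : cvgn (series (geometric C 2^-1)).
  by apply: is_cvg_geometric_series; rewrite ger0_norm// invf_lt1// ltr1n.
have : cvgn (series (telescope v)).
  apply: normed_cvg; apply: series_le_cvg geo => k /=.
  - exact: normr_ge0.
  - exact: le_trans (normr_ge0 _) (hv k).
  - exact: hv.
rewrite telescopeK => cv.
rewrite (_ : v = (fun n => v n - v 0%N) \+ cst (v 0%N)).
  by apply: is_cvgD => //; exact: is_cvg_cst.
by apply/funext => n /=; rewrite subrK.
Qed.

Lemma limn_einf_le (s : nat -> \bar R) (c : \bar R) :
  (forall k, s k <= c)%E -> (limn_einf s <= c)%E.
Proof.
move=> sc; rewrite limn_einf_lim; apply: lime_le; first exact: is_cvg_einfs.
by near=> k; apply: le_trans (sc k); apply: ereal_inf_lbound; exists k => /=.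
Unshelve. all: by end_near. Qed.

Lemma sqint_EFin F : sqint F ->
  (\int[mu]_(x in D) (F x ^+ 2)%:E)%E = (\int[mu]_(x in D) (F x ^+ 2))%:E.
Proof. by case=> _ iF; rewrite /Rintegral fineK//; exact: integrable_fin_num. Qed.

Lemma sqintB F G : sqint F -> sqint G -> sqint (fun x => F x - G x).
Proof.
move=> sF sG; have := sqintD sF (sqintZ (-1) sG).
by congr sqint; apply/funext => x; rewrite mulN1r.
Qed.

(** The squares of the increments, weighted by [4^k], have integrals at most [2^-k]. Their sum is
    finite almost everywhere, and there the increments are [O(2^-k)]. *)
Lemma sqint_cvg_ae (v : nat -> T -> R) : (forall k, sqint (v k)) ->
  (forall k, \int[mu]_(x in D) (v k.+1 x - v k x) ^+ 2 <= (8%:R ^+ k)^-1) ->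
  {ae mu, forall x, D x -> cvgn (v ^~ x)}.
Proof.
move=> sv hv; have sdv k := sqintB (sv k.+1) (sv k).
pose f k x := (4 ^+ k * (v k.+1 x - v k x) ^+ 2)%:E.
have f0 k x : D x -> (0 <= f k x)%E.
  by move=> _; rewrite lee_fin mulr_ge0 ?sqr_ge0.
have mf k : measurable_fun D (f k).
  apply/measurable_EFinP/measurable_funM => //; apply: measurable_funX.
  by case: (sdv k).
have If k : (\int[mu]_(x in D) f k x <= (2 / (2 ^ k.+1)%:R)%:E)%E.
  rewrite /f; under eq_integral do rewrite EFinM.
  have [_ iv] := sdv k; rewrite integralZl// sqint_EFin// -EFinM lee_fin.
  apply: le_trans (ler_wpM2l _ (hv k)) _; first exact: exprn_ge0.
  rewrite natrX exprS invfM mulrA divff// mul1r (_ : 8 = 4 * 2) ?exprMn ?invfM; last ring.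
  by rewrite mulVKf// expf_neq0.
have : mu.-integrable D (fun x => \sum_(k <oo) f k x)%E.
  apply/integrableP; split.
    by apply: ge0_emeasurable_sum => [k x Dx _|k _]; [exact: f0|exact: mf].
  rewrite (eq_integral (fun x => \sum_(k <oo) f k x)%E); last first.
    by move=> x /set_mem Dx; rewrite gee0_abs// nneseries_ge0// => k _ _; exact: f0.
  rewrite integral_nneseries//.
  apply: le_lt_trans (lee_nneseries _ _) (le_lt_trans (epsilon_trick0 predT (ler0n R 2)) (ltry _)).
  - by move=> k _ _; apply: integral_ge0; exact: f0.
  - by move=> k _; exact: If.
move=> /(integrable_ae mD); apply: filterS => x hx Dx.
have := hx Dx; set s := (\sum_(_ <oo) _)%E => sfin.
have hs k : (f k x <= s)%E.
  have := nneseries_lim_ge (P := predT) k.+1 (fun n _ _ => f0 n x Dx).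
  move=> h; apply: le_trans (h 0%N); rewrite big_nat_recr//= leeDr// sume_ge0// => j _; exact: f0.
apply: (@cvg_geometric_steps _ (fine s + 1)) => k.
have := hs k; rewrite -(fineK sfin) lee_fin => h.
have s0 : 0 <= fine s by apply: le_trans h; rewrite mulr_ge0 ?sqr_ge0.
rewrite -ler_pdivrMr ?exprn_gt0 ?invr_gt0// -exprVn invrK.
rewrite -(ler_pXn2r (n := 2)) ?nnegrE ?mulr_ge0 ?addr_ge0 ?exprn_ge0//.
rewrite exprMn real_normK ?num_real// -exprM mulnC exprM -natrX (_ : (2 ^ 2)%N = 4%N)// mulrC.
by apply: le_trans h _; nra.
Qed.

Lemma sqint_complete (u : nat -> T -> R) : (forall n, sqint (u n)) ->
  (forall e : R, 0 < e -> exists N : nat, forall m n, (N <= m)%N -> (N <= n)%N ->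
    \int[mu]_(x in D) (u m x - u n x) ^+ 2 < e) ->
  exists2 F, sqint F & forall e : R, 0 < e -> exists N : nat,
    forall n, (N <= n)%N -> \int[mu]_(x in D) (u n x - F x) ^+ 2 < e.
Proof.
move=> su cu.
have /choice[N hN] : forall k, exists N : nat, forall m n, (N <= m)%N ->
    (N <= n)%N -> \int[mu]_(x in D) (u m x - u n x) ^+ 2 < (8%:R ^+ k)^-1.
  by move=> k; apply: cu; rewrite invr_gt0 exprn_gt0.
(* Partial sums make [p] strictly increasing with [N k <= p k]. *)
pose p k := (\sum_(i < k.+1) (N i).+1)%N.
have Np k : (N k <= p k)%N.
  by rewrite /p big_ord_recr/= (leq_trans (leqnSn _))// leq_addl.
have pS k : (p k < p k.+1)%N.
  by rewrite /p [ltnRHS]big_ord_recr/= -[ltnLHS]addn0 ltn_add2l.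
have kp k : (k <= p k)%N by elim: k => // k kp; exact: leq_ltn_trans kp (pS k).
pose v k := u (p k).
have sv k : sqint (v k) by exact: su.
have hv k : \int[mu]_(x in D) (v k.+1 x - v k x) ^+ 2 <= (8%:R ^+ k)^-1.
  by apply/ltW/hN => //; exact: leq_trans (ltnW (pS k)).
have [Bad [mBad Bad0 hBad]] := sqint_cvg_ae sv hv.
(* Set to zero on the exceptional null set, the subsequence converges everywhere and its limit is
   measurable. *)
pose w k x := v k x * \1_(~` Bad) x.
have wv k x : ~ Bad x -> w k x = v k x.
  by move=> nB; rewrite /w indicE mem_set// mulr1.
have mw k : measurable_fun D (w k).
  apply: measurable_funM; first by case: (sv k).
  by apply: measurable_indic; exact: measurableC.
pose F x := limn (w ^~ x).
have wF x : D x -> w ^~ x @ \oo --> F x.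
  move=> Dx; have [Bx|nBx] := pselect (Bad x).
    rewrite /F (_ : w ^~ x = cst 0); first exact: is_cvg_cst.
    by apply/funext => k; rewrite /w indicE memNset ?mulr0//=; exact.
  rewrite /F (_ : w ^~ x = v ^~ x); last by apply/funext => k; exact: wv.
  by apply: contrapT => ncv; apply/nBx/hBad => /(_ Dx).
have mF : measurable_fun D F by apply: measurable_fun_cvg wF.
(* Fatou's lemma along the subsequence turns a Cauchy bound into a bound for the distance to the
   limit. *)
have fatouF e n : 0 < e ->
    (forall k, (n <= k)%N -> \int[mu]_(x in D) (u k x - u n x) ^+ 2 <= e) ->
    (\int[mu]_(x in D) ((u n x - F x) ^+ 2)%:E <= e%:E)%E.
  move=> e0 he; have [mu_n _] := su n.
  pose g k x := ((w (k + n)%N x - u n x) ^+ 2)%:E.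
  have mg k : measurable_fun D (g k).
    by apply/measurable_EFinP/measurable_funX/measurable_funB.
  have g0 k x : D x -> (0 <= g k x)%E by rewrite lee_fin sqr_ge0.
  apply: le_trans (le_trans (fatou mu mD mg g0) (limn_einf_le (c := e%:E) _)).
    rewrite le_eqVlt; apply/orP; left; apply/eqP.
    apply: eq_integral => x /set_mem Dx; apply/esym.
    apply: (cvg_limn_einf_sup _).1; apply/cvg_EFin; first by apply: nearW.
    rewrite -sqrrN opprB expr2.
    rewrite (_ : _ \o _ = (fun k => w (k + n)%N x - u n x) *
                           (fun k => w (k + n)%N x - u n x)); last first.
      by apply/funext.
    have wu : (w (k + n)%N x - u n x) @[k --> \oo] --> F x - u n x.
      apply: cvgB; last exact: cvg_cst.
      by rewrite (cvg_shiftn n (fun k => w k x)); exact: wF.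
    exact: cvgM.
  move=> k; apply: le_trans (_ : (\int[mu]_(x in D) (u (p (k + n)%N) x - u n x) ^+ 2)%:E <= _)%E.
    rewrite -sqint_EFin; last exact: sqintB.
    rewrite le_eqVlt; apply/orP; left; apply/eqP.
    apply: ge0_ae_eq_integral => //.
    - apply/measurable_EFinP/measurable_funX/measurable_funB => //.
      by case: (su (p (k + n)%N)).
    - by move=> x _; rewrite lee_fin sqr_ge0.
    - by move=> x _; rewrite lee_fin sqr_ge0.
    - exists Bad; split=> // x /= h; apply: contrapT => nB; apply: h => Dx.
      by rewrite /g wv.
  rewrite lee_fin; apply: he.
  exact: leq_trans (leq_addl k n) (kp _).
have sF : sqint F.
  have [n hn] := cu 1 ltr01.
  have sd : sqint (fun x => u n x - F x).
    split; first by apply: measurable_funB => //; case: (su n).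
    apply/integrableP; split.
      by apply/measurable_EFinP/measurable_funX/measurable_funB => //; case: (su n).
    under eq_integral do rewrite gee0_abs ?lee_fin ?sqr_ge0//.
    apply: le_lt_trans (fatouF 1 n ltr01 _) (ltry _) => k nk.
    exact/ltW/hn.
  rewrite (_ : F = fun x => u n x - (u n x - F x)); last first.
    by apply/funext => x; rewrite subKr.
  exact: sqintB.
exists F => // e e0; have [|n hn] := cu (e / 2); first by rewrite divr_gt0.
exists n => m nm; apply: (@le_lt_trans _ _ (e / 2)); last by lra.
rewrite -lee_fin -sqint_EFin; last exact: sqintB.
apply: fatouF => [|k mk]; first by rewrite divr_gt0.
by apply/ltW/hn => //; exact: leq_trans mk.
Qed.

End square_integrable.

(** * Square integrable functions on the half line as a complete semi-inner product space *)

Section l2_half_line.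
Variable R : realType.
Notation mu := (@lebesgue_measure R).

Definition halfline : set R := `]0, +oo[.

Lemma measurable_halfline : @measurable _ (measurableTypeR R) halfline.
Proof. exact: measurable_itv. Qed.

Definition l2half : {pred R -> R} := l2 mu halfline.

Lemma l2half_submod_closed : submod_closed l2half.
Proof. exact: (@l2_submod_closed _ _ R mu halfline measurable_halfline). Qed.

HB.instance Definition _ :=
  GRing.isSubmodClosed.Build R (R -> R) l2half l2half_submod_closed.

(** These are functions, not classes modulo null sets; [l2prod] is accordingly a semi-inner product,
    as in the abstract results. *)
Record l2fun := L2fun { l2val :> R -> R; l2valP : l2val \in l2half }.
HB.instance Definition _ := [isSub of l2fun for l2val].
HB.instance Definition _ := [Choice of l2fun by <:].
HB.instance Definition _ := [SubChoice_isSubLmodule of l2fun by <:].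

Implicit Types F G : l2fun.

Lemma l2fun_sqint F : sqint mu halfline F.
Proof. exact/asboolP/l2valP. Qed.

Definition l2prod F G : R := \int[mu]_(x in halfline) (F x * G x).

Lemma l2prod_integrable F G :
  mu.-integrable halfline (EFin \o (fun x => F x * G x)).
Proof. exact: (@sqint_mul _ _ R mu halfline measurable_halfline F G (l2fun_sqint F) (l2fun_sqint G)). Qed.

Lemma l2prodC F G : l2prod F G = l2prod G F.
Proof. by apply: eq_Rintegral => x _; rewrite mulrC. Qed.

Lemma l2prodDl F G H : l2prod (F + G) H = l2prod F H + l2prod G H.
Proof.
rewrite -RintegralD ?l2prod_integrable//; last exact: measurable_halfline.
by apply: eq_Rintegral => x _; rewrite -mulrDl.
Qed.

Lemma l2prodZl a F H : l2prod (a *: F) H = a * l2prod F H.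
Proof.
rewrite -RintegralZl ?l2prod_integrable//; last exact: measurable_halfline.
by apply: eq_Rintegral => x _; rewrite mulrA.
Qed.

Lemma l2prod_ge0 F : 0 <= l2prod F F.
Proof. by apply: Rintegral_ge0 => x _; rewrite -expr2 sqr_ge0. Qed.

(* A complex function is represented by its real and imaginary parts, so that
   this is the real part of the inner product of [L^2(0, oo)]. *)
Definition cprod (u v : l2fun * l2fun) : R := l2prod u.1 v.1 + l2prod u.2 v.2.

Lemma cprodC u v : cprod u v = cprod v u.
Proof. by rewrite /cprod l2prodC (l2prodC u.2). Qed.

Lemma cprodDl u v w : cprod (u + v) w = cprod u w + cprod v w.
Proof. by rewrite /cprod !l2prodDl addrACA. Qed.

Lemma cprodZl a u w : cprod (a *: u) w = a * cprod u w.
Proof. by rewrite /cprod !l2prodZl mulrDr. Qed.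

Lemma cprod_ge0 u : 0 <= cprod u u.
Proof. by rewrite addr_ge0// l2prod_ge0. Qed.

Lemma l2prod_complete : sqcomplete R _ l2prod predT.
Proof.
move=> u _ cu.
have sqE F G : \int[mu]_(x in halfline) (F x - G x) ^+ 2 = l2prod (F - G) (F - G).
  by apply: eq_Rintegral => x _; rewrite expr2.
have [|F sF hF] := @sqint_complete _ _ R mu halfline measurable_halfline u (fun n => l2fun_sqint (u n)).
  by move=> e /cu[N hN]; exists N => m n Nm Nn; rewrite sqE hN.
have lF : F \in l2half by exact/asboolP.
exists (L2fun lF) => // e /hF[N hN]; exists N => n Nn.
Qed.

Lemma cprod_complete : sqcomplete R _ cprod predT.
Proof.
move=> u _ cu.
have [|F _ hF] := l2prod_complete (u := fun n => (u n).1) (fun=> isT).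
  move=> e /cu[N hN]; exists N => m n Nm Nn; apply: le_lt_trans (hN _ _ Nm Nn).
  by rewrite /cprod lerDl l2prod_ge0.
have [|G _ hG] := l2prod_complete (u := fun n => (u n).2) (fun=> isT).
  move=> e /cu[N hN]; exists N => m n Nm Nn; apply: le_lt_trans (hN _ _ Nm Nn).
  by rewrite /cprod lerDr l2prod_ge0.
exists (F, G) => // e e0; have e2 : 0 < e / 2 by rewrite divr_gt0.
have [N hN] := hF _ e2; have [M hM] := hG _ e2.
exists (maxn N M) => n; rewrite geq_max => /andP[Nn Mn].
by rewrite /cprod [ltRHS]splitr; apply: ltrD; [exact: hN|exact: hM].
Qed.

End l2_half_line.

(** * Absolute continuity *)

Section absolute_continuity.
Variable R : realType.
Notation mu := (@lebesgue_measure R).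
Implicit Types (a b : R) (u v h : R -> R).

Lemma ae_sub (P Q : R -> Prop) : (forall x, P x -> Q x) ->
  {ae mu, forall x : R, P x} -> {ae mu, forall x : R, Q x}.
Proof. by move=> PQ [N [mN N0 hN]]; exists N; split=> //; apply: subset_trans hN; apply/subsetC. Qed.

Lemma ae_and (P Q : R -> Prop) : {ae mu, forall x : R, P x} ->
  {ae mu, forall x : R, Q x} -> {ae mu, forall x : R, P x /\ Q x}.
Proof.
move=> [N [mN N0 hN]] [M [mM M0 hM]]; exists (N `|` M); split.
- exact: measurableU.
- exact: null_set_setU.
- move=> x /= /not_andP[nP|nQ]; [left; exact: hN|right; exact: hM].
Qed.

Lemma ac_point a b u e : abs_continuous a b u -> 0 < e -> exists2 d, 0 < d &
  forall x y, a <= x <= b -> a <= y <= b -> `|y - x| < d -> `|u y - u x| < e.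
Proof.
move=> ac e0; have [d d0 hd] := ac _ e0; exists d => // x y.
wlog xy : x y / x <= y.
  move=> h hx hy; have [xy|yx] := leP x y; first exact: h.
  by rewrite distrC (distrC (u y)); apply: h => //; exact: ltW.
move=> /andP[ax xb] /andP[ay yb]; rewrite ger0_norm ?subr_ge0// => xyd.
have := hd 1%N (fun=> x) (fun=> y); rewrite !big_ord1; apply=> //.
by move=> i j; rewrite (ord1 i) (ord1 j).
Qed.

(** Any point is reached from [a] in a bounded number of steps of length at most [d / 2], each
    changing [u] by less than 1. *)
Lemma ac_bounded a b u : abs_continuous a b u ->
  exists M, forall x, a <= x <= b -> `|u x| <= M.
Proof.
move=> /ac_point/(_ ltr01)[d d0 hd].
have step k x : a <= x <= b -> x - a <= k%:R * (d / 2) -> `|u x - u a| <= k%:R.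
  elim: k x => [|k IH] x /andP[ax xb].
    by rewrite mul0r subr_le0 => xa; rewrite (@le_anti _ _ x a) ?subrr ?normr0// xa.
  move=> h; pose y := Num.max a (x - d / 2).
  have ay : a <= y by rewrite le_max lexx.
  have yx : y <= x by rewrite ge_max ax; lra.
  have ab : a <= y <= b by rewrite ay (le_trans yx).
  have : `|u y - u a| <= k%:R.
    apply: IH => //; rewrite /y; have [|_] := leP a (x - d / 2).
      by move: h; rewrite -natr1; lra.
    by rewrite subrr mulr_ge0//; lra.
  have : `|u x - u y| < 1.
    apply: hd => //; first by rewrite ax.
    rewrite ger0_norm ?subr_ge0//; have : x - d / 2 <= y by rewrite le_max lexx orbT.
    by lra.
  move=> h1 h2; rewrite -natr1.
  have -> : u x - u a = (u x - u y) + (u y - u a) by ring.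
  by apply: le_trans (ler_normD _ _) _; lra.
pose k := Num.bound ((b - a) / (d / 2)).
exists (k%:R + `|u a|) => x /andP[ax xb].
have : `|u x - u a| <= k%:R.
  apply: step; first by rewrite ax.
  have d2 : 0 < d / 2 by lra.
  rewrite -ler_pdivrMr//.
  apply: le_trans (ltW (archi_boundP _)); last by apply: divr_ge0; lra.
  by rewrite ler_pM2r ?invr_gt0//; lra.
have := lerB_dist (u x) (u a); lra.
Qed.

Lemma ac_lin a b u v c : abs_continuous a b u -> abs_continuous a b v ->
  abs_continuous a b (fun x => u x + c * v x).
Proof.
move=> acu acv e e0; have [|d d0 hd] := acu (e / 2); first by rewrite divr_gt0.
have [|d' d'0 hd'] := acv (e / (2 * (`|c| + 1))).
  by rewrite divr_gt0// mulr_gt0// ltr_wpDl.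
exists (Num.min d d'); first by rewrite lt_min d0.
move=> n s t h1 h2; rewrite lt_min => /andP[h3 h4].
have := hd n s t h1 h2 h3; have := hd' n s t h1 h2 h4.
rewrite ltr_pdivlMr ?mulr_gt0// ?ltr_wpDl// => h5 h6.
apply: (@le_lt_trans _ _ (\sum_i `|u (t i) - u (s i)| + `|c| * \sum_i `|v (t i) - v (s i)|)).
  rewrite mulr_sumr -big_split/=; apply: ler_sum => i _.
  rewrite -normrM; apply: le_trans (ler_normD _ _).
  by rewrite le_eqVlt; apply/orP; left; apply/eqP; congr `|_|; ring.
have S0 : 0 <= \sum_i `|v (t i) - v (s i)| by apply: sumr_ge0.
have := normr_ge0 c; nra.
Qed.

Lemma ac_linear a b u v c d : abs_continuous a b u -> abs_continuous a b v ->
  abs_continuous a b (fun x => c * u x + d * v x).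
Proof.
move=> acu acv; apply: ac_lin => //.
have ac0 : abs_continuous a b (fun=> 0 : R).
  move=> e e0; exists 1 => // n s t _ _ _.
  by rewrite big1// => i _; rewrite subrr normr0.
have := ac_lin c ac0 acu; congr abs_continuous.
by apply/funext => x; rewrite add0r.
Qed.

Lemma acM a b u v : abs_continuous a b u -> abs_continuous a b v ->
  abs_continuous a b (fun x => u x * v x).
Proof.
move=> acu acv e e0; have [M hM] := ac_bounded acu; have [N hN] := ac_bounded acv.
pose C := `|M| + `|N| + 1; have C0 : 0 < C by rewrite ltr_wpDl// addr_ge0.
have eC : 0 < e / (2 * C) by rewrite divr_gt0// mulr_gt0.
have [d d0 hd] := acu _ eC; have [d' d'0 hd'] := acv _ eC.
exists (Num.min d d'); first by rewrite lt_min d0.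
move=> n s t h1 h2; rewrite lt_min => /andP[h3 h4].
have := hd n s t h1 h2 h3; have := hd' n s t h1 h2 h4.
rewrite !ltr_pdivlMr ?mulr_gt0// => h5 h6.
apply: (@le_lt_trans _ _ (C * \sum_i `|u (t i) - u (s i)| + C * \sum_i `|v (t i) - v (s i)|)).
  rewrite !mulr_sumr -big_split/=; apply: ler_sum => i _.
  have [as_ [st tb]] := h1 i.
  have -> : u (t i) * v (t i) - u (s i) * v (s i) =
    (u (t i) - u (s i)) * v (t i) + u (s i) * (v (t i) - v (s i)) by ring.
  apply: le_trans (ler_normD _ _) _; rewrite !normrM; apply: lerD.
    rewrite mulrC; apply: ler_wpM2r => //; apply: le_trans (hN _ _) _.
      by rewrite tb (le_trans as_).
    by rewrite /C; have := ler_norm N; have := normr_ge0 M; lra.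
  apply: ler_wpM2r => //; apply: le_trans (hM _ _) _.
    by rewrite as_ (le_trans st).
  by rewrite /C; have := ler_norm M; have := normr_ge0 N; lra.
by lra.
Qed.

Lemma is_derive0_slope u (x e : R) : is_derive x 1 u 0 -> 0 < e ->
  exists2 r, 0 < r & forall y, `|y - x| < r -> `|u y - u x| <= e * `|y - x|.
Proof.
move=> [du Du] e0.
have : (fun h : R => h^-1 *: ((u \o shift x) (h *: 1) - u x)) @ 0^' --> (0 : R).
  by rewrite -[X in _ --> X]Du; exact: du.
move=> /cvgrPdist_le/(_ e e0)/nbhs_ballP[r /= r0 hr]; exists r => // y yx.
have [->|yx0] := eqVneq y x; first by rewrite !subrr normr0 mulr0.
have yx_neq0 : y - x != 0 by rewrite subr_eq0.
have := hr (y - x); rewrite /ball/= sub0r normrN => /(_ yx yx_neq0).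
rewrite sub0r normrN /shift /= [_ *: 1]mulr1 subrK normrM normfV mulrC.
by rewrite ler_pdivrMr// normr_gt0.
Qed.

(* The steps of slope at most [e] are taken near points where [u' = 0], and the
   jumps [[s i, t i]] across the open set [U] containing all other points. *)
Definition reach (a e : R) u (U : set R) (x : R) :=
  exists n (s t : 'I_n -> R), [/\
    forall i, a <= s i /\ s i <= t i /\ t i <= x,
    forall i j, i != j -> t i <= s j \/ t j <= s i,
    ((\sum_i (t i - s i))%:E <= mu (U `&` `]a, x]%classic))%E &
    `|u x - u a| <= e * (x - a) + \sum_i `|u (t i) - u (s i)|].

Lemma reach_slope a e u U x y : measurable U -> x <= y ->
  `|u y - u x| <= e * (y - x) -> reach a e u U x -> reach a e u U y.
Proof.
move=> mU xy uxy [n [s [t [h1 h2 h3 h4]]]]; exists n, s, t; split=> //.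
- by move=> i; have [? [? tx]] := h1 i; split=> //; split=> //; exact: le_trans xy.
- apply: le_trans h3 _; apply: le_measure; rewrite ?inE; try exact: measurableI.
  by apply: setIS; apply: subset_itvl; rewrite bnd_simp.
- have -> : u y - u a = (u y - u x) + (u x - u a) by ring.
  by apply: le_trans (ler_normD _ _) _; lra.
Qed.

Lemma reach_jump a e u U x y : 0 <= e -> measurable U -> a <= x -> x <= y ->
  `]x, y]%classic `<=` U -> reach a e u U x -> reach a e u U y.
Proof.
move=> e0 mU ax xy xyU [n [s [t [h1 h2 h3 h4]]]].
pose s' (i : 'I_n.+1) := oapp s x (unlift ord0 i).
pose t' (i : 'I_n.+1) := oapp t y (unlift ord0 i).
have s'0 : s' ord0 = x by rewrite /s' unlift_none.
have t'0 : t' ord0 = y by rewrite /t' unlift_none.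
have s'S i : s' (lift ord0 i) = s i by rewrite /s' liftK.
have t'S i : t' (lift ord0 i) = t i by rewrite /t' liftK.
exists n.+1, s', t'; split.
- move=> i; case: (unliftP ord0 i) => [j|] ->; last by rewrite s'0 t'0.
  by rewrite s'S t'S; have [? [? tx]] := h1 j; split=> //; split=> //; exact: le_trans xy.
- move=> i j; case: (unliftP ord0 i) => [k|] ->; case: (unliftP ord0 j) => [l|] ->.
  + by move=> kl; rewrite !s'S !t'S; apply: h2; apply: contra_neq kl => ->.
  + by rewrite s'0 t'0 s'S t'S => _; left; have [_ []] := h1 k.
  + by rewrite s'0 t'0 s'S t'S => _; right; have [_ []] := h1 l.
  + by rewrite eqxx.
- rewrite big_ord_recl s'0 t'0; under eq_bigr do rewrite s'S t'S.
  have -> : U `&` `]a, y] = `]x, y] `|` (U `&` `]a, x]).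
    apply/seteqP; split=> z /=; rewrite !in_itv/=.
      by move=> [Uz /andP[az zy]]; have [zx|xz] := leP z x;
        [right; split=> //; rewrite az|left; rewrite zy].
    move=> [/andP[xz zy]|[Uz /andP[az zx]]].
      split; first by apply: xyU; rewrite /= in_itv/= xz.
      by rewrite zy (le_lt_trans ax).
    by split=> //; rewrite az (le_trans zx).
  rewrite measureU//; last 2 first.
  + exact: measurableI.
  + apply/seteqP; split=> z //= [+ [_]]; rewrite !in_itv/= => /andP[xz _] /andP[_ zx].
    by move: (lt_le_trans xz zx); rewrite ltxx.
  rewrite EFinD; apply: leeD => //.
  rewrite /= lebesgue_measure_itv/= lte_fin; case: ltP => // yx.
  by rewrite lee_fin subr_le0.
- rewrite big_ord_recl s'0 t'0; under eq_bigr do rewrite s'S t'S.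
  have -> : u y - u a = (u y - u x) + (u x - u a) by ring.
  apply: le_trans (ler_normD _ _) _.
  have : e * (x - a) <= e * (y - a) by apply: ler_wpM2l => //; lra.
  lra.
Qed.

(** A supremum argument in place of a covering theorem. The supremum [c] of the points reachable
    from [a] can be passed unless [c = b]: by a jump if [c] lies in the exceptional null set, which
    has an open neighbourhood of small measure, and by a step of small slope otherwise. *)
Lemma ac_const a b u : a <= b -> abs_continuous a b u ->
  {ae mu, forall x, a < x < b -> is_derive x 1 u 0} -> u b = u a.
Proof.
move=> ab ac [N0 [mN0 N00 hN0]].
(* The end points join the exceptional set, because the hypothesis on the derivative covers only
   interior points. *)
pose N := N0 `|` [set a; b].
have mab : measurable [set a; b] by apply: measurableU; exact: measurable_set1.
have mN : measurable N by exact: measurableU.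
have N_null : mu N = 0%E.
  apply/eqP; rewrite eq_le measure_ge0 andbT.
  apply: le_trans (measureU2 _ mN0 mab) _.
  rewrite [X in (X + _)%E]N00 add0e; apply: le_trans (measureU2 _ _ _) _.
  - exact: measurable_set1.
  - exact: measurable_set1.
  - by rewrite /= !lebesgue_measure_set1 adde0.
have derN x : a <= x <= b -> ~ N x -> is_derive x 1 u 0.
  move=> /andP[ax xb] nN; apply: contrapT => h; apply: nN.
  have [->|xa] := eqVneq x a; first by right; left.
  have [->|xb'] := eqVneq x b; first by right; right.
  left; apply: hN0 => /= H; apply: h; apply: H.
  by rewrite !lt_neqAle eq_sym xa xb' ax.
apply/eqP; rewrite -subr_eq0 -normr_eq0 eq_le normr_ge0 andbT.
apply/ler_addgt0Pl => e' e'0; rewrite addr0.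
(* The steps contribute at most [e (b - a)] and the jumps at most [e]. *)
pose e := e' / (b - a + 1).
have e0 : 0 < e by rewrite divr_gt0//; lra.
have [d d0 hd] := ac _ e0.
have [|U [oU NU muU]] := lebesgue_regularity_outer mN _ d0.
  by change (mu N < +oo)%E; rewrite N_null ltry.
have mU : measurable U by exact: open_measurable.
have {}muU : (mu U < d%:E)%E.
  have -> : U = N `|` (U `\` N) by rewrite setDE setUIr setUv setIT; apply/esym/setUidPr.
  apply: le_lt_trans (measureU2 _ mN (measurableD mU mN)) _.
  by rewrite [X in (X + _)%E]N_null add0e.
suff [n [s [t [h1 h2 h3 h4]]]] : reach a e u U b.
  have : \sum_i (t i - s i) < d.
    rewrite -lte_fin; apply: le_lt_trans h3 (le_lt_trans _ muU).
    by apply: le_measure; rewrite ?inE//; exact: measurableI.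
  move=> /(hd n s t h1 h2) h5; apply: le_trans h4 _.
  have : e * (b - a + 1) = e' by rewrite /e mulfVK// gt_eqF//; lra.
  lra.
pose S := [set x | a <= x <= b /\ reach a e u U x].
have Sa : S a.
  split; first by rewrite lexx.
  by exists 0%N, (fun=> a), (fun=> a); split=> [[]//|[]//||];
    rewrite big_ord0 ?measure_ge0// subrr normr0 subrr mulr0 addr0.
have supS : has_sup S by split; [exists a|exists b => x [/andP[]]].
pose c := sup S.
have ac_ : a <= c by apply: ub_le_sup => //; case: supS.
have cb : c <= b by apply: ge_sup; [exists a|move=> x [/andP[]]].
have [r r0 hr] : exists2 r, 0 < r & forall x y, a <= x -> x <= c -> c <= y -> y <= b ->
    c - r < x -> y < c + r -> reach a e u U x -> reach a e u U y.
  have [Nc|nNc] := pselect (N c).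
    have [r /= r0 hr] : exists2 r : R, 0 < r & ball c r `<=` U.
      have /nbhs_ballP[r r0 hr] : nbhs c U by apply: open_nbhs_nbhs; split=> //; exact: NU.
      by exists r.
    exists r => // x y ax xc cy yb cx yc; apply: reach_jump => //; first exact: ltW.
      exact: le_trans cy.
    move=> z /=; rewrite in_itv/= => /andP[xz zy]; apply: hr.
    by rewrite /ball/= ltr_norml; lra.
  have dc : is_derive c 1 u 0 by apply: derN => //; rewrite ac_.
  have [r r0 hr] := is_derive0_slope dc e0.
  exists r => // x y ax xc cy yb cx yc; apply: reach_slope => //.
    exact: le_trans cy.
  have -> : u y - u x = (u y - u c) - (u x - u c) by ring.
  apply: le_trans (ler_normB _ _) _.
  have := hr y; rewrite ger0_norm ?subr_ge0// => h2.
  have : `|u x - u c| <= e * (c - x) by have := hr x; rewrite ler0_norm ?subr_le0// opprB; apply; lra.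
  have : `|u y - u c| <= e * (y - c) by apply: h2; lra.
  lra.
have [x Sx cx] : exists2 x, S x & c - r < x by exact: sup_adherent.
have xc : x <= c by apply: ub_le_sup => //; case: supS.
have [/andP[ax xb] rx] := Sx.
pose y := Num.min (c + r / 2) b.
have cy : c <= y by rewrite le_min cb andbT; lra.
have yb : y <= b by rewrite ge_min lexx orbT.
have yr : y < c + r by rewrite gt_min; apply/orP; left; lra.
have ry : reach a e u U y by exact: hr rx.
have : y <= c.
  apply: ub_le_sup; first by case: supS.
  by split=> //; rewrite yb (le_trans ac_).
move=> yc; have yb' : y = b.
  move: yc; rewrite /y; case: (leP (c + r / 2) b) => // _; lra.
by rewrite -yb'.
Qed.

(** Normalised at [-oo], so that the primitive of a function supported in []X, Y]] vanishes up to
    [X]. *)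
Definition prim h (x : R) : R := \int[mu]_(t in `]-oo, x]) h t.

Lemma prim_sub h (s t : R) : mu.-integrable setT (EFin \o h) -> s <= t ->
  prim h t - prim h s = \int[mu]_(x in `]s, t]) h x.
Proof.
move=> ih st; apply: Rintegral_itvB => //.
exact: integrableS ih.
Qed.

Lemma ac_prim a b h : mu.-integrable setT (EFin \o h) -> abs_continuous a b (prim h).
Proof.
move=> ih e e0; have [d [d0 hd]] := integral_normr_continuous ih e0.
exists d => // n s t h1 h2 h3.
pose A (i : 'I_n) : set R := `]s i, t i]%classic.
have mA i : measurable (A i) by exact: measurable_itv.
have trA : trivIset [set` index_enum 'I_n] A.
  move=> i j _ _ [x [/=]]; rewrite /A/= !in_itv/= => /andP[si ti] /andP[sj tj].
  apply/eqP; apply/negP => /negP ij; have [tisj|tjsi] := h2 _ _ ij.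
    by have := lt_le_trans (le_lt_trans tisj sj) ti; rewrite ltxx.
  by have := lt_le_trans (le_lt_trans tjsi si) tj; rewrite ltxx.
pose D := \big[setU/set0]_(i <- index_enum 'I_n) A i.
have mD : measurable D by apply: bigsetU_measurable.
have muD : (mu D < d%:E)%E.
  apply: le_lt_trans (_ : _ <= \sum_(i < n) (t i - s i)%:E)%E _; last first.
    by rewrite sumEFin lte_fin.
  have -> : mu D = (\int[mu]_(x in D) 1)%E by rewrite integral_cst// mul1e.
  rewrite ge0_integral_bigsetU ?index_enum_uniq//.
  apply: lee_sum => i _; rewrite integral_cst//=; last exact: mA.
  rewrite mul1e /A lebesgue_measure_itv/=.
  by rewrite lte_fin; case: ltP => // _; rewrite lee_fin subr_ge0; have [_ []] := h1 i.
have := hd D mD muD; apply: le_lt_trans.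
have iD : mu.-integrable D (EFin \o (fun x => `|h x|)).
  exact: integrable_norm (integrableS _ _ _ ih).
rewrite -lee_fin -sumEFin /Rintegral fineK; last exact: integrable_fin_num iD.
rewrite ge0_integral_bigsetU ?index_enum_uniq//; last first.
  exact: (measurable_int _ iD).
apply: lee_sum => i _; rewrite prim_sub//; last by have [_ []] := h1 i.
have iA : mu.-integrable (A i) (EFin \o h).
  by have mAi := mA i; exact: (integrableS _ _ _ ih).
by rewrite EFin_normr_Rintegral//; apply: le_abse_integral => //; exact: (measurable_int _ iA).
Qed.

Lemma prim_derive h : mu.-integrable setT (EFin \o h) ->
  {ae mu, forall x : R, is_derive x 1 (prim h) (h x)}.
Proof.
move=> ih; have : locally_integrable setT h.
  by apply: open_integrable_locally => //; exact: openT.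
move=> /(FTC1Ny _) H.
have /H : forall y, mu.-integrable `]-oo, y] (EFin \o h) by move=> y; exact: integrableS ih.
apply: ae_sub => x [dx <-]; rewrite derive1E; exact: derivableP.
Qed.

(** Subtracting from [u] the primitive of [h] restricted to []a, b]] leaves an absolutely continuous
    function with derivative 0 almost everywhere. *)
Lemma ac_ftc a b u h : a <= b -> abs_continuous a b u ->
  mu.-integrable `]a, b] (EFin \o h) ->
  {ae mu, forall x, a < x < b -> is_derive x 1 u (h x)} ->
  u b - u a = \int[mu]_(x in `]a, b]) h x.
Proof.
move=> ab ac ih du; pose k := h \_ `]a, b].
have ik : mu.-integrable setT (EFin \o k).
  by rewrite /k -restrict_EFin; apply/(integrable_mkcond _ _).1.
have -> : \int[mu]_(x in `]a, b]) h x = prim k b - prim k a.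
  rewrite prim_sub//; apply: eq_Rintegral => x xab.
  by rewrite /k patchE xab.
suff : u b + (-1) * prim k b = u a + (-1) * prim k a by lra.
apply: (@ac_const a b (fun x => u x + (-1) * prim k x)) => //.
  by apply: ac_lin => //; exact: ac_prim.
apply: ae_sub (ae_and du (prim_derive ik)) => x [dux dpx] axb.
have {}dux := dux axb.
have -> : 0 = h x + (-1) * k x.
  rewrite /k patchE mem_set; first by ring.
  by rewrite /= in_itv/=; move: axb => /andP[-> /ltW].
have := is_deriveD dux (is_deriveZ (-1) dpx).
by [].
Qed.

End absolute_continuity.

(** * Green's identity *)

(** In the orthonormal frame [(c, s)], [(- s, c)] the Wronskian pairs the components of [u] and [v]
    along [(c, s)] with the perpendicular ones, whose squares are at most [2 m^2]. *)
Lemma wronskian_sq_le (R : realType) (c s u1 u2 v1 v2 m : R) :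
  c ^+ 2 + s ^+ 2 = 1 -> `|u1| <= m -> `|u2| <= m -> `|v1| <= m -> `|v2| <= m ->
  (u1 * v2 - u2 * v1) ^+ 2 <=
    8 * m ^+ 2 * ((c * u1 + s * u2) ^+ 2 + (c * v1 + s * v2) ^+ 2).
Proof.
move=> cs1 hu1 hu2 hv1 hv2.
have m0 : 0 <= m by exact: le_trans hu1.
have sq (y : R) : `|y| <= m -> y ^+ 2 <= m ^+ 2.
  by move=> ym; rewrite -(real_normK (num_real y)) ler_pXn2r ?nnegrE.
have perp (y1 y2 : R) : `|y1| <= m -> `|y2| <= m -> (c * y2 - s * y1) ^+ 2 <= 2 * m ^+ 2.
  move=> /sq h1 /sq h2; have -> : (c * y2 - s * y1) ^+ 2 =
    (c ^+ 2 + s ^+ 2) * (y1 ^+ 2 + y2 ^+ 2) - (c * y1 + s * y2) ^+ 2 by ring.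
  by rewrite cs1 mul1r; have := sqr_ge0 (c * y1 + s * y2); lra.
have -> : u1 * v2 - u2 * v1 =
    (c * u1 + s * u2) * (c * v2 - s * v1) - (c * v1 + s * v2) * (c * u2 - s * u1).
  transitivity ((c ^+ 2 + s ^+ 2) * (u1 * v2 - u2 * v1)); last by ring.
  by rewrite cs1 mul1r.
have := perp _ _ hu1 hu2; have := perp _ _ hv1 hv2.
move: (c * u1 + s * u2) (c * v1 + s * v2) (c * v2 - s * v1) (c * u2 - s * u1).
clear; move=> F L p q hp hq; have := sqr_ge0 (F * p + L * q).
have : F ^+ 2 * p ^+ 2 <= F ^+ 2 * (2 * m ^+ 2) by apply: ler_wpM2l => //; exact: sqr_ge0.
have : L ^+ 2 * q ^+ 2 <= L ^+ 2 * (2 * m ^+ 2) by apply: ler_wpM2l => //; exact: sqr_ge0.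
have := mulr_ge0 (sqr_ge0 m) (sqr_ge0 F); have := mulr_ge0 (sqr_ge0 m) (sqr_ge0 L).
lra.
Qed.

Section green.
Variable R : realType.
Notation mu := (@lebesgue_measure R).
Notation D := (@halfline R).
Implicit Types (F G h u v : R -> R).

Lemma subset_Rintegral d (T : measurableType d) (nu : {measure set T -> \bar R})
    (A B : set T) (h : T -> R) : measurable A -> measurable B -> A `<=` B ->
  nu.-integrable B (EFin \o h) -> (forall x, B x -> 0 <= h x) ->
  \int[nu]_(x in A) h x <= \int[nu]_(x in B) h x.
Proof.
move=> mA mB AB iB h0; have iA := integrableS mB mA AB iB.
rewrite /Rintegral fine_le ?(integrable_fin_num _ iA) ?(integrable_fin_num _ iB)//.
apply: ge0_subset_integral => //.
exact: measurable_int iB.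
Qed.

Lemma integrable_cst_itv (a b k : R) : mu.-integrable `]a, b] (EFin \o (fun=> k)).
Proof.
apply/integrableP; split; first exact: measurable_cst.
rewrite integral_cst//= lebesgue_measure_itv/=.
by case: ifP => _; rewrite -EFinM ltry.
Qed.

Lemma integrable_tail h : mu.-integrable D (EFin \o h) -> forall e : R, 0 < e ->
  exists2 X, 0 < X & forall Y, X <= Y -> \int[mu]_(x in `]Y, +oo[) `|h x| < e.
Proof.
move=> ih e e0; have mD : measurable D by exact: measurable_halfline.
have inh : mu.-integrable D (EFin \o (fun x => `|h x|)) by exact: integrable_norm ih.
pose E (n : nat) : set R := `]n%:R, +oo[%classic.
have mE n : measurable (E n) by exact: measurable_itv.
pose f_ (n : nat) x := (`|h x| * \1_(E n) x)%:E.
have mf_ n : measurable_fun D (f_ n).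
  apply/measurable_EFinP/measurable_funM; last exact: measurable_indic.
  by have /measurable_EFinP := measurable_int _ inh.
have f_0 x : D x -> f_ ^~ x @ \oo --> 0%E.
  move=> Dx; apply: cvg_near_cst; near=> n.
  rewrite /f_ indicE memNset ?mulr0//= /E/= in_itv/= andbT; apply/negP; rewrite -leNgt.
  near: n; exact: nbhs_infty_ger.
have f_h n x : D x -> (`|f_ n x| <= (`|h x|%R)%:E)%E.
  move=> Dx; rewrite /f_ /= normrM normr_id lee_fin ler_piMr//.
  by rewrite indicE; case: (_ \in _); rewrite ?normr1 ?normr0.
have := @dominated_cvg _ _ R mu D mD f_ (cst 0%E) (fun x => (`|h x|)%:E)
  mf_ f_0 (fun _ _ => isT) inh f_h.
rewrite integral0 => /fine_cvgP[fin].
move=> /cvgrPdist_lt/(_ e e0) H.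
have [N [HN finN]] : exists N : nat, \int[mu]_(x in D) (`|h x| * \1_(E N) x) < e /\
   (\int[mu]_(x in D) f_ N x)%E \is a fin_num.
  have [N _ HN] := filterI H fin.
  exists N; have [h1 h2] := HN N (leqnn _); split=> //.
  by move: h1; rewrite sub0r normrN; apply: le_lt_trans; exact: ler_norm.
exists (N%:R + 1) => [|Y NY]; first by rewrite ltr_wpDl.
apply: le_lt_trans HN; rewrite /Rintegral fine_le//.
  have iY : mu.-integrable `]Y, +oo[ (EFin \o (fun x => `|h x|)).
    apply: integrableS inh => //; apply: subset_itvr; rewrite bnd_simp.
    by apply: le_trans NY; rewrite addr_ge0.
  exact: integrable_fin_num iY.
have -> : `]Y, +oo[%classic = D `&` `]Y, +oo[%classic.
  apply/seteqP; split=> x; rewrite /halfline/= !in_itv/= !andbT; last by case.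
  by move=> h1; split=> //; apply: le_lt_trans h1; apply: le_trans NY; rewrite addr_ge0.
rewrite integral_mkcondr.
apply: (@le_trans _ _ (\int[mu]_(x in D) (`|h x| * \1_(`]Y, +oo[%classic : set R) x)%:E)%E).
  rewrite le_eqVlt; apply/orP; left; apply/eqP/eq_integral => x _.
  by rewrite patchE indicE; case: ifP => _; rewrite ?mulr1 ?mulr0.
apply: ge0_le_integral => //.
- apply/measurable_EFinP/measurable_funM; last exact: measurable_indic.
  by have /measurable_EFinP := measurable_int _ inh.
- exact: mf_.
move=> x Dx; rewrite /f_ lee_fin ler_wpM2l// !indicE; case: (boolP (x \in _)) => // xY.
rewrite mem_set// /E/= in_itv/= andbT.
by move: xY; rewrite inE/= in_itv/= andbT; apply: le_lt_trans; lra.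
Unshelve. all: by end_near. Qed.

Lemma sqint_itv_integrable G (b : R) : sqint mu D G ->
  mu.-integrable `]0, b] (EFin \o G).
Proof.
move=> [mG iG].
have sub : `]0, b] `<=` D by move=> x /=; rewrite /halfline/= !in_itv/= andbT => /andP[].
have i1 : mu.-integrable `]0, b] (EFin \o (fun x => G x ^+ 2)).
  by apply: integrableS iG => //; exact: measurable_halfline.
have i2 := integrable_cst_itv 0 b 1.
apply: (le_integrable _ _ _ (integrableD _ i1 i2)) => //.
  apply/measurable_EFinP; apply: measurable_funS mG => //; exact: measurable_halfline.
move=> x _ /=; rewrite lee_fin; have := sqr_ge0 (G x - 1); have := sqr_ge0 (G x + 1).
move=> h1 h2; rewrite [leRHS]ger0_norm ?addr_ge0 ?sqr_ge0// ler_norml; nra.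
Qed.

Variables c s : R -> R.
Hypotheses (mc : measurable_fun D c) (ms : measurable_fun D s).
Hypothesis cs1 : forall x, c x ^+ 2 + s x ^+ 2 = 1.

(* The canonical system [J u' = - H g] with [H] the projection onto [(c, s)],
   in terms of [G = (c, s) . g] *)
Definition solves u1 u2 G := [/\ forall b, abs_continuous 0 b u1,
  forall b, abs_continuous 0 b u2, u2 0 = 0 &
  {ae mu, forall x : R, 0 < x ->
    is_derive x 1 u1 (- s x * G x) /\ is_derive x 1 u2 (c x * G x)}].

Lemma integrable_mul_le1 h G (b : R) : measurable_fun D h ->
  (forall x, `|h x| <= 1) -> sqint mu D G ->
  mu.-integrable `]0, b] (EFin \o (fun x => h x * G x)).
Proof.
move=> mh h1 sG; apply: (le_integrable _ _ _ (sqint_itv_integrable b sG)) => //.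
  apply/measurable_EFinP; apply: (@measurable_funS _ _ _ _ D).
  - exact: measurable_halfline.
  - by move=> x /=; rewrite /halfline/= !in_itv/= andbT => /andP[].
  - by apply: measurable_funM => //; case: sG.
by move=> x _ /=; rewrite lee_fin normrM ler_piMl.
Qed.

Let c1 x : `|c x| <= 1.
Proof.
rewrite -(ler_pXn2r (n := 2)) ?nnegrE// expr1n real_normK ?num_real//.
by have := cs1 x; have := sqr_ge0 (s x); lra.
Qed.

Let s1 x : `|s x| <= 1.
Proof.
rewrite -(ler_pXn2r (n := 2)) ?nnegrE// expr1n real_normK ?num_real//.
by have := cs1 x; have := sqr_ge0 (c x); lra.
Qed.

(** Cauchy-Schwarz on []0, x]]: with [r = sqrt x], integrate [|G| <= (r G^2 + 1 / r) / 2]; both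
    terms contribute a multiple of [r]. *)
Lemma ac_growth u h G : (forall b, abs_continuous 0 b u) ->
  measurable_fun D h -> (forall x, `|h x| <= 1) -> sqint mu D G ->
  {ae mu, forall x : R, 0 < x -> is_derive x 1 u (h x * G x)} ->
  exists C, forall x, 1 <= x -> `|u x| <= C * Num.sqrt x.
Proof.
move=> acu mh h1 sG du.
pose I := \int[mu]_(x in D) (G x ^+ 2).
have I0 : 0 <= I by apply: Rintegral_ge0 => x _; exact: sqr_ge0.
exists (`|u 0| + (I + 1) / 2) => x x1.
have x0 : 0 < x by lra.
pose r := Num.sqrt x; have r0 : 0 < r by rewrite sqrtr_gt0.
have r2 : r ^+ 2 = x by rewrite sqr_sqrtr// ltW.
have r1 : 1 <= r by rewrite -sqrtr1 ler_wsqrtr.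
have sub : `]0, x] `<=` D by move=> y /=; rewrite /halfline/= !in_itv/= andbT => /andP[].
have ih := integrable_mul_le1 x mh h1 sG.
have ftc : u x - u 0 = \int[mu]_(t in `]0, x]) (h t * G t).
  by apply: ac_ftc => //; [exact: ltW|apply: ae_sub du => y hy /andP[y0 _]; exact: hy].
have : `|u x - u 0| <= r * ((I + 1) / 2).
  rewrite ftc; apply: le_trans (le_normr_Rintegral _ ih) _; first exact: measurable_itv.
  have [mG iG] := sG.
  have i2 : mu.-integrable `]0, x] (EFin \o (fun x => G x ^+ 2)).
    by apply: integrableS iG => //; exact: measurable_halfline.
  have I2 : \int[mu]_(t in `]0, x]) (G t ^+ 2) <= I.
    apply: subset_Rintegral => //; first exact: measurable_halfline.
    by move=> y _; exact: sqr_ge0.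
  have i1 := integrable_cst_itv 0 x (r^-1 / 2).
  have i3 : mu.-integrable `]0, x] (EFin \o (fun y => r / 2 * G y ^+ 2)).
    exact: integrableZl i2.
  apply: (@le_trans _ _ (\int[mu]_(t in `]0, x]) (r / 2 * G t ^+ 2 + r^-1 / 2))).
    apply: le_Rintegral => //; first exact: integrable_norm ih.
      exact: integrableD i3 i1.
    move=> y _; rewrite normrM; apply: (@le_trans _ _ `|G y|); first by rewrite ler_piMl.
    have := sqr_ge0 (r * `|G y| - 1).
    rewrite -(real_normK (num_real (G y))) => h2.
    rewrite -(ler_pM2l r0) mulrDr [r * (r^-1 / 2)]mulrA divff ?gt_eqF//; nra.
  rewrite RintegralD// RintegralZl// Rintegral_cst//= lebesgue_measure_itv/= lte_fin x0.
  rewrite -EFinD subr0 /=.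
  have -> : r^-1 / 2 * x = r / 2 by rewrite -r2; field; rewrite gt_eqF.
  by move: I2; move: (\int[mu]_(_ in _) _) => J; nra.
have := lerB_dist (u x) (u 0).
have := normr_ge0 (u 0); rewrite -/r; nra.
Qed.

Lemma solves_growth u1 u2 G : solves u1 u2 G -> sqint mu D G ->
  exists2 C, 0 < C & forall x, 1 <= x ->
    `|u1 x| <= C * Num.sqrt x /\ `|u2 x| <= C * Num.sqrt x.
Proof.
move=> [ac1 ac2 _ du] sG.
have [|||C1 h1] := @ac_growth u1 (fun x => - s x) G ac1 _ _ sG _.
- exact: measurableT_comp.
- by move=> x; rewrite normrN.
- by apply: ae_sub du => x hx /hx[].
have [|C2 h2] := @ac_growth u2 c G ac2 mc c1 sG _.
  by apply: ae_sub du => x hx /hx[].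
exists (`|C1| + `|C2| + 1) => [|x x1]; first by have := normr_ge0 C1; have := normr_ge0 C2; lra.
have r0 := sqrtr_ge0 x.
have := h1 x x1; have := h2 x x1; have := ler_norm C1; have := ler_norm C2.
by have := normr_ge0 C1; have := normr_ge0 C2; split; nra.
Qed.

(** The Wronskian vanishes at 0 by the boundary condition, and its derivative is [F K - G L] almost
    everywhere. *)
Lemma wronskian_ftc u1 u2 G v1 v2 K (x : R) : solves u1 u2 G -> solves v1 v2 K ->
  forall F (L : R -> R), sqint mu D F -> sqint mu D G -> sqint mu D K -> sqint mu D L ->
  {ae mu, forall x : R, 0 < x -> F x = c x * u1 x + s x * u2 x} ->
  {ae mu, forall x : R, 0 < x -> L x = c x * v1 x + s x * v2 x} -> 0 <= x ->
  u1 x * v2 x - u2 x * v1 x = \int[mu]_(t in `]0, x]) (F t * K t - G t * L t).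
Proof.
move=> [acu1 acu2 u20 du] [acv1 acv2 v20 dv] F L sF sG sK sL FE LE x0.
pose W x := u1 x * v2 x + (-1) * (u2 x * v1 x).
have -> : u1 x * v2 x - u2 x * v1 x = W x - W 0 by rewrite /W u20 v20; ring.
apply: ac_ftc => //.
- by apply: ac_lin; exact: acM.
- have mD := @measurable_halfline R.
  apply: (@integrableS _ _ _ mu D) => //.
    by move=> y /=; rewrite /halfline/= !in_itv/= andbT => /andP[].
  exact: integrableB (sqint_mul mD sF sK) (sqint_mul mD sG sL).
apply: ae_sub (ae_and (ae_and du dv) (ae_and FE LE)) => y [[hu hv] [hF hL]] /andP[y0 _].
have [du1 du2] := hu y0; have [dv1 dv2] := hv y0.
have h1 := is_deriveM du1 dv2; have h2 := is_deriveM du2 dv1.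
apply: is_derive_eq (is_deriveD h1 (is_deriveZ (-1) h2)) _.
rewrite hF// hL// /GRing.scale/=; ring.
Qed.

(* The boundary term at infinity vanishes: since [u] and [v] are [O(sqrt x)], a
   Wronskian that stays away from [0] would make the integral of [F ^ 2 + L ^ 2]
   over [[Y, 2 Y]] bounded below as [Y] tends to infinity. *)
Lemma green u1 u2 G v1 v2 K F (L : R -> R) : solves u1 u2 G -> solves v1 v2 K ->
  sqint mu D F -> sqint mu D G -> sqint mu D K -> sqint mu D L ->
  {ae mu, forall x : R, 0 < x -> F x = c x * u1 x + s x * u2 x} ->
  {ae mu, forall x : R, 0 < x -> L x = c x * v1 x + s x * v2 x} ->
  \int[mu]_(x in D) (F x * K x) = \int[mu]_(x in D) (G x * L x).
Proof.
move=> su sv sF sG sK sL FE LE; have mD := @measurable_halfline R.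
have iFK := sqint_mul mD sF sK; have iGL := sqint_mul mD sG sL.
pose q x := F x * K x - G x * L x.
have iq : mu.-integrable D (EFin \o q) by exact: integrableB iFK iGL.
apply/eqP; rewrite -subr_eq0 -RintegralB//; apply/negPn/negP => I0.
pose I := \int[mu]_(x in D) q x; pose d := `|I|.
have d0 : 0 < d by rewrite normr_gt0.
have [C C0 hC] := solves_growth su sG; have [C' C'0 hC'] := solves_growth sv sK.
pose M := C + C'; have M0 : 0 < M by rewrite addr_gt0.
have d2 : 0 < d / 2 by rewrite divr_gt0.
have [X1 X10 hX1] := integrable_tail iq d2.
(* The Wronskian at [Y] is the integral of [q] over []0, Y]], so it differs from [I] by the tail,
   which is below [d / 2]. *)
have W_ge Y : X1 <= Y -> d / 2 < `|u1 Y * v2 Y - u2 Y * v1 Y|.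
  move=> XY; have Y0 : 0 < Y by exact: lt_le_trans XY.
  rewrite (wronskian_ftc su sv sF sG sK sL FE LE (ltW Y0)) -/q.
  have split_q : I - \int[mu]_(x in `]0, Y]) q x = \int[mu]_(x in `]Y, +oo[) q x.
    by apply: Rintegral_itvB => //; rewrite bnd_simp ltW.
  have iqY : mu.-integrable `]Y, +oo[ (EFin \o q).
    apply: integrableS iq => //; apply: subset_itvr; rewrite bnd_simp.
    exact: ltW.
  have : `|\int[mu]_(x in `]Y, +oo[) q x| <= \int[mu]_(x in `]Y, +oo[) `|q x|.
    by apply: le_normr_Rintegral iqY; exact: measurable_itv.
  rewrite -split_q.
  have := hX1 Y XY; have := lerB_dist I (\int[mu]_(x in `]0, Y]) q x).
  by rewrite -/d; lra.
pose p x := F x ^+ 2 + L x ^+ 2.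
have ip : mu.-integrable D (EFin \o p).
  by case: sF => _ iF; case: sL => _ iL; exact: integrableD iF iL.
have eta0 : 0 < d ^+ 2 / (64 * M ^+ 2) by rewrite divr_gt0 ?exprn_gt0 ?mulr_gt0 ?exprn_gt0.
have [X2 X20 hX2] := integrable_tail ip eta0.
pose Y := Num.max (Num.max X1 X2) 1.
have Y1 : 1 <= Y by rewrite le_max lexx orbT.
have YX1 : X1 <= Y by rewrite !le_max lexx.
have YX2 : X2 <= Y by rewrite !le_max lexx orbT.
have := hX2 Y YX2; apply/negP; rewrite -leNgt.
(* From [(d / 2)^2 <= 8 M^2 x p] and [x <= 2 Y] one gets [p >= k] on []Y, 2 Y]], an interval of
   length [Y]. *)
pose k := d ^+ 2 / (64 * M ^+ 2) / Y.
have k0 : 0 < k by rewrite divr_gt0//; lra.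
have ipY : mu.-integrable `]Y, +oo[ (EFin \o (fun x => `|p x|)).
  apply: integrable_norm; apply: integrableS ip => //; apply: subset_itvr.
  by rewrite bnd_simp; lra.
have sub2 : `]Y, 2 * Y] `<=` `]Y, +oo[.
  by move=> x /=; rewrite !in_itv/= andbT => /andP[].
have ip2 : mu.-integrable `]Y, 2 * Y] (EFin \o (fun x => `|p x|)).
  exact: integrableS ipY.
apply: (@le_trans _ _ (\int[mu]_(x in `]Y, 2 * Y]) `|p x|)); last first.
  exact: subset_Rintegral.
have -> : d ^+ 2 / (64 * M ^+ 2) = \int[mu]_(x in `]Y, 2 * Y]) k.
  rewrite Rintegral_cst//= lebesgue_measure_itv/= lte_fin.
  have -> : Y < 2 * Y by lra.
  by rewrite -EFinD /= /k; field; rewrite !gt_eqF//; lra.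
rewrite /Rintegral fine_le//.
- exact: integrable_fin_num (integrable_cst_itv _ _ _).
- exact: integrable_fin_num ip2.
apply: ae_ge0_le_integral => //.
- by move=> x _; rewrite lee_fin ltW.
- exact: measurable_int ip2.
apply: ae_sub (ae_and FE LE) => x [hF hL] /=; rewrite in_itv/= => /andP[Yx xY].
have x1 : 1 <= x by lra.
have x0 : 0 < x by lra.
rewrite lee_fin ger0_norm ?addr_ge0 ?sqr_ge0//.
have [hu1 hu2] := hC x x1; have [hv1 hv2] := hC' x x1.
pose r := Num.sqrt x; have r0 : 0 <= r by exact: sqrtr_ge0.
have r2 : r ^+ 2 = x by rewrite sqr_sqrtr// ltW.
have CM : C <= M by rewrite lerDl ltW.
have C'M : C' <= M by rewrite lerDr ltW.
have bnd (y A : R) : A <= M -> `|y| <= A * r -> `|y| <= M * r.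
  by move=> AM /le_trans; apply; exact: ler_wpM2r.
have := wronskian_sq_le (cs1 x) (bnd _ _ CM hu1) (bnd _ _ CM hu2) (bnd _ _ C'M hv1)
  (bnd _ _ C'M hv2).
rewrite exprMn r2 -hF// -hL// -/(p x) => Wp.
have Wx := W_ge x (le_trans YX1 (ltW Yx)).
have {}Wx : (d / 2) ^+ 2 <= 8 * (M ^+ 2 * x) * p x.
  apply: le_trans Wp; rewrite -(real_normK (num_real (_ - _))).
  by rewrite ler_pXn2r ?nnegrE//; exact: ltW.
have p0 : 0 <= p x by rewrite addr_ge0 ?sqr_ge0.
have Mp : M ^+ 2 * p x * x <= M ^+ 2 * p x * (2 * Y).
  by apply: ler_wpM2l => //; rewrite mulr_ge0 ?sqr_ge0.
rewrite /k ler_pdivrMr; last exact: lt_le_trans Y1.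
rewrite ler_pdivrMr ?mulr_gt0 ?exprn_gt0//.
move: Wx Mp; clear; lra.
Qed.

End green.

(** * Reduction to scalar functions *)

Section ae_eq_integral_nonmeasurable.
Import HBNNSimple.
Context d (T : measurableType d) (R : realType) (mu : {measure set T -> \bar R}).
Implicit Types f g : T -> \bar R.

(* The integral of a nonnegative function is a supremum over the simple
   functions below it, whether or not the function is measurable. *)
Lemma ae_eq_nnintegral_le f g : (forall x, (0 <= f x)%E) ->
  (forall x, (0 <= g x)%E) -> {ae mu, forall x, f x = g x} ->
  (\int[mu]_x f x <= \int[mu]_x g x)%E.
Proof.
move=> f0 g0 [N [mN N0 hN]].
rewrite !ge0_integralTE//; apply: ge_ereal_sup => _ [h /= hf <-].
have mNC : measurable (~` N) by exact: measurableC.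
pose h' : {nnsfun T >-> R} := proj_nnsfun h mNC.
have h'E (x : T) : h' x = h x * \1_(~` N) x by rewrite /h' /= mindicE indicE.
have h'g (x : T) : ((h' x)%:E <= g x)%E.
  rewrite h'E indicE; case: (boolP (x \in ~` N)) => [|_]; last by rewrite mulr0.
  rewrite inE/= mulr1 => nNx; apply: le_trans (hf x) _.
  rewrite le_eqVlt; apply/orP; left; apply/eqP.
  by apply: contrapT => fg; apply/nNx/hN.
have -> : sintegral mu h = sintegral mu h'.
  rewrite -!integralT_nnsfun; apply: ge0_ae_eq_integral => //.
  - by apply/measurable_EFinP.
  - by apply/measurable_EFinP.
  - by move=> x _; rewrite lee_fin.
  - by move=> x _; rewrite lee_fin.
  exists N; split=> // x /= hx; apply: contrapT => nNx; apply: hx => _.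
  by congr EFin; rewrite [RHS]h'E indicE mem_set// mulr1.
by apply: ereal_sup_ubound; exists h'.
Qed.

(** The coefficient [H] is Lebesgue but perhaps not Borel measurable, and so is [qform H f]. This
    lemma lets it be replaced under the integral by a Borel expression in [phi]. *)
Lemma ae_eq_integral_nonmeas (D : set T) f g :
  {ae mu, forall x, D x -> f x = g x} ->
  (\int[mu]_(x in D) f x = \int[mu]_(x in D) g x)%E.
Proof.
move=> [N [mN N0 hN]].
have fg x : ~ N x -> (f \_ D) x = (g \_ D) x.
  move=> nN; rewrite !patchE; case: ifPn => // /set_mem Dx.
  by apply: contrapT => h; apply/nN/hN => /(_ Dx).
rewrite integral_mkcond [RHS]integral_mkcond integralE [RHS]integralE.
have eqN (F G : T -> \bar R) : (forall x, (0 <= F x)%E) -> (forall x, (0 <= G x)%E) ->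
    (forall x, ~ N x -> F x = G x) -> (\int[mu]_x F x = \int[mu]_x G x)%E.
  move=> F0 G0 FG; apply/eqP; rewrite eq_le.
  apply/andP; split; apply: ae_eq_nnintegral_le => //; exists N; split=> // x /= h.
    by apply: contrapT => /FG.
  by apply: contrapT => /FG/esym.
by congr (_ - _)%E; apply: eqN => // x nN; rewrite ?funeposE ?funenegE fg.
Qed.

End ae_eq_integral_nonmeasurable.

Lemma ac_measurable (R : realType) (u : R -> R) :
  (forall b, abs_continuous 0 b u) -> measurable_fun (@halfline R) u.
Proof.
move=> acu; apply: open_continuous_measurable_fun; first exact: interval_open.
move=> x; rewrite inE /halfline/= in_itv/= andbT => x0.
apply/cvgrPdist_lt => e e0; have [d d0 hd] := ac_point (acu (x + 1)) e0.
apply/nbhs_ballP; exists (Num.min d (Num.min x 1)) => [|y].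
  by rewrite /= !lt_min d0 x0 ltr01.
rewrite /ball/= !lt_min => /andP[xyd /andP[xyx xy1]].
rewrite distrC; apply: hd; last by rewrite distrC.
  by rewrite (ltW x0)/= lerDl.
by move: xyx xy1; rewrite !ltr_norml; lra.
Qed.

(** * Transfer from the complex space [L^2_H] to pairs of real functions *)

Section bridge.
Variables (R : realType) (phi : R -> R).
Notation mu := (@lebesgue_measure R).
Notation D := (@halfline R).
Notation C := R[i].
Implicit Types (f g : R -> 'cV[C]_2).

Definition reF f (x : R) : R :=
  cos (phi x) * complex.Re (f x 0 0) + sin (phi x) * complex.Re (f x 1 0).
Definition imF f (x : R) : R :=
  cos (phi x) * complex.Im (f x 0 0) + sin (phi x) * complex.Im (f x 1 0).

Lemma qform_Pmx (H : R -> 'M[R]_2) f x : H x = Pmx (phi x) ->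
  qform H f x = reF f x ^+ 2 + imF f x ^+ 2.
Proof.
rewrite /qform => ->; rewrite /reF /imF /adjmx /tocplx /Pmx /evec.
rewrite !mxE !big_ord_recl big_ord0 !mxE !big_ord_recl !big_ord0 !mxE /=.
rewrite !big_ord_recl !big_ord0 !mxE /=.
have -> : lift ord0 (ord0 : 'I_1) = 1 :> 'I_2 by apply/val_inj.
case: (f x ord0 ord0) => a0 b0; case: (f x 1 ord0) => a1 b1.
rewrite /=; ring.
Qed.

Section bridge_ae.
Variable H : R -> 'M[R]_2.
Hypothesis Hphi : {ae mu, forall x : R, 0 < x -> H x = Pmx (phi x)}.
Hypothesis phi_decr : forall x y : R, 0 < x -> x <= y -> phi y <= phi x.

Let mD : @measurable _ (measurableTypeR R) D := @measurable_halfline R.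

Lemma halflineE (x : R) : D x = (0 < x) :> Prop.
Proof. by rewrite /halfline/= in_itv/= andbT. Qed.

(** [phi] is monotone on the half line only, while [phi \o expR] is monotone on the whole line. *)
Lemma measurable_phi : measurable_fun D phi.
Proof.
apply: (@eq_measurable_fun _ _ _ _ D ((phi \o expR) \o (@ln R))).
  by move=> x; rewrite inE halflineE => x0 /=; rewrite lnK.
apply: (@measurable_comp _ _ _ _ _ _ setT) => //.
- by apply: nonincreasing_measurable => // x y xy; apply: phi_decr; rewrite ?expR_gt0 ?ler_expR.
- exact: measurable_funTS (@measurable_ln R).
Qed.

Lemma measurable_cos_phi : measurable_fun D (cos \o phi).
Proof.
apply: (measurableT_comp _ measurable_phi).
by apply: continuous_measurable_fun; exact: continuous_cos.
Qed.

Lemma measurable_sin_phi : measurable_fun D (sin \o phi).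
Proof.
apply: (measurableT_comp _ measurable_phi).
by apply: continuous_measurable_fun; exact: continuous_sin.
Qed.

Definition cmeas f := forall i,
  measurable_fun D (fun x : R => complex.Re (f x i 0)) /\
  measurable_fun D (fun x : R => complex.Im (f x i 0)).

Lemma measurable_reF f : cmeas f -> measurable_fun D (reF f).
Proof.
move=> mf; have [m0 _] := mf 0; have [m1 _] := mf 1.
by apply: measurable_funD; apply: measurable_funM => //;
  [exact: measurable_cos_phi|exact: measurable_sin_phi].
Qed.

Lemma measurable_imF f : cmeas f -> measurable_fun D (imF f).
Proof.
move=> mf; have [_ m0] := mf 0; have [_ m1] := mf 1.
by apply: measurable_funD; apply: measurable_funM => //;
  [exact: measurable_cos_phi|exact: measurable_sin_phi].
Qed.

Lemma sqnormE f :
  sqnorm H f = (\int[mu]_(x in D) (reF f x ^+ 2 + imF f x ^+ 2)%:E)%E.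
Proof.
apply: ae_eq_integral_nonmeas; apply: ae_sub Hphi => x hx.
by rewrite /= in_itv/= andbT => /hx/qform_Pmx ->.
Qed.

Lemma L2_sqint f : L2 H f -> sqint mu D (reF f) /\ sqint mu D (imF f).
Proof.
move=> [mf]; rewrite sqnormE => fin; have m1 := measurable_reF mf.
have m2 := measurable_imF mf.
split; split => //; apply/integrableP; split;
  try by apply/measurable_EFinP/measurable_funX.
all: apply: le_lt_trans fin; apply: ge0_le_integral => //.
all: try by apply: measurableT_comp => //; apply/measurable_EFinP/measurable_funX.
all: try by apply/measurable_EFinP/measurable_funD; exact: measurable_funX.
all: move=> x _; rewrite /= lee_fin ger0_norm ?sqr_ge0//.
all: by rewrite ?lerDl ?lerDr sqr_ge0.
Qed.

(** The default value 0 is taken by a component that is not square integrable, so never on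
    [L2 H]. *)
Definition toV f : l2fun R * l2fun R := (insubd 0 (reF f), insubd 0 (imF f)).

Lemma toVE f : L2 H f -> (toV f).1 = reF f :> (R -> R) /\ (toV f).2 = imF f :> (R -> R).
Proof.
by move=> /L2_sqint[s1 s2]; split; apply: insubdK; apply/asboolP.
Qed.

(** The representative parallel to [e_phi] at every point; any component perpendicular to [e_phi] is
    invisible to [L^2_H]. *)
Definition ofV (p : l2fun R * l2fun R) (x : R) : 'cV[C]_2 :=
  \col_i ((evec (phi x) i 0 * p.1 x) +i* (evec (phi x) i 0 * p.2 x))%C.

Lemma cs1 x : cos (phi x) ^+ 2 + sin (phi x) ^+ 2 = 1.
Proof. exact: cos2Dsin2. Qed.

Lemma reF_ofV p : reF (ofV p) = p.1.
Proof.
apply/funext => x; rewrite /reF /ofV !mxE /= !mulrA -!expr2 -mulrDl cs1 mul1r//.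
Qed.

Lemma imF_ofV p : imF (ofV p) = p.2.
Proof.
apply/funext => x; rewrite /imF /ofV !mxE /= !mulrA -!expr2 -mulrDl cs1 mul1r//.
Qed.

Lemma sqnorm_V f (p : l2fun R * l2fun R) : (forall x, reF f x = p.1 x) ->
  (forall x, imF f x = p.2 x) -> sqnorm H f = (cprod p p)%:E.
Proof.
move=> h1 h2; rewrite sqnormE; under eq_integral do rewrite h1 h2 EFinD !expr2.
rewrite integralD//; [|exact: l2prod_integrable..].
rewrite /cprod /l2prod /Rintegral EFinD !fineK//; apply: integrable_fin_num => //;
  exact: l2prod_integrable.
Qed.

Lemma L2_ofV p : L2 H (ofV p).
Proof.
have m1 : measurable_fun D p.1 by have [] := l2fun_sqint p.1.
have m2 : measurable_fun D p.2 by have [] := l2fun_sqint p.2.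
have me (i : 'I_2) : measurable_fun D (fun x : R => evec (phi x) i 0).
  case: (eqVneq i 0) => [->|i0].
    by under eq_fun do rewrite /evec mxE /=; exact: measurable_cos_phi.
  by under eq_fun do rewrite /evec mxE (negbTE i0); exact: measurable_sin_phi.
split=> [i|]; last first.
  by rewrite (@sqnorm_V _ p) ?ltry// => x; rewrite ?reF_ofV ?imF_ofV.
have -> : (fun x => complex.Re (ofV p x i 0)) = (fun x => evec (phi x) i 0 * p.1 x).
  by apply/funext => x; rewrite !mxE.
have -> : (fun x => complex.Im (ofV p x i 0)) = (fun x => evec (phi x) i 0 * p.2 x).
  by apply/funext => x; rewrite !mxE.
by split; apply: measurable_funM => //; exact: me.
Qed.

Lemma ofVK p : toV (ofV p) = p.
Proof.
have [h1 h2] := toVE (L2_ofV p); rewrite reF_ofV in h1; rewrite imF_ofV in h2.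
by rewrite [RHS]surjective_pairing [LHS]surjective_pairing; congr pair; apply: val_inj.
Qed.

Lemma canonical_eqP g x (d : 'cV[C]_2) : H x = Pmx (phi x) ->
  (tocplx (Jmx R) *m d = - (tocplx (H x) *m g x)) <->
  [/\ complex.Re (d 0 0) = - sin (phi x) * reF g x,
      complex.Re (d 1 0) = cos (phi x) * reF g x,
      complex.Im (d 0 0) = - sin (phi x) * imF g x &
      complex.Im (d 1 0) = cos (phi x) * imF g x].
Proof.
move=> ->; have l1 : lift ord0 (ord0 : 'I_1) = 1 :> 'I_2 by apply/val_inj.
have e00 : (tocplx (Jmx R) *m d) 0 0 = - d 1 0.
  by rewrite mxE !big_ord_recl big_ord0 !mxE /= l1 ?mxE/=; case: (d 0 0) (d 1 0) => [? ?] [? ?];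
    apply/eqP; rewrite eq_complex /=; apply/andP; split; apply/eqP; ring.
have e10 : (tocplx (Jmx R) *m d) 1 0 = d 0 0.
  by rewrite mxE !big_ord_recl big_ord0 !mxE /= l1 ?mxE/=; case: (d 0 0) (d 1 0) => [? ?] [? ?];
    apply/eqP; rewrite eq_complex /=; apply/andP; split; apply/eqP; ring.
have h (i : 'I_2) : (tocplx (Pmx (phi x)) *m g x) i 0 =
    ((evec (phi x) i 0 * reF g x) +i* (evec (phi x) i 0 * imF g x))%C.
  rewrite mxE !big_ord_recl big_ord0 !mxE !big_ord_recl !big_ord0 !mxE /= l1 /reF /imF.
  case: (g x 0 0) => a0 b0; case: (g x 1 0) => a1 b1 /=.
  by apply/eqP; rewrite eq_complex /=; apply/andP; split; apply/eqP; ring.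
split.
  move=> E; have E0 := congr1 (fun M : 'cV[C]_2 => M 0 0) E.
  have E1 := congr1 (fun M : 'cV[C]_2 => M 1 0) E; rewrite /= in E0 E1.
  rewrite e00 mxE h /evec mxE/= in E0; rewrite e10 mxE h /evec mxE/= in E1.
  move: E0 E1; case: (d 0 0) => a0 b0; case: (d 1 0) => a1 b1.
  by move=> /eqP + /eqP; rewrite !eq_complex /= !eqr_opp => /andP[/eqP-> /eqP->] /andP[/eqP-> /eqP->];
    split; ring.
move=> [h1 h2 h3 h4]; apply/matrixP => i j; rewrite (ord1 j).
move: h1 h2 h3 h4; have := e00; have := e10.
have [->|i0] := eqVneq i 0.
  move=> _ ->; rewrite mxE h /evec mxE/=; case: (d 1 0) => a1 b1 /= _ -> _ ->.
  by apply/eqP; rewrite eq_complex /= !eqxx.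
have -> : i = 1 by case: i i0 => [[|[|//]]] //= ? _; apply/val_inj.
move=> -> _; rewrite mxE h /evec mxE/=; case: (d 0 0) => a0 b0 /= -> _ -> _.
by apply/eqP; rewrite eq_complex /= !mulNr !eqxx.
Qed.

(** The real form of the relation: [(u1, u2)] is the absolutely continuous representative, and [F]
    and [G] are the components along [e_phi] of the two entries. *)
Definition solvable (F G : R -> R) := exists u1 u2,
  solves (cos \o phi) (sin \o phi) u1 u2 G /\
  {ae mu, forall x : R, 0 < x -> F x = cos (phi x) * u1 x + sin (phi x) * u2 x}.

Lemma L2eq_ae f g : cmeas (fun x => f x - g x) -> L2eq H f g ->
  {ae mu, forall x : R, 0 < x -> reF f x = reF g x /\ imF f x = imF g x}.
Proof.
move=> mfg; rewrite /L2eq sqnormE => h0.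
have m1 := measurable_reF mfg; have m2 := measurable_imF mfg.
pose q x := (reF (fun x => f x - g x) x ^+ 2 + imF (fun x => f x - g x) x ^+ 2)%:E.
have m : measurable_fun D q.
  by apply/measurable_EFinP/measurable_funD; exact: measurable_funX.
have q0 : (\int[mu]_(x in D) `|q x| = 0)%E.
  rewrite -h0; apply: eq_integral => x _.
  by rewrite gee0_abs// lee_fin addr_ge0 ?sqr_ge0.
have := (ae_eq_integral_abs _ mD m).1 q0.
apply: ae_sub => x hx x0.
have /eqP : reF (fun x => f x - g x) x ^+ 2 + imF (fun x => f x - g x) x ^+ 2 = 0.
  by apply: EFin_inj; apply: hx; rewrite halflineE.
rewrite paddr_eq0 ?sqr_ge0// !sqrf_eq0 => /andP[/eqP e1 /eqP e2].
split; apply/eqP; rewrite -subr_eq0; apply/eqP.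
  rewrite -e1 /reF !mxE; case: (f x 0 0) (f x 1 0) (g x 0 0) (g x 1 0) =>
    [? ?] [? ?] [? ?] [? ?] /=; ring.
rewrite -e2 /imF !mxE; case: (f x 0 0) (f x 1 0) (g x 0 0) (g x 1 0) =>
  [? ?] [? ?] [? ?] [? ?] /=; ring.
Qed.

Lemma reFB f g x : reF (fun x => f x - g x) x = reF f x - reF g x.
Proof.
rewrite /reF !mxE; case: (f x 0 0) (f x 1 0) (g x 0 0) (g x 1 0) =>
  [? ?] [? ?] [? ?] [? ?] /=; ring.
Qed.

Lemma imFB f g x : imF (fun x => f x - g x) x = imF f x - imF g x.
Proof.
rewrite /imF !mxE; case: (f x 0 0) (f x 1 0) (g x 0 0) (g x 1 0) =>
  [? ?] [? ?] [? ?] [? ?] /=; ring.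
Qed.

Lemma ae_L2eq f g :
  {ae mu, forall x : R, 0 < x -> reF f x = reF g x /\ imF f x = imF g x} ->
  L2eq H f g.
Proof.
move=> fg; rewrite /L2eq sqnormE.
rewrite (ae_eq_integral_nonmeas (g := cst 0%E)) ?integral0//.
apply: ae_sub fg => x h; rewrite halflineE => /h[e1 e2].
by rewrite reFB imFB e1 e2 !subrr expr0n addr0.
Qed.

(** The system and its boundary condition have real coefficients, so real and imaginary parts
    satisfy it separately. *)
Lemma relS_solvable f g : L2 H f -> L2 H g ->
  relS H f g <-> solvable (reF f) (reF g) /\ solvable (imF f) (imF g).
Proof.
move=> Lf Lg; split.
  move=> [_ _ [f0 [ff0 acf0 df0 f00]]].
  have mf0 : cmeas f0.
    by move=> i; split; apply: ac_measurable => b; case: (acf0 b i).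
  have mff0 : cmeas (fun x => f x - f0 x).
    move=> i; have [m1 m2] := Lf.1 i; have [m3 m4] := mf0 i.
    have -> : (fun x => complex.Re ((f x - f0 x) i 0)) =
        (fun x => complex.Re (f x i 0) - complex.Re (f0 x i 0)).
      by apply/funext => x; rewrite !mxE; case: (f x i 0) (f0 x i 0) => [? ?] [? ?].
    have -> : (fun x => complex.Im ((f x - f0 x) i 0)) =
        (fun x => complex.Im (f x i 0) - complex.Im (f0 x i 0)).
      by apply/funext => x; rewrite !mxE; case: (f x i 0) (f0 x i 0) => [? ?] [? ?].
    by split; exact: measurable_funB.
  have ae0 := L2eq_ae mff0 ff0.
  have ders : {ae mu, forall x : R, 0 < x -> exists2 d, is_deriv f0 x d &
    [/\ complex.Re (d 0 0) = - sin (phi x) * reF g x,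
      complex.Re (d 1 0) = cos (phi x) * reF g x,
      complex.Im (d 0 0) = - sin (phi x) * imF g x &
      complex.Im (d 1 0) = cos (phi x) * imF g x]}.
    apply: ae_sub (ae_and Hphi df0) => x [hx hd] x0.
    by have [d dd] := hd x0; exists d => //; apply/canonical_eqP => //; exact: hx.
  split.
    exists (fun x => complex.Re (f0 x 0 0)), (fun x => complex.Re (f0 x 1 0)); split.
      split=> [b|b||].
      - by case: (acf0 b 0).
      - by case: (acf0 b 1).
      - by rewrite f00.
      apply: ae_sub ders => x hd /hd[d dd [<- <- _ _]].
      by split; [case: (dd 0)|case: (dd 1)].
    by apply: ae_sub ae0 => x h /h[].
  exists (fun x => complex.Im (f0 x 0 0)), (fun x => complex.Im (f0 x 1 0)); split.
    split=> [b|b||].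
    - by case: (acf0 b 0).
    - by case: (acf0 b 1).
    - by rewrite f00.
    apply: ae_sub ders => x hd /hd[d dd [_ _ <- <-]].
    by split; [case: (dd 0)|case: (dd 1)].
  by apply: ae_sub ae0 => x h /h[].
move=> [[u1 [u2 [[acu1 acu2 u20 du] hF]]] [v1 [v2 [[acv1 acv2 v20 dv] hG]]]].
split=> //; pose f0 x : 'cV[C]_2 :=
  \col_i (if i == 0 then (u1 x +i* v1 x) else (u2 x +i* v2 x))%C.
have reE (i : 'I_2) : (fun x => complex.Re (f0 x i 0)) = if i == 0 then u1 else u2.
  by apply/funext => x; rewrite mxE; case: ifP.
have imE (i : 'I_2) : (fun x => complex.Im (f0 x i 0)) = if i == 0 then v1 else v2.
  by apply/funext => x; rewrite mxE; case: ifP.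
exists f0; split.
- apply: ae_L2eq; apply: ae_sub (ae_and hF hG) => x [h1 h2] x0.
  by rewrite h1// h2// /reF /imF /f0 !mxE.
- by move=> b i; rewrite reE imE; case: ifP.
- apply: ae_sub (ae_and Hphi (ae_and du dv)) => x [hx [h1 h2]] x0.
  have [d1 d2] := h1 x0; have [d3 d4] := h2 x0.
  exists (\col_i (if i == 0
     then ((- sin (phi x) * reF g x) +i* (- sin (phi x) * imF g x))
     else ((cos (phi x) * reF g x) +i* (cos (phi x) * imF g x)))%C).
    by move=> i; rewrite reE imE !mxE; case: ifP.
  by apply/canonical_eqP; [exact: hx|rewrite !mxE].
- by rewrite /f0 mxE /= u20 v20.
Qed.

Lemma ae_solvable F G F' G' : solvable F G ->
  {ae mu, forall x : R, 0 < x -> F x = F' x} ->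
  {ae mu, forall x : R, 0 < x -> G x = G' x} -> solvable F' G'.
Proof.
move=> [u1 [u2 [[ac1 ac2 u20 du] hF]]] FF' GG'; exists u1, u2; split.
  split=> //; apply: ae_sub (ae_and du GG') => x [hx gg] x0.
  by rewrite -gg//; exact: hx.
by apply: ae_sub (ae_and hF FF') => x [h1 h2] x0; rewrite -h2// h1.
Qed.

Lemma solvable_lin a F G F' G' : solvable F G -> solvable F' G' ->
  solvable (fun x => a * F x + F' x) (fun x => a * G x + G' x).
Proof.
move=> [u1 [u2 [[ac1 ac2 u20 du] hF]]] [v1 [v2 [[acv1 acv2 v20 dv] hF']]].
exists (fun x => v1 x + a * u1 x), (fun x => v2 x + a * u2 x); split.
  split; [by move=> b; exact: ac_lin|by move=> b; exact: ac_lin| |].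
    by rewrite u20 v20 mulr0 addr0.
  apply: ae_sub (ae_and du dv) => x [h1 h2] x0.
  have [d1 d2] := h1 x0; have [e1 e2] := h2 x0.
  split; first apply: is_derive_eq (is_deriveD e1 (is_deriveZ a d1)) _.
    by rewrite /GRing.scale/=; ring.
  apply: is_derive_eq (is_deriveD e2 (is_deriveZ a d2)) _.
  by rewrite /GRing.scale/=; ring.
apply: ae_sub (ae_and hF hF') => x [h1 h2] x0.
by rewrite h1// h2//; ring.
Qed.

Lemma solvable0 : solvable (fun=> 0) (fun=> 0).
Proof.
have ac0 (b : R) : abs_continuous 0 b (fun=> 0 : R).
  move=> e e0; exists 1 => // n s t _ _ _.
  by rewrite big1// => i _; rewrite subrr normr0.
exists (fun=> 0), (fun=> 0); split; last by apply: aeW => x _; rewrite !mulr0 addr0.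
split=> //; apply: aeW => x _; rewrite !mulr0; split; exact: is_derive_cst.
Qed.

Definition SrV (p q : l2fun R * l2fun R) := solvable p.1 q.1 /\ solvable p.2 q.2.

Lemma SrV0 : SrV 0 0.
Proof. by split; exact: solvable0. Qed.

Lemma SrV_lin a p q p' q' : SrV p q -> SrV p' q' -> SrV (a *: p + p') (a *: q + q').
Proof.
have linE (F G : l2fun R) : l2val (a *: F + G) = (fun x => a * F x + G x) by [].
move=> [s1 s2] [s1' s2']; rewrite /SrV.
have -> : (a *: p + p').1 = a *: p.1 + p'.1 by [].
have -> : (a *: p + p').2 = a *: p.2 + p'.2 by [].
have -> : (a *: q + q').1 = a *: q.1 + q'.1 by [].
have -> : (a *: q + q').2 = a *: q.2 + q'.2 by [].
by rewrite !linE; split; [exact: (solvable_lin a s1 s1')|exact: (solvable_lin a s2 s2')].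
Qed.

Lemma SrV_sym p q p' q' : SrV p q -> SrV p' q' -> cprod p q' = cprod q p'.
Proof.
have green1 (F G K L : l2fun R) : solvable F G -> solvable L K ->
    l2prod F K = l2prod G L.
  move=> [u1 [u2 [su hF]]] [v1 [v2 [sv hL]]].
  apply: (green measurable_cos_phi measurable_sin_phi cs1 su sv) => //;
    exact: l2fun_sqint.
move=> [s1 s2] [s1' s2'].
have e1 := green1 _ _ _ _ s1 s1'; have e2 := green1 _ _ _ _ s2 s2'.
by rewrite /cprod; exact: (congr2 +%R e1 e2).
Qed.

Lemma l2prod_eq0 (F : l2fun R) : l2prod F F = 0 -> {ae mu, forall x : R, 0 < x -> F x = 0}.
Proof.
move=> F0; have [mF iF] := l2fun_sqint F.
pose q x := (F x ^+ 2)%:E.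
have mq : measurable_fun D q by apply/measurable_EFinP; exact: measurable_funX.
have q0 : (\int[mu]_(x in D) `|q x| = 0)%E.
  transitivity (l2prod F F)%:E; last by rewrite F0.
  rewrite /l2prod /Rintegral fineK; last first.
    by apply: integrable_fin_num => //; exact: l2prod_integrable.
  by apply: eq_integral => x _; rewrite gee0_abs ?lee_fin ?sqr_ge0// /q expr2.
apply: ae_sub ((ae_eq_integral_abs _ mD mq).1 q0) => x hx x0.
apply/eqP; rewrite -sqrf_eq0; apply/eqP/EFin_inj; apply: hx.
by rewrite halflineE.
Qed.

Lemma cprod_eq0_ae p p' : cprod (p - p') (p - p') = 0 ->
  {ae mu, forall x : R, 0 < x -> p.1 x = p'.1 x /\ p.2 x = p'.2 x}.
Proof.
move=> /eqP; rewrite /cprod paddr_eq0 ?l2prod_ge0// => /andP[/eqP/l2prod_eq0 h1 /eqP/l2prod_eq0 h2].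
apply: ae_sub (ae_and h1 h2) => x [k1 k2] x0; split; apply/eqP; rewrite -subr_eq0; apply/eqP.
  exact: k1.
exact: k2.
Qed.

Lemma SrV_null p q p' q' : SrV p q -> cprod (p - p') (p - p') = 0 ->
  cprod (q - q') (q - q') = 0 -> SrV p' q'.
Proof.
move=> [s1 s2] /cprod_eq0_ae pp' /cprod_eq0_ae qq'.
split; [apply: ae_solvable s1 _ _|apply: ae_solvable s2 _ _].
- by apply: ae_sub pp' => x h /h[].
- by apply: ae_sub qq' => x h /h[].
- by apply: ae_sub pp' => x h /h[].
- by apply: ae_sub qq' => x h /h[].
Qed.

Lemma relS_SrV f g : L2 H f -> L2 H g -> relS H f g <-> SrV (toV f) (toV g).
Proof.
move=> Lf Lg; have [f1 f2] := toVE Lf; have [g1 g2] := toVE Lg.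
by rewrite /SrV f1 f2 g1 g2; exact: relS_solvable.
Qed.

Notation sq u := (cprod u u).

Lemma sqnorm_sub f g : L2 H f -> L2 H g ->
  sqnorm H (fun x => f x - g x) = (sq (toV f - toV g))%:E.
Proof.
move=> Lf Lg; have [f1 f2] := toVE Lf; have [g1 g2] := toVE Lg.
apply: sqnorm_V => x; first by rewrite reFB -f1 -g1.
by rewrite imFB -f2 -g2.
Qed.

Lemma sqnorm_toV f : L2 H f -> sqnorm H f = (sq (toV f))%:E.
Proof.
by move=> Lf; have [f1 f2] := toVE Lf; apply: sqnorm_V => x; rewrite ?f1 ?f2.
Qed.

Lemma reFZ (a : R) f x : reF (fun x => a%:C%C *: f x) x = a * reF f x.
Proof.
rewrite /reF !mxE; case: (f x 0 0) (f x 1 0) => [? ?] [? ?] /=; ring.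
Qed.

Lemma imFZ (a : R) f x : imF (fun x => a%:C%C *: f x) x = a * imF f x.
Proof.
rewrite /imF !mxE; case: (f x 0 0) (f x 1 0) => [? ?] [? ?] /=; ring.
Qed.

Lemma sqnorm_resolvent (l : R) f g h : L2 H f -> L2 H g -> L2 H h ->
  sqnorm H (fun x => g x - l%:C%C *: f x - h x) = (sq (toV g - l *: toV f - toV h))%:E.
Proof.
move=> Lf Lg Lh; have [f1 f2] := toVE Lf; have [g1 g2] := toVE Lg.
have [h1 h2] := toVE Lh.
apply: sqnorm_V => x.
  by rewrite reFB (reFB g (fun x => l%:C%C *: f x)) reFZ -f1 -g1 -h1.
by rewrite imFB (imFB g (fun x => l%:C%C *: f x)) imFZ -f2 -g2 -h2.
Qed.

Lemma sqnorm_shift (l : R) f g : L2 H f -> L2 H g ->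
  sqnorm H (fun x => g x - l%:C%C *: f x) = (sq (toV g - l *: toV f))%:E.
Proof.
move=> Lf Lg; have [f1 f2] := toVE Lf; have [g1 g2] := toVE Lg.
apply: sqnorm_V => x.
  by rewrite (reFB g (fun x => l%:C%C *: f x)) reFZ -f1 -g1.
by rewrite (imFB g (fun x => l%:C%C *: f x)) imFZ -f2 -g2.
Qed.

Notation dom := (@domcl R _ (@cprod R) SrV).
Notation rel := (@relop R _ (@cprod R) SrV).
Notation reg := (@regular R _ (@cprod R) SrV).

Lemma sqrt_lt_sq (a e : R) : 0 <= a -> 0 < e -> (Num.sqrt a < e) = (a < e ^+ 2).
Proof.
move=> a0 e0; rewrite -(ltr_pXn2r (n := 2)) ?nnegrE ?sqrtr_ge0 ?ltW//.
by rewrite sqr_sqrtr.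
Qed.

Lemma closureD_dom f : L2 H f -> closureD H f <-> dom (toV f).
Proof.
move=> Lf; split.
  move=> [_ cf]; apply/domclP => e e0.
  have [|h [k [hk fh]]] := cf (Num.sqrt e); first by rewrite sqrtr_gt0.
  have [Lh Lk _] := hk; exists (toV h), (toV k); split; first exact/relS_SrV.
  move: fh; rewrite /L2norm sqnorm_sub//= sqrt_lt_sq ?cprod_ge0 ?sqrtr_gt0//.
  by rewrite sqr_sqrtr// ltW.
move=> /domclP df; split=> // e e0.
have [|p [q [pq fp]]] := df (e ^+ 2); first by rewrite exprn_gt0.
have Lp := L2_ofV p; have Lq := L2_ofV q.
exists (ofV p), (ofV q); split; first by apply/relS_SrV => //; rewrite !ofVK.
by rewrite /L2norm sqnorm_sub//= ofVK sqrt_lt_sq ?cprod_ge0.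
Qed.

Lemma opS_rel f g : L2 H f -> L2 H g -> opS H f g <-> rel (toV f) (toV g).
Proof.
move=> Lf Lg; split.
  move=> [r /(closureD_dom Lf) cf /(closureD_dom Lg) cg].
  by split=> //; exact/relS_SrV.
move=> [r cf cg]; split; [exact/relS_SrV|exact/closureD_dom|exact/closureD_dom].
Qed.

Lemma opS_L2 f g : opS H f g -> L2 H f /\ L2 H g.
Proof. by case=> [[]]. Qed.

Lemma opS_ofV p q : rel p q -> opS H (ofV p) (ofV q).
Proof. by move=> pq; apply/opS_rel; [exact: L2_ofV|exact: L2_ofV|rewrite !ofVK]. Qed.

Lemma sqrt_le_mul (a b k : R) : 0 <= a -> 0 <= b -> Num.sqrt a <= k * Num.sqrt b ->
  a <= k ^+ 2 * b.
Proof.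
move=> a0 b0 h; rewrite -(sqr_sqrtr a0) -(sqr_sqrtr b0) -exprMn.
by rewrite ler_pXn2r ?nnegrE ?sqrtr_ge0// (le_trans _ h)// sqrtr_ge0.
Qed.

(** Norms on one side and their squares on the other account for the constants [k ^+ 2] and
    [Num.sqrt]. *)
Lemma resolvent_regular (l : R) : resolvent_set H l%:C%C <-> reg l.
Proof.
split.
  move=> [surj [k hk]]; split.
    move=> h dh; have [|f [g [fg e]]] := surj (ofV h).
      by apply/closureD_dom; [exact: L2_ofV|rewrite ofVK].
    have [Lf Lg] := opS_L2 fg.
    exists (toV f), (toV g); split; first exact: (opS_rel Lf Lg).1.
    move: e; rewrite /L2eq sqnorm_resolvent//; last exact: L2_ofV.
    by rewrite ofVK => -[].
  exists (k ^+ 2) => p q /opS_ofV pq; have := hk _ _ pq.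
  rewrite /L2norm sqnorm_toV ?sqnorm_shift; try exact: L2_ofV.
  by rewrite !ofVK /=; apply: sqrt_le_mul; exact: cprod_ge0.
move=> [surj [k hk]]; split.
  move=> h dh; have Lh : L2 H h by case: dh.
  have [|p [q [pq e]]] := surj (toV h); first exact: (closureD_dom Lh).1.
  exists (ofV p), (ofV q); split; first exact: opS_ofV.
  by rewrite /L2eq sqnorm_resolvent ?ofVK ?e//; exact: L2_ofV.
exists (Num.sqrt `|k|) => f g fg; have [Lf Lg] := opS_L2 fg.
have := hk _ _ ((opS_rel Lf Lg).1 fg).
rewrite /L2norm sqnorm_toV// sqnorm_shift//= -sqrtrM//.
move=> h; apply: ler_wsqrtr; apply: le_trans h _.
by apply: ler_wpM2r; [exact: cprod_ge0|exact: ler_norm].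
Qed.

(** Multiplication by [i]. A complex span is the real span of the vectors and their images under
    it. *)
Definition rotV (p : l2fun R * l2fun R) : l2fun R * l2fun R := (- p.2, p.1).

Lemma cprod_rotV p q : cprod (rotV p) (rotV q) = cprod p q.
Proof.
have N (F G : l2fun R) : l2prod (- F) G = - l2prod F G.
  have -> : - F = (-1) *: F by rewrite scaleN1r.
  by rewrite l2prodZl mulN1r.
have NN (F G : l2fun R) : l2prod (- F) (- G) = l2prod F G.
  by rewrite N l2prodC N opprK l2prodC.
by rewrite /cprod /= [LHS]addrC; congr (_ + _); exact: NN.
Qed.

Lemma rotVB p q : rotV (p - q) = rotV p - rotV q.
Proof. by rewrite /rotV; congr pair; rewrite /= opprD. Qed.

Lemma rotVZ a p : rotV (a *: p) = a *: rotV p.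
Proof. by rewrite /rotV; congr pair; rewrite /= scalerN. Qed.

Lemma SrV_rotV p q : SrV p q -> SrV (rotV p) (rotV q).
Proof.
move=> [s1 s2]; split=> //=.
apply: ae_solvable (solvable_lin (-1) s2 solvable0) _ _; apply: aeW => x _;
  by rewrite addr0 mulN1r.
Qed.

Lemma rel_rotV p q : rel p q -> rel (rotV p) (rotV q).
Proof.
have rd u : dom u -> dom (rotV u).
  move=> /domclP du; apply/domclP => e /du[h [k [hk uh]]].
  exists (rotV h), (rotV k); split; first exact: SrV_rotV.
  by rewrite -rotVB cprod_rotV.
by move=> [s1 d1 d2]; split; [exact: SrV_rotV|exact: rd|exact: rd].
Qed.

Lemma l2scaleE (a : R) (F : l2fun R) x : (a *: F) x = a * F x.
Proof. by []. Qed.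

Lemma ofVZ (a : R) p : ofV (a *: p) = (fun x => a%:C%C *: ofV p x).
Proof.
apply/funext => x; apply/matrixP => i j; rewrite (ord1 j) !mxE.
have -> : (a *: p).1 = a *: p.1 by [].
have -> : (a *: p).2 = a *: p.2 by [].
rewrite !l2scaleE.
by apply/eqP; rewrite eq_complex /=; apply/andP; split; apply/eqP; ring.
Qed.

Lemma toVZ (a : R) f : L2 H f -> L2 H (fun x => a%:C%C *: f x) ->
  toV (fun x => a%:C%C *: f x) = a *: toV f.
Proof.
move=> Lf La; have [f1 f2] := toVE Lf; have [a1 a2] := toVE La.
rewrite [LHS]surjective_pairing [RHS]surjective_pairing; congr pair; apply: val_inj.
  rewrite [LHS]a1; apply/funext => x; rewrite reFZ.
  have -> : (a *: toV f).1 = a *: (toV f).1 by [].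
  by rewrite -f1; exact/esym/l2scaleE.
rewrite [LHS]a2; apply/funext => x; rewrite imFZ.
have -> : (a *: toV f).2 = a *: (toV f).2 by [].
by rewrite -f2; exact/esym/l2scaleE.
Qed.

Lemma sqnorm_combination n (b : 'I_n -> R -> 'cV[C]_2) (c : 'I_n -> C) f :
  (forall i, L2 H (b i)) -> L2 H f ->
  sqnorm H (fun x => f x - \sum_i c i *: b i x) =
  (sq (toV f - \sum_i (complex.Re (c i) *: toV (b i) +
                       complex.Im (c i) *: rotV (toV (b i)))))%:E.
Proof.
move=> Lb Lf; have [f1 f2] := toVE Lf.
pose p := \sum_i (complex.Re (c i) *: toV (b i) + complex.Im (c i) *: rotV (toV (b i))).
have sumE x : reF (fun x => \sum_i c i *: b i x) x = p.1 x /\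
              imF (fun x => \sum_i c i *: b i x) x = p.2 x.
  have e (k : 'I_2) : (\sum_i c i *: b i x) k 0 = \sum_i c i * b i x k 0.
    by rewrite summxE; apply: eq_bigr => i _; rewrite mxE.
  have reS (u : 'I_n -> C) : complex.Re (\sum_i u i) = \sum_i complex.Re (u i).
    by apply: (big_morph (@complex.Re R)) => // [[? ?] [? ?]].
  have imS (u : 'I_n -> C) : complex.Im (\sum_i u i) = \sum_i complex.Im (u i).
    by apply: (big_morph (@complex.Im R)) => // [[? ?] [? ?]].
  have p1E : p.1 x = \sum_i (complex.Re (c i) * reF (b i) x - complex.Im (c i) * imF (b i) x).
    rewrite (big_morph (fun q : l2fun R * l2fun R => q.1 x) (id1 := 0) (op1 := +%R))//.
    apply: eq_bigr => i _; have [b1 b2] := toVE (Lb i).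
    by rewrite -b1 -b2 -mulrN.
  have p2E : p.2 x = \sum_i (complex.Re (c i) * imF (b i) x + complex.Im (c i) * reF (b i) x).
    rewrite (big_morph (fun q : l2fun R * l2fun R => q.2 x) (id1 := 0) (op1 := +%R))//.
    apply: eq_bigr => i _; have [b1 b2] := toVE (Lb i).
    by rewrite -b1 -b2.
  rewrite p1E p2E /reF /imF !e !reS !imS !mulr_sumr -!big_split/=.
  split; apply: eq_bigr => i _.
    by case: (c i) (b i x 0 0) (b i x 1 0) => [? ?] [? ?] [? ?] /=; ring.
  by case: (c i) (b i x 0 0) (b i x 1 0) => [? ?] [? ?] [? ?] /=; ring.
apply: sqnorm_V => x; first by rewrite reFB (sumE x).1 -f1.
by rewrite imFB (sumE x).2 -f2.
Qed.

Notation disc := (@discrete_or_regular R _ (@cprod R) SrV).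

(** The finite list consists of generators [b] of the eigenspace and of the [i b]. An eigenvector
    orthogonal to all of them is a real combination of them up to a null vector, hence orthogonal to
    itself. *)
Lemma discrete_spectrum_disc (l : R) : discrete_spectrum H l%:C%C -> disc l.
Proof.
move=> [_ [e e0 iso] _ [n [b [eb fb]]]].
have Lb i : L2 H (b i) by have [] := opS_L2 (eb i).
have rb i : rel (toV (b i)) (l *: toV (b i)).
  have [L1 L2b] := opS_L2 (eb i); rewrite -toVZ//.
  exact: (opS_rel L1 L2b).1 (eb i).
exists e => //; split.
  move=> w /andP[w0 wl]; apply/resolvent_regular; apply: contrapT => sw.
  have := iso w%:C%C sw.
  rewrite -rmorphB /= normc_def /= expr0n addr0 sqrtr_sqr ltcR => /(_ wl) wlE.
  by move: w0; rewrite (complexI wlE) subrr normr0 ltxx.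
exists ([seq toV (b i) | i : 'I_n] ++ [seq rotV (toV (b i)) | i : 'I_n]).
  move=> p; rewrite mem_cat => /orP[] /mapP[i _ ->]; first exact: rb.
  by rewrite -rotVZ; exact: rel_rotV.
move=> p pp; rewrite orth_cat => /andP[/allP o1 /allP o2].
have [|c hc] := fb (ofV p).
  by rewrite /eigenfun -ofVZ; exact: opS_ofV.
move: hc; rewrite /L2eq sqnorm_combination//; last exact: L2_ofV.
rewrite ofVK => -[hc].
rewrite (sqB_null _ _ _ (@cprodC R) (@cprodDl R) (@cprodZl R) (@cprod_ge0 R) _ _ p hc).
rewrite (big_morph (fun q => cprod q p) (id1 := 0) (op1 := +%R)).
- apply: big1 => i _; rewrite cprodDl !cprodZl cprodC (cprodC (rotV _)).
  have -> : cprod p (toV (b i)) = 0.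
    by apply/eqP/o1/mapP; exists i => //; rewrite mem_enum.
  have -> : cprod p (rotV (toV (b i))) = 0.
    by apply/eqP/o2/mapP; exists i => //; rewrite mem_enum.
  by rewrite !mulr0 addr0.
- by move=> u v; exact: cprodDl.
- by have := cprodZl 0 0 p; rewrite scale0r mul0r.
Qed.

Let rd := regular_discrete _ _ _ (@cprodC R) (@cprodDl R) (@cprodZl R) (@cprod_ge0 R)
  _ SrV0 SrV_lin SrV_sym SrV_null (@cprod_complete R).

Lemma not_ess_disc (l : R) : ~ ess_spectrum H l%:C%C -> disc l.
Proof.
move=> ness; have [res|nres] := pselect (resolvent_set H l%:C%C).
  exact/rd/resolvent_regular.
by apply: discrete_spectrum_disc; apply: contrapT => nd; apply: ness; split.
Qed.

End bridge_ae.

End bridge.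

(** * Trial functions *)

Section supported.
Variable R : realType.
Notation mu := (@lebesgue_measure R).
Notation D := (@halfline R).
Implicit Types (X Y : R) (g h : R -> R).

(** The interval is half open, so that the supports of functions on adjacent intervals are
    disjoint. *)
Definition supported X Y g := [/\ measurable_fun D g,
  exists M, forall x, `|g x| <= M & forall x, ~~ (X < x <= Y) -> g x = 0].

Lemma supported_integrable X Y g : 0 <= X -> supported X Y g ->
  mu.-integrable setT (EFin \o g).
Proof.
move=> X0 [mg [M hM] g0].
have mD := @measurable_halfline R.
have sub : `]X, Y] `<=` D.
  move=> x /=; rewrite /halfline/= !in_itv/= andbT => /andP[Xx _].
  exact: le_lt_trans Xx.
have gE : EFin \o g = (EFin \o g) \_ `]X, Y].
  apply/funext => x; rewrite patchE; case: ifPn => // h; rewrite /= g0//.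
  by move: h; rewrite notin_setE/= in_itv/= => /negP.
rewrite gE; apply/(integrable_mkcond _ _).1; first exact: measurable_itv.
apply: (le_integrable _ _ _ (integrable_cst_itv X Y M)) => //.
  by apply/measurable_EFinP; apply: measurable_funS mg.
move=> x _ /=; rewrite lee_fin; apply: le_trans (hM x) (ler_norm _).
Qed.

Lemma supported_mul X Y g h X0 M : X0 <= X -> measurable_fun D h ->
  (forall x, X0 <= x -> `|h x| <= M) -> supported X Y g ->
  supported X Y (fun x => h x * g x).
Proof.
move=> X0X mh hM [mg [N hN] g0]; split.
- exact: measurable_funM.
- exists (`|M| * `|N|) => x; rewrite normrM.
  have [xX|] := boolP (X < x <= Y); last by move=> /g0 ->; rewrite normr0 mulr0 mulr_ge0.
  apply: ler_pM => //; last exact: le_trans (hN x) (ler_norm _).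
  apply: le_trans (hM x _) (ler_norm _).
  by case/andP: xX => /ltW Xx _; exact: le_trans Xx.
- by move=> x /g0 ->; rewrite mulr0.
Qed.

Lemma supported_lin X Y g h a : supported X Y g -> supported X Y h ->
  supported X Y (fun x => g x + a * h x).
Proof.
move=> [mg [M hM] g0] [mh [N hN] h0]; split.
- by apply: measurable_funD => //; exact: measurable_funM.
- exists (M + `|a| * N) => x; apply: le_trans (ler_normD _ _) _.
  by rewrite lerD// normrM ler_wpM2l.
- by move=> x nx; rewrite g0// h0// mulr0 addr0.
Qed.

Lemma supportedZ X Y g c : supported X Y g -> supported X Y (fun x => c * g x).
Proof. exact: (supported_mul (lexx X) (measurable_cst c) (fun _ _ => lexx `|c|)). Qed.

Lemma supported_integrable_half X Y g : 0 <= X -> supported X Y g ->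
  mu.-integrable D (EFin \o g).
Proof.
move=> X0 /(supported_integrable X0); apply: integrableS => //.
exact: measurable_halfline.
Qed.

Lemma supported_widen X Y X' Y' g : X' <= X -> Y <= Y' -> supported X Y g ->
  supported X' Y' g.
Proof.
move=> XX YY [mg bg g0]; split=> // x nx; apply: g0; apply: contra nx => /andP[h1 h2].
by rewrite (le_lt_trans XX)//= (le_trans h2).
Qed.

Lemma prim_before X Y g x : supported X Y g -> x <= X -> prim g x = 0.
Proof.
move=> [_ _ g0] xX; transitivity (\int[mu]_(t in `]-oo, x]) (0 : R)); last first.
  by rewrite /Rintegral integral0.
apply: eq_Rintegral => y; rewrite inE/= in_itv/= => yx; rewrite g0// negb_and -leNgt.
by rewrite (le_trans yx).
Qed.

Lemma prim_after X Y g x : 0 <= X -> supported X Y g -> Y <= x -> prim g x = prim g Y.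
Proof.
move=> X0 sg Yx; have := prim_sub (supported_integrable X0 sg) Yx.
have -> : \int[mu]_(t in `]Y, x]) g t = \int[mu]_(t in `]Y, x]) (0 : R).
  apply: eq_Rintegral => y; rewrite inE/= in_itv/= => /andP[Yy _].
  by case: sg => _ _ -> //; rewrite negb_and -!leNgt orbC -ltNge Yy.
by rewrite /Rintegral integral0 /= => /eqP; rewrite subr_eq0 => /eqP.
Qed.

Lemma supportedM X Y g h : supported X Y g -> supported X Y h ->
  supported X Y (fun x => g x * h x).
Proof.
move=> [mg [M hM] g0] sh.
by apply: (supported_mul (lexx X) mg _ sh) => x _; exact: hM.
Qed.

Lemma supported_prim X Y g : 0 <= X -> supported X Y g -> prim g Y = 0 ->
  supported X Y (prim g).
Proof.
move=> X0 sg gY; have ig := supported_integrable X0 sg.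
have ac b : abs_continuous 0 b (prim g) by exact: ac_prim.
have w0 x : ~~ (X < x <= Y) -> prim g x = 0.
  rewrite negb_and -!leNgt => /orP[xX|]; first exact: prim_before sg _.
  by rewrite -ltNge => /ltW Yx; rewrite (prim_after X0 sg Yx).
have [M hM] := ac_bounded (ac Y); split => //; first exact: ac_measurable.
exists `|M| => x; have [/andP[Xx xY]|/w0 ->] := boolP (X < x <= Y); last by rewrite normr0.
by apply: le_trans (hM x _) (ler_norm _); rewrite xY andbT ltW// (le_lt_trans X0).
Qed.

Lemma sqint_supported X Y g : 0 <= X -> supported X Y g -> sqint mu D g.
Proof.
move=> X0 sg; have [mg [M hM] g0] := sg; split => //.
have mD := @measurable_halfline R.
have sg2 : supported X Y (fun x => g x * g x).
  by apply: (@supported_mul _ _ _ _ X M) sg.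
have := supported_integrable X0 sg2 => /(integrableS measurableT mD (@subsetT _ _)).
by apply: eq_integrable => // x _ /=; rewrite expr2.
Qed.

Lemma Rintegral_supported X Y g : 0 <= X -> supported X Y g ->
  \int[mu]_(x in D) g x = \int[mu]_(x in `]X, Y]) g x.
Proof.
move=> X0 [_ _ g0]; rewrite Rintegral_mkcond [RHS]Rintegral_mkcond.
apply: eq_Rintegral => x _; rewrite !patchE; case: ifPn => h1; case: ifPn => h2 //.
  by rewrite g0//; move: h2; rewrite notin_setE/= in_itv/= => /negP.
move: h1; rewrite notin_setE halflineE => nx; move: h2; rewrite inE/= in_itv/=.
by move=> /andP[Xx _]; exfalso; apply: nx; exact: le_lt_trans Xx.
Qed.

End supported.

Section trial.
Variables (R : realType) (phi : R -> R) (phioo c0 X0 : R).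
Notation mu := (@lebesgue_measure R).
Notation D := (@halfline R).
Hypothesis phi_decr : forall x y : R, 0 < x -> x <= y -> phi y <= phi x.
Hypothesis X0_gt0 : 0 < X0.
Hypothesis c0_gt0 : 0 < c0.
Let psi x := phi x - phioo.
Hypothesis cos_psi : forall x, X0 <= x -> c0 <= cos (psi x).
Implicit Types (X Y : R) (g h : R -> R).

(* The cosine is truncated at [c0] in order that its inverse be bounded and
   measurable on the whole half line. *)
Definition icos x := (Num.max (cos (psi x)) c0)^-1.
Definition ta x := sin (psi x) * icos x.

Let mD : @measurable _ (measurableTypeR R) D := @measurable_halfline R.

Let mpsi : measurable_fun D psi.
Proof. by apply: measurable_funB => //; exact: measurable_phi. Qed.

Let mcos : measurable_fun D (fun x => cos (psi x)).
Proof.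
apply: (measurableT_comp _ mpsi).
by apply: continuous_measurable_fun; exact: continuous_cos.
Qed.

Let msin : measurable_fun D (fun x => sin (psi x)).
Proof.
apply: (measurableT_comp _ mpsi).
by apply: continuous_measurable_fun; exact: continuous_sin.
Qed.

Lemma icos_gt0 x : 0 < icos x.
Proof. by rewrite invr_gt0 lt_max c0_gt0 orbT. Qed.

Lemma icos_le x : `|icos x| <= c0^-1.
Proof.
rewrite ger0_norm; last exact/ltW/icos_gt0.
by rewrite lef_pV2 ?posrE ?lt_max ?c0_gt0 ?orbT// le_max lexx orbT.
Qed.

Lemma icosE x : X0 <= x -> cos (psi x) * icos x = 1.
Proof.
move=> /cos_psi h; rewrite /icos (max_idPl h) divff// gt_eqF//.
exact: lt_le_trans h.
Qed.

Let micos : measurable_fun D icos.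
Proof.
have m : measurable_fun setT (fun y : R => (Num.max y c0)^-1).
  apply: nonincreasing_measurable => // x y xy.
  rewrite lef_pV2 ?posrE ?lt_max ?c0_gt0 ?orbT//.
  by rewrite ge_max !le_max xy lexx orbT.
exact: (measurableT_comp m mcos).
Qed.

Lemma measurable_ta : measurable_fun D ta.
Proof. exact: measurable_funM. Qed.

Lemma ta_le x : `|ta x| <= c0^-1.
Proof.
rewrite /ta normrM -[leRHS]mul1r; apply: ler_pM => //; first exact: sin_max.
exact: icos_le.
Qed.

Lemma supported_ta X Y g : X0 <= X -> supported X Y g ->
  supported X Y (fun x => ta x * g x).
Proof. by move=> XX; apply: (supported_mul XX measurable_ta) => x _; exact: ta_le. Qed.

(* In the frame rotated by [phioo] the solution with right hand side
   [G = g / cos psi] has the components [- prim (tan psi * g)] and [prim g]. *)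
Lemma trial_pair X Y g : X0 <= X -> X <= Y -> supported X Y g ->
  prim g Y = 0 -> prim (fun x => ta x * g x) Y = 0 ->
  exists F G : l2fun R, [/\ solvable phi F G,
    forall x, ~~ (X < x <= Y) -> F x = 0,
    forall x, G x = icos x * g x &
    l2prod F G = 2 * \int[mu]_(x in D) (ta x * prim g x * g x)].
Proof.
move=> X0X XY sg gY tY; have X_ge0 : 0 <= X by apply: le_trans X0X; exact: ltW.
have st := supported_ta X0X sg.
have ig := supported_integrable X_ge0 sg; have it := supported_integrable X_ge0 st.
pose w := prim g; pose t := prim (fun x => ta x * g x).
have acw b : abs_continuous 0 b w by exact: ac_prim.
have act b : abs_continuous 0 b t by exact: ac_prim.
have sw : supported X Y w by exact: supported_prim.
have st' : supported X Y t by exact: supported_prim st tY.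
have [_ _ w0] := sw; have [_ _ t0] := st'.
have cos1 x : X0 <= x -> `|cos (psi x)| <= 1 by move=> _; exact: cos_max.
have sin1 x : X0 <= x -> `|sin (psi x)| <= 1 by move=> _; exact: sin_max.
pose F x := sin (psi x) * w x + (-1) * (cos (psi x) * t x).
pose G x := icos x * g x.
have sF : supported X Y F.
  by apply: supported_lin; [exact: (supported_mul X0X msin sin1)|exact: (supported_mul X0X mcos cos1)].
have sG : supported X Y G by by apply: (supported_mul X0X micos) sg => x _; exact: icos_le.
have lF : F \in @l2half R by apply/asboolP; exact: sqint_supported sF.
have lG : G \in @l2half R by apply/asboolP; exact: sqint_supported sG.
exists (L2fun lF), (L2fun lG); split.
(* Rotating the frame by [phioo] turns the components [(- t, w)] into those of the solution. *)
- pose co := cos phioo; pose so := sin phioo.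
  have cs : co ^+ 2 + so ^+ 2 = 1 by exact: cos2Dsin2.
  exists (fun x => (- co) * t x + (- so) * w x), (fun x => (- so) * t x + co * w x).
  have psiE x : phi x = psi x + phioo by rewrite /psi subrK.
  split.
    split.
    - by move=> b; apply: ac_linear.
    - by move=> b; apply: ac_linear.
    - by rewrite w0 ?t0 ?mulr0 ?addr0// negb_and -leNgt X_ge0.
    apply: ae_sub (ae_and (prim_derive ig) (prim_derive it)) => x [dw dt] x0.
    (* The truncated inverse is [1 / cos psi] only from [X0] on; to the left of it [g] vanishes. *)
    have gE (k : R) : (X0 <= x -> k = 0) -> k * g x = 0.
      move=> hk; have [/andP[/ltW Xx _]|nx] := boolP (X < x <= Y).
        by rewrite hk ?mul0r//; exact: le_trans Xx.
      by case: sg => _ _ ->//; rewrite mulr0.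
    split.
      apply: is_derive_eq (is_deriveD (is_deriveZ (- co) dt) (is_deriveZ (- so) dw)) _.
      apply/eqP; rewrite -subr_eq0 /GRing.scale /= psiE sinD -/co -/so /G; apply/eqP.
      rewrite -[RHS](gE (so * (cos (psi x) * icos x - 1))) /ta; first by ring.
      by move=> xX; rewrite icosE// subrr mulr0.
    apply: is_derive_eq (is_deriveD (is_deriveZ (- so) dt) (is_deriveZ co dw)) _.
    apply/eqP; rewrite -subr_eq0 /GRing.scale /= psiE cosD -/co -/so /G; apply/eqP.
    rewrite -[RHS](gE (- co * (cos (psi x) * icos x - 1))) /ta; first by ring.
    by move=> xX; rewrite icosE// subrr mulr0.
  apply: aeW => x _; rewrite /F psiE cosD sinD -/co -/so /=.
  rewrite -[LHS]mul1r -{1}cs; ring.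
- by case: sF.
- by [].
have tw : supported X Y (fun x => ta x * w x * g x).
  by apply: supportedM sg; exact: supported_ta.
have tg : supported X Y (fun x => t x * g x) by exact: supportedM.
have widen h : supported X Y h -> supported 0 Y h by exact: supported_widen.
have X_le : (0 : R) <= 0 by [].
have i1 : mu.-integrable D (EFin \o (fun x => ta x * w x * g x)).
  exact: supported_integrable_half tw.
have i2 : mu.-integrable D (EFin \o (fun x => t x * g x)).
  exact: supported_integrable_half tg.
(* Integration by parts: [t w] vanishes at both ends and has derivative [tan(psi) g w + t g]. Since
   [F G = tan(psi) w g - t g], this doubles the first term. *)
have parts : \int[mu]_(x in D) (ta x * w x * g x) + \int[mu]_(x in D) (t x * g x) = 0.
  rewrite -RintegralD//.
  transitivity (\int[mu]_(x in `]0, Y]) (ta x * w x * g x + t x * g x)).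
    apply: Rintegral_supported => //.
    have := supported_lin 1 (widen _ tw) (widen _ tg).
    by under eq_fun do rewrite mul1r.
  have Y0 : 0 <= Y by exact: le_trans XY.
  rewrite -(@ac_ftc _ 0 Y (fun x => t x * w x) _ Y0).
  - by rewrite /t tY [w 0]w0 ?mulr0 ?mul0r ?subrr// negb_and -leNgt X_ge0.
  - exact: acM.
  - apply: (integrableS mD _ _ (integrableD mD i1 i2)) => //.
    by move=> x /=; rewrite /halfline/= !in_itv/= andbT => /andP[].
  apply: ae_sub (ae_and (prim_derive ig) (prim_derive it)) => x [dw dt] _.
  by apply: is_derive_eq (is_deriveM dt dw) _; rewrite /GRing.scale /= /t /w; ring.
transitivity (\int[mu]_(x in D) (ta x * w x * g x - t x * g x)).
  apply: eq_Rintegral => x _ /=; rewrite /F /G.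
  have [/andP[/ltW Xx _]|nx] := boolP (X < x <= Y).
    have := icosE (le_trans X0X Xx); rewrite /ta => e.
    transitivity (sin (psi x) * icos x * w x * g x - (cos (psi x) * icos x) * t x * g x).
      by ring.
    by rewrite e mul1r.
  by case: sg => _ _ ->//; rewrite !mulr0 subrr.
rewrite RintegralB//; lra.
Qed.

End trial.

(** * A single bump with large form *)

Section bump.
Variable R : realType.
Notation mu := (@lebesgue_measure R).
Notation D := (@halfline R).
Implicit Types (a b X Y : R) (f g F : R -> R).

Lemma Rintegral_ftc a b f F : a <= b ->
  (forall x, a <= x <= b -> {for x, continuous f}) ->
  (forall x, a <= x <= b -> is_derive x 1 F (f x)) ->
  \int[mu]_(x in `]a, b]) f x = F b - F a.
Proof.
rewrite le_eqVlt => /orP[/eqP->|ab] cf dF.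
  by rewrite set_itv_ge ?bnd_simp ?ltxx// Rintegral_set0 subrr.
have lab : a <= a <= b by rewrite lexx ltW.
have rab : a <= b <= b by rewrite lexx ltW.
have cF x : a <= x <= b -> {for x, continuous F}.
  by move=> /dF [dFx _]; apply/differentiable_continuous/derivable1_diffP.
have wcf : {within `[a, b], continuous f}.
  by apply: continuous_in_subspaceT => x; rewrite inE/= in_itv/= => /cf.
rewrite Rintegral_itv_obnd_cbnd; last first.
  apply: integrableS (continuous_compact_integrable (@segment_compact _ a b) wcf) => //.
  by apply: subset_itvr; rewrite bnd_simp.
rewrite /Rintegral (@continuous_FTC2 _ f F)//=.
- split.
  + by move=> x; rewrite in_itv/= => /andP[/ltW ax /ltW xb]; case: (dF x); rewrite ?ax.
  + exact/cvg_at_right_filter/cF.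
  + exact/cvg_at_left_filter/cF.
- move=> x; rewrite in_itv/= => /andP[/ltW ax /ltW xb].
  by rewrite derive1E; case: (dF x) => //; rewrite ax.
Qed.

Lemma Rintegral_itv1 a b : a <= b -> \int[mu]_(x in `]a, b]) (1 : R) = b - a.
Proof.
move=> ab; apply: (Rintegral_ftc (F := fun x => x) ab) => y _; exact: cst_continuous.
Qed.

Definition cut X Y f x := if X < x <= Y then f x else 0.

Section cut.
Variables (X Y : R) (f : R -> R).
Hypotheses (X_gt0 : 0 < X) (cf : forall x, 0 < x -> {for x, continuous f}).

Let mf : measurable_fun D f.
Proof.
apply: open_continuous_measurable_fun; first exact: interval_open.
by move=> x; rewrite inE halflineE => /cf.
Qed.

Lemma supported_cut : supported X Y (cut X Y f).
Proof.
split.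
- have -> : cut X Y f = f \_ `]X, Y].
    apply/funext => x; rewrite /cut patchE; case: ifPn => h; case: ifPn => //.
      by rewrite notin_setE/= in_itv/=.
    by rewrite inE/= in_itv/= => h'; rewrite h' in h.
  apply: (measurable_restrict f _ _).1 => //; first exact: measurable_halfline.
  by apply: measurable_funS mf; first exact: measurable_halfline.
- have [XY|YX] := leP X Y; last first.
    exists 0 => x; rewrite /cut; case: ifPn => [/andP[Xx xY]|_]; last by rewrite normr0.
    by have := lt_trans (lt_le_trans Xx xY) YX; rewrite ltxx.
  have [|c _ hc] := @EVT_max R (fun x => `|f x|) X Y XY.
    apply: continuous_in_subspaceT => x; rewrite inE/= in_itv/= => /andP[Xx _].
    apply: cvg_norm; apply: cf; exact: lt_le_trans Xx.
  exists `|f c| => x; rewrite /cut; case: ifPn => [/andP[Xx xY]|_]; last by rewrite normr0.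
  by apply: hc; rewrite in_itv/= xY ltW.
- by move=> x nx; rewrite /cut ifN.
Qed.

Lemma Rintegral_cut : \int[mu]_(x in D) cut X Y f x = \int[mu]_(x in `]X, Y]) f x.
Proof.
rewrite (Rintegral_supported (ltW X_gt0) supported_cut).
by apply: eq_Rintegral => x; rewrite inE/= in_itv/= /cut => ->.
Qed.

Lemma prim_cut x : X <= x <= Y ->
  prim (cut X Y f) x = \int[mu]_(t in `]X, x]) f t.
Proof.
move=> /andP[Xx xY].
rewrite -[LHS]subr0 -(prim_before supported_cut (lexx X)) prim_sub//; last first.
  exact: supported_integrable (ltW X_gt0) supported_cut.
apply: eq_Rintegral => y; rewrite inE/= in_itv/= => /andP[Xy yx].
by rewrite /cut Xy (le_trans yx).
Qed.

End cut.

Lemma primD_supported X Y X' Y' g h c x : 0 <= X -> 0 <= X' -> supported X Y g ->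
  supported X' Y' h -> prim (fun x => g x + c * h x) x = prim g x + c * prim h x.
Proof.
move=> X0 X'0 /(supported_integrable X0) ig /(supported_integrable X'0) ih.
have ig' : mu.-integrable `]-oo, x] (EFin \o g) by exact: integrableS ig.
have ih' : mu.-integrable `]-oo, x] (EFin \o h) by exact: integrableS ih.
rewrite /prim RintegralD//; first by rewrite RintegralZl.
exact: (integrableZl _ c ih').
Qed.

Lemma continuous_sqrtV (x : R) : 0 < x ->
  {for x, continuous (fun t : R => (2 * Num.sqrt t)^-1)}.
Proof.
move=> x0; apply: continuousV; first by rewrite mulf_neq0// gt_eqF ?sqrtr_gt0.
apply: continuousM; first exact: cst_continuous.
exact: sqrt_continuous.
Qed.

Lemma Rintegral_sqrtV a b : 0 < a -> a <= b ->
  \int[mu]_(x in `]a, b]) (2 * Num.sqrt x)^-1 = Num.sqrt b - Num.sqrt a.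
Proof.
move=> a0 ab; apply: Rintegral_ftc => // x /andP[ax _]; have x0 := lt_le_trans a0 ax.
  exact: continuous_sqrtV.
exact: is_derive1_sqrt.
Qed.

Lemma Rintegral_inv a b : 0 < a -> a <= b ->
  \int[mu]_(x in `]a, b]) x^-1 = ln b - ln a.
Proof.
move=> a0 ab; apply: Rintegral_ftc => // x /andP[ax _]; have x0 := lt_le_trans a0 ax.
  by apply: inv_continuous; rewrite gt_eqF.
exact: is_derive1_ln.
Qed.

Lemma continuous_sqrt3V (x : R) : 0 < x ->
  {for x, continuous (fun t : R => t^-1 * (Num.sqrt t)^-1)}.
Proof.
move=> x0; apply: continuousM; first by apply: inv_continuous; rewrite gt_eqF.
by apply: continuousV; [rewrite gt_eqF ?sqrtr_gt0|exact: sqrt_continuous].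
Qed.

Lemma continuous_invD_sqrt3V c (x : R) : 0 < x ->
  {for x, continuous (fun t : R => t^-1 + c * (t^-1 * (Num.sqrt t)^-1))}.
Proof.
move=> x0; apply: continuousD; first by apply: inv_continuous; rewrite gt_eqF.
apply: continuousM; [exact: cst_continuous|exact: continuous_sqrt3V].
Qed.

(** With [c = - sqrt X] and the factor [b0 / 2] the integrand is [b0 w w' / x] for
    [w = sqrt x - sqrt X]. *)
Lemma Rintegral_sqrt3V a b c : 0 < a -> a <= b ->
  \int[mu]_(x in `]a, b]) (x^-1 + c * (x^-1 * (Num.sqrt x)^-1)) =
  ln b - ln a - 2 * c * ((Num.sqrt b)^-1 - (Num.sqrt a)^-1).
Proof.
move=> a0 ab.
transitivity (ln b + (- 2 * c) * (Num.sqrt b)^-1 - (ln a + (- 2 * c) * (Num.sqrt a)^-1)).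
  apply: (Rintegral_ftc (F := fun x => ln x + (- 2 * c) * (Num.sqrt x)^-1) ab).
    move=> x /andP[ax _]; have x0 := lt_le_trans a0 ax.
    exact: continuous_invD_sqrt3V.
  move=> x /andP[ax _]; have x0 := lt_le_trans a0 ax.
  have s0 : Num.sqrt x != 0 by rewrite gt_eqF ?sqrtr_gt0.
  apply: is_derive_eq (is_deriveD (is_derive1_ln x0)
    (is_deriveZ (- 2 * c) (is_deriveV s0 (is_derive1_sqrt x0)))) _.
  have e := sqr_sqrtr (ltW x0).
  by rewrite /GRing.scale /= -[in RHS]e -[in LHS]e sqrtr_sqr ger0_norm ?sqrtr_ge0//; field.
by ring.
Qed.

Lemma Rintegral_supported_lin X Y X' Y' g h c d : 0 <= X -> 0 <= X' ->
  supported X Y g -> supported X' Y' h ->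
  \int[mu]_(x in D) (c * g x + d * h x) =
  c * \int[mu]_(x in D) g x + d * \int[mu]_(x in D) h x.
Proof.
move=> X0 X'0 /(supported_integrable X0) ig /(supported_integrable X'0) ih.
have mD := @measurable_halfline R.
have ig' : mu.-integrable D (EFin \o g) by exact: integrableS ig.
have ih' : mu.-integrable D (EFin \o h) by exact: integrableS ih.
rewrite RintegralD//; first by rewrite !RintegralZl.
  exact: (integrableZl _ c ig').
exact: (integrableZl _ d ih').
Qed.

(* [g] makes its primitive [sqrt x - sqrt X] on [[X, b]]; this primitive is then
   brought back to [0] far out, at a cost that stays bounded as [b] grows. *)
Lemma bump (T : R -> R) (N b0 k X : R) : measurable_fun D T ->
  (forall x, `|T x| <= N) -> 0 < b0 -> 0 <= k -> k < 4 * b0 ->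
  (forall x, X <= x -> b0 <= x * T x) ->
  (forall e, 0 < e -> exists Z, forall x, Z <= x -> T x <= e) -> 0 < X ->
  exists Y g, [/\ X <= Y, supported X Y g, prim g Y = 0,
    0 < \int[mu]_(x in D) (g x * g x) &
    k * \int[mu]_(x in D) (g x * g x) <=
    2 * \int[mu]_(x in D) (T x * prim g x * g x)].
Proof.
move=> mT bT b00 k0 kb hT Tsmall X0.
(* [L] is the logarithmic length of the rise. The net gain [(b0 - k / 4) L] has to pay [2 b0] for
   subtracting [sqrt X], and [k] and [2] for the norm and the form of the descent. *)
pose L := (k + 2 * b0 + 2) / (b0 - k / 4).
have L0 : 0 < L by apply: divr_gt0; lra.
have LE : L * (b0 - k / 4) = k + 2 * b0 + 2 by rewrite mulfVK// gt_eqF//; lra.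
pose b := X * expR L.
have Xb : X < b by rewrite ltr_pMr// expR_gt1.
have b_gt0 := lt_trans X0 Xb.
have lnb : ln b - ln X = L by rewrite lnM ?posrE ?expR_gt0// expRK; ring.
pose wb := Num.sqrt b - Num.sqrt X.
have wb0 : 0 < wb by rewrite subr_gt0 ltr_sqrt.
(* The slope of the descent: over the length [wb / s] its square integrates to [s wb <= 1]. *)
pose s := (wb + 1)^-1.
have s0 : 0 < s by rewrite invr_gt0; lra.
have swb : s * wb <= 1 by rewrite mulrC ler_pdivrMr; lra.
(* Beyond [Z] the integrand on the descent is at least [- s / wb], so the descent costs at most 1;
   before [Z] the primitive stays constant. *)
have [|Z hZ] := Tsmall (wb ^- 2); first by rewrite invr_gt0 exprn_gt0.
pose b1 := Num.max b Z; pose b2 := b1 + wb / s.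
have bb1 : b <= b1 by rewrite le_max lexx.
have Zb1 : Z <= b1 by rewrite le_max lexx orbT.
have b1_gt0 : 0 < b1 by exact: lt_le_trans bb1.
have b12 : b1 < b2 by rewrite ltrDl divr_gt0.
have Xb1 : X <= b1 by apply: le_trans bb1; exact: ltW.
have Xb2 : X <= b2 by apply: le_trans Xb1 _; exact: ltW.
pose f1 (x : R) := (2 * Num.sqrt x)^-1.
pose g1 := cut X b f1; pose g2 := cut b1 b2 (fun=> 1).
pose g x := g1 x + (- s) * g2 x.
have c1 (x : R) : 0 < x -> {for x, continuous (fun _ : R => 1 : R)}.
  by move=> _; exact: cst_continuous.
have s1 : supported X b g1 by apply: supported_cut => //; exact: continuous_sqrtV.
have s2 : supported b1 b2 g2 by exact: supported_cut.
have sg : supported X b2 g.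
  apply: supported_lin; first by apply: supported_widen s1 => //; exact: le_trans bb1 (ltW _).
  exact: supported_widen s2.
have wE x : prim g x = prim g1 x - s * prim g2 x.
  by rewrite (primD_supported _ _ (ltW X0) (ltW b1_gt0) s1 s2) mulNr.
have w1 x : X <= x <= b -> prim g x = Num.sqrt x - Num.sqrt X.
  move=> /andP[Xx xb]; rewrite wE (prim_before s2); last exact: le_trans bb1.
  rewrite mulr0 subr0 prim_cut ?Xx//; last exact: continuous_sqrtV.
  exact: Rintegral_sqrtV.
have w2 x : b1 <= x <= b2 -> prim g x = wb - s * (x - b1).
  move=> /andP[b1x xb2]; rewrite wE (prim_after (ltW X0) s1); last exact: le_trans b1x.
  rewrite !prim_cut ?b1x ?xb2 ?lexx ?(ltW Xb)//; last exact: continuous_sqrtV.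
  rewrite Rintegral_sqrtV ?ltW//; congr (_ - _ * _).
  exact: Rintegral_itv1.
have i2 : \int[mu]_(x in D) g2 x = wb / s.
  by rewrite Rintegral_cut// Rintegral_itv1 ?ltW// /b2 addrAC subrr add0r.
have gg : \int[mu]_(x in D) (g x * g x) = L / 4 + s * wb.
  transitivity (\int[mu]_(x in D) (4^-1 * cut X b (fun x => x^-1) x + s ^+ 2 * g2 x)).
    apply: eq_Rintegral => y _; rewrite /g /g1 /g2 /cut.
    case: ifPn => [/andP[Xy yb]|_].
      rewrite [b1 < y]ltNge (le_trans yb bb1) /= !mulr0 !addr0 /f1.
      have y0 := lt_trans X0 Xy; rewrite -invfM -invfM; congr (_^-1).
      by rewrite -{3}(sqr_sqrtr (ltW y0)); ring.
    by case: ifP => _; ring.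
  have cV (x : R) : 0 < x -> {for x, continuous (fun t : R => t^-1)}.
    by move=> x0; apply: inv_continuous; exact: lt0r_neq0.
  rewrite (Rintegral_supported_lin _ _ (ltW X0) (ltW b1_gt0) (supported_cut b X0 cV) s2).
  rewrite i2 Rintegral_cut//.
  by rewrite Rintegral_inv ?ltW// lnb; field; exact: lt0r_neq0.
have gb2 : prim g b2 = 0.
  by rewrite w2 ?lexx ?(ltW b12)// /b2 [b1 + _]addrC addrK mulrC mulfVK ?gt_eqF// subrr.
exists b2, g; split => //.
- by rewrite gg; apply: addr_gt0; [exact: divr_gt0|exact: mulr_gt0].
(* [b0 / 2 * f3] is [(b0 / x) w w'] on the rise, a lower bound by [T x >= b0 / x]. *)
pose f3 (x : R) := x^-1 + (- Num.sqrt X) * (x^-1 * (Num.sqrt x)^-1).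
have cf3 x : 0 < x -> {for x, continuous f3} by move=> ?; exact: continuous_invD_sqrt3V.
have s3 : supported X b (cut X b f3) by exact: supported_cut.
have lb : b0 / 2 * (L + 2 * (Num.sqrt X / Num.sqrt b) - 2) - 1 <=
    \int[mu]_(x in D) (T x * prim g x * g x).
  have -> : b0 / 2 * (L + 2 * (Num.sqrt X / Num.sqrt b) - 2) - 1 =
      \int[mu]_(x in D) (b0 / 2 * cut X b f3 x + (- (s / wb)) * g2 x).
    rewrite (Rintegral_supported_lin _ _ (ltW X0) (ltW b1_gt0) s3 s2) i2 Rintegral_cut//.
    rewrite Rintegral_sqrt3V ?ltW// lnb; field.
    by rewrite !gt_eqF ?sqrtr_gt0.
  have mD := @measurable_halfline R.
  apply: le_Rintegral => //.
  - apply: (supported_integrable_half (ltW X0) (Y := b2)).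
    apply: supported_lin; last exact: supported_widen s2.
    by apply: supportedZ; apply: supported_widen s3 => //; exact: le_trans bb1 (ltW _).
  - apply: (supported_integrable_half (ltW X0) (Y := b2)); apply: (supportedM _ sg).
    apply: (supported_mul (lexx X) mT) (supported_prim (ltW X0) sg gb2) => x _.
    exact: bT.
  move=> x _; rewrite [g x]/g /g1 /g2 /cut.
  case: ifPn => [/andP[Xx xb]|nx].
    have x0 := lt_trans X0 Xx.
    rewrite [b1 < x]ltNge (le_trans xb bb1) /= !mulr0 !addr0 w1 ?xb ?(ltW Xx)//.
    have sx : 0 < Num.sqrt x by rewrite sqrtr_gt0.
    have sXx : Num.sqrt X <= Num.sqrt x by rewrite ler_wsqrtr// ltW.
    have -> : b0 / 2 * f3 x = (b0 / x) * ((Num.sqrt x - Num.sqrt X) * f1 x).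
      by rewrite /f3 /f1; field; rewrite !gt_eqF.
    rewrite -[T x * _ * _]mulrA; apply: ler_wpM2r; first by rewrite mulr_ge0 ?subr_ge0// invr_ge0; lra.
    by rewrite ler_pdivrMr// mulrC hT// ltW.
  rewrite mulr0 !add0r; case: ifPn => [/andP[b1x xb2]|_]; last by rewrite !mulr0.
  rewrite w2 ?xb2 ?(ltW b1x)// !mulr1 mulrN lerN2.
  have sle : 0 <= wb - s * (x - b1) <= wb.
    have : s * (x - b1) <= wb by rewrite mulrC -ler_pdivlMr// /b2 in xb2 *; lra.
    have : 0 <= s * (x - b1) by rewrite mulr_ge0 ?ltW// subr_gt0.
    by move=> ? ?; apply/andP; split; lra.
  move/andP : sle => [s_ge0 s_le].
  have Tx : T x <= wb ^- 2 by apply: hZ; apply: le_trans Zb1 (ltW _).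
  rewrite mulrC ler_pM2l//.
  apply: le_trans (ler_wpM2r s_ge0 Tx) _.
  apply: le_trans (ler_wpM2l _ s_le) _; first by rewrite invr_ge0 exprn_ge0 ?ltW.
  by rewrite le_eqVlt; apply/orP; left; apply/eqP; field; rewrite gt_eqF.
rewrite gg; have : 0 <= b0 * (Num.sqrt X / Num.sqrt b).
  by rewrite mulr_ge0 ?ltW// divr_gt0 ?sqrtr_gt0.
have : k * (s * wb) <= k * 1 by exact: ler_wpM2l.
move: LE lb; clear; lra.
Qed.

End bump.

Lemma ge_tan (R : realType) (y : R) : 0 <= y -> y < pi / 2 -> y <= tan y.
Proof.
rewrite le_eqVlt => /orP[/eqP <-|y0] ypi; first by rewrite tan0.
have cos0 (x : R) : 0 <= x <= y -> 0 < cos x.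
  move=> /andP[x0 xy]; apply: cos_gt0_pihalf; rewrite (le_lt_trans xy)// andbT.
  by apply: lt_le_trans x0; rewrite oppr_lt0 divr_gt0 ?pi_gt0.
have dtan (x : R) : 0 <= x <= y -> is_derive x 1 (@tan R) (cos x ^- 2).
  by move=> /cos0 cx; apply: is_derive_tan; rewrite gt_eqF.
have [|c|c] := @MVT R (@tan R) (fun x => cos x ^- 2) 0 y y0.
- by move=> c; rewrite in_itv/= => /andP[c0 cy]; apply: dtan; rewrite !ltW.
- apply: derivable_within_continuous => x; rewrite in_itv/= => /dtan[].
  by [].
rewrite in_itv/= => /andP[c0 cy]; rewrite tan0 !subr0 => ->.
have cc : 0 < cos c by apply: cos0; rewrite !ltW.
rewrite ler_peMl ?(ltW y0)// invf_ge1 ?exprn_gt0//.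
Qed.

Section combine.
Variable R : realType.
Notation mu := (@lebesgue_measure R).
Notation D := (@halfline R).
Implicit Types (X Y : R) (f g : R -> R).

(* Two bumps with disjoint supports suffice to satisfy the linear condition
   [prim (T * g) Y = 0] as well. *)
Lemma two_bumps (T : R -> R) (N b0 k X : R) : measurable_fun D T ->
  (forall x, `|T x| <= N) -> 0 < b0 -> 0 <= k -> k < 4 * b0 ->
  (forall x, X <= x -> b0 <= x * T x) ->
  (forall e, 0 < e -> exists Z, forall x, Z <= x -> T x <= e) -> 0 < X ->
  exists Y g, [/\ X <= Y, supported X Y g, prim g Y = 0 /\ prim (fun x => T x * g x) Y = 0,
    0 < \int[mu]_(x in D) (g x * g x) &
    k * \int[mu]_(x in D) (g x * g x) <=
    2 * \int[mu]_(x in D) (T x * prim g x * g x)].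
Proof.
move=> mT bT b00 k0 kb hT Tsmall X0.
have sT Z Y g : supported Z Y g -> supported Z Y (fun x => T x * g x).
  by apply: (supported_mul (lexx Z) mT) => x _; exact: bT.
have [Y [g [XY sg gY g_gt0 kg]]] := bump mT bT b00 k0 kb hT Tsmall X0.
have [tY|tY] := eqVneq (prim (fun x => T x * g x) Y) 0; first by exists Y, g.
have Y0 := lt_le_trans X0 XY.
have hT' x : Y <= x -> b0 <= x * T x by move=> Yx; apply: hT; exact: le_trans Yx.
have [Y' [g' [YY' sg' gY' g'_gt0 kg']]] := bump mT bT b00 k0 kb hT' Tsmall Y0.
(* The multiple of the first bump that cancels the contribution of the second one to the linear
   condition; disjoint supports keep the inequality. *)
pose c := - prim (fun x => T x * g' x) Y' / prim (fun x => T x * g x) Y.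
pose h x := g' x + c * g x.
have X_ge0 := ltW X0; have Y_ge0 := ltW Y0.
have XY' := le_trans XY YY'.
have sh : supported X Y' h.
  by apply: supported_lin; [exact: supported_widen sg'|exact: supported_widen sg].
have whE x : prim h x = prim g' x + c * prim g x by exact: primD_supported sg' sg.
have hY' : prim h Y' = 0 by rewrite whE gY' (prim_after X_ge0 sg)// gY mulr0 addr0.
have sp := supported_prim X_ge0 sg gY; have sp' := supported_prim Y_ge0 sg' gY'.
have cross u v x : supported X Y u -> supported Y Y' v -> u x * v x = 0.
  move=> [_ _ u0] [_ _ v0]; have [xY|Yx] := leP x Y.
    by rewrite v0 ?mulr0// negb_and -leNgt xY.
  by rewrite u0 ?mul0r// negb_and -ltNge Yx orbT.
have sgg := supportedM sg sg; have sgg' := supportedM sg' sg'.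
have hh : \int[mu]_(x in D) (h x * h x) =
    1 * \int[mu]_(x in D) (g' x * g' x) + c ^+ 2 * \int[mu]_(x in D) (g x * g x).
  rewrite -(Rintegral_supported_lin _ _ Y_ge0 X_ge0 sgg' sgg).
  apply: eq_Rintegral => x _; rewrite /h.
  have := cross _ _ x sg sg'; move: (g x) (g' x) => a b ab.
  by transitivity (1 * (b * b) + c ^+ 2 * (a * a) + 2 * c * (a * b)); [ring|rewrite ab; ring].
have swg := supportedM (sT _ _ _ sp) sg; have swg' := supportedM (sT _ _ _ sp') sg'.
have ww : \int[mu]_(x in D) (T x * prim h x * h x) =
    1 * \int[mu]_(x in D) (T x * prim g' x * g' x) +
    c ^+ 2 * \int[mu]_(x in D) (T x * prim g x * g x).
  rewrite -(Rintegral_supported_lin _ _ Y_ge0 X_ge0 swg' swg).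
  apply: eq_Rintegral => x _; rewrite whE /h.
  have := cross _ _ x sp sg'; have := cross _ _ x sg sp'.
  move: (g x) (g' x) (prim g x) (prim g' x) (T x) => a b p q t e1 e2.
  transitivity (1 * (t * q * b) + c ^+ 2 * (t * p * a) + t * c * (a * q) + t * c * (p * b)); first by ring.
  by rewrite e1 e2 !mulr0 !addr0.
exists Y', h; split => //.
- split => //.
  transitivity (prim (fun x => T x * g' x + c * (T x * g x)) Y').
    by congr (prim _ _); apply/funext => x; rewrite /h; ring.
  rewrite (primD_supported _ _ Y_ge0 X_ge0 (sT _ _ _ sg') (sT _ _ _ sg)).
  by rewrite [X in _ + _ * X](prim_after X_ge0 (sT _ _ _ sg))// /c mulfVK// addrN.
- rewrite hh mul1r ltr_wpDr// mulr_ge0 ?sqr_ge0// ltW//.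
- rewrite hh ww; have := ler_wpM2l (sqr_ge0 c) kg; move: kg'; clear; lra.
Qed.

End combine.

(** * Trial pairs with disjoint supports *)

Section trial_sequence.
Variables (R : realType) (phi : R -> R) (phioo : R).
Notation mu := (@lebesgue_measure R).
Notation D := (@halfline R).
Hypothesis phi_decr : forall x y : R, 0 < x -> x <= y -> phi y <= phi x.
Hypothesis phi_cvgoo : phi x @[x --> +oo] --> phioo.
Implicit Types (X Y : R) (f g : R -> R).

Lemma phi_ge (x : R) : 0 < x -> phioo <= phi x.
Proof.
move=> x0; apply/ler_addgt0Pl => e e0.
have [M [_ hM]] : \forall y \near +oo, `|phioo - phi y| < e.
  by move/cvgrPdist_lt: phi_cvgoo; exact.
pose y := Num.max x (M + 1).
have xy : x <= y by rewrite le_max lexx.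
have : `|phioo - phi y| < e by apply: hM; rewrite lt_max ltrDl ltr01 orbT.
have := phi_decr x0 xy; rewrite ltr_norml; lra.
Qed.

Lemma phi_small (e : R) : 0 < e ->
  exists2 Z, 0 < Z & forall x, Z <= x -> 0 <= phi x - phioo < e.
Proof.
move=> e0; have [M [_ hM]] : \forall y \near +oo, `|phioo - phi y| < e.
  by move/cvgrPdist_lt: phi_cvgoo; exact.
exists (Num.max 1 (M + 1)); first by rewrite lt_max ltr01.
move=> x; rewrite ge_max => /andP[x1 Mx].
have x0 : 0 < x by exact: lt_le_trans x1.
rewrite subr_ge0 phi_ge//=.
have : `|phioo - phi x| < e by apply: hM; lra.
rewrite ltr_norml; lra.
Qed.

(** Passing from [g] to [G = g / cos psi] enlarges the squared norm by a factor of at most [c0^-2],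
    where [c0] is a lower bound of [cos psi]. The strict inequality [k < 4 b0] leaves room for this
    far out, where [psi] is small; any starting point [Z] is allowed so that the construction can be
    repeated. *)
Lemma trial_exists (b0 k Z : R) : 0 <= k -> k < 4 * b0 ->
  (exists Z, forall x, Z <= x -> b0 <= x * (phi x - phioo)) ->
  exists X Y (F G : l2fun R), [/\ Z <= X, X <= Y, solvable phi F G,
    forall x, ~~ (X < x <= Y) -> F x = 0 /\ G x = 0 &
    0 < l2prod G G /\ k * l2prod G G <= l2prod F G].
Proof.
move=> k0 kb [Z0 hZ0]; have b00 : 0 < b0 by lra.
pose r := k / (4 * b0).
have r0 : 0 <= r by rewrite divr_ge0//; lra.
have r1 : r < 1 by rewrite ltr_pdivrMr; lra.
have kr : k = 4 * b0 * r by rewrite /r mulrC mulfVK// gt_eqF//; lra.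
(* By the inequality of the means [c0^2 > r], so that [k' = k / c0^2] is still below [4 b0]. *)
pose c0 := (1 + r) / 2.
have c00 : 0 < c0 by rewrite /c0; lra.
have c01 : c0 < 1 by rewrite /c0; lra.
pose k' := k / c0 ^+ 2.
have c02 : 0 < c0 ^+ 2 by exact: exprn_gt0.
have kb' : k' < 4 * b0.
  rewrite ltr_pdivrMr// kr ltr_pM2l; last lra.
  rewrite /c0; have : 0 < (1 - r) ^+ 2 by rewrite exprn_gt0//; lra.
  by rewrite !expr2; lra.
have k'0 : 0 <= k' by rewrite divr_ge0// ltW.
have [d /= d0 hd] : exists2 d : R, 0 < d & forall y : R, 0 <= y < d -> c0 <= cos y.
  have : \forall y \near (0 : R), c0 < cos y.
    have := @continuous_cos R 0; rewrite /continuous_at cos0 => /cvgr_gt; exact.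
  move=> /nbhs_ballP[d /= d0 hd]; exists d => // y /andP[y0 yd].
  by apply/ltW/hd; rewrite /ball/= sub0r normrN ger0_norm.
have pi2 : 0 < pi / 2 :> R by rewrite divr_gt0// pi_gt0.
have [|Z1 Z10 hZ1] := @phi_small (Num.min d (pi / 2)); first by rewrite lt_min d0.
pose X := Num.max Z (Num.max Z0 Z1).
have ZX : Z <= X by rewrite le_max lexx.
have Z0X : Z0 <= X by rewrite !le_max lexx !orbT.
have Z1X : Z1 <= X by rewrite !le_max lexx !orbT.
have X0 : 0 < X by exact: lt_le_trans Z1X.
have psi_lt x : X <= x -> 0 <= phi x - phioo < Num.min d (pi / 2).
  by move=> Xx; apply: hZ1; exact: le_trans Xx.
have cos_psi x : X <= x -> c0 <= cos (phi x - phioo).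
  by move=> /psi_lt; rewrite lt_min => /and3P[? ? _]; apply: hd; apply/andP.
pose T := ta phi phioo c0.
(* [psi <= tan psi] carries the hypothesis on [x psi] over to [x T]. *)
have T_ge x : X <= x -> b0 <= x * T x.
  move=> Xx; have x0 : 0 < x by exact: lt_le_trans Xx.
  apply: le_trans (hZ0 _ (le_trans Z0X Xx)) _; rewrite ler_pM2l//.
  have /andP[p0] := psi_lt _ Xx; rewrite lt_min => /andP[_ ppi].
  rewrite /T /ta /icos (max_idPl (cos_psi _ Xx)); exact: ge_tan.
have Tsmall e : 0 < e -> exists Z, forall x, Z <= x -> T x <= e.
  move=> e0.
  have : \forall y \near (0 : R), sin y < e * c0.
    have := @continuous_sin R 0; rewrite /continuous_at sin0 => /cvgr_lt; apply.
    exact: mulr_gt0.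
  move=> /nbhs_ballP[d' /= d'0 hd']; have [Z2 Z20 hZ2] := phi_small d'0.
  exists (Num.max X Z2) => x; rewrite ge_max => /andP[Xx Z2x].
  rewrite /T /ta /icos (max_idPl (cos_psi _ Xx)).
  have cx := lt_le_trans c00 (cos_psi _ Xx).
  rewrite ler_pdivrMr//; apply: (@le_trans _ _ (e * c0)).
    apply/ltW/hd'; rewrite /ball/= sub0r normrN.
    by have /andP[p0 pd] := hZ2 _ Z2x; rewrite ger0_norm.
  by rewrite ler_pM2l// cos_psi.
have [Y [g [XY sg [gY TgY] g_gt0 kg]]] := two_bumps (measurable_ta phioo phi_decr c00)
  (ta_le phi phioo c00) b00 k'0 kb' T_ge Tsmall X0.
have [F [G [sFG F0 GE FG]]] := trial_pair phi_decr X0 c00 cos_psi (lexx X) XY sg gY TgY.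
exists X, Y, F, G; split => //.
- move=> x nx; split; first exact: F0.
  by rewrite GE; have [_ _ ->] := sg; rewrite ?mulr0.
have icos_ge1 x : 1 <= icos phi phioo c0 x.
  rewrite invf_ge1; last by rewrite lt_max c00 orbT.
  by rewrite ge_max cos_le1 ltW.
have iG := l2prod_integrable G G; have ig : mu.-integrable D (EFin \o (fun x => g x * g x)).
  exact: supported_integrable_half (ltW X0) (supportedM sg sg).
have mD := @measurable_halfline R.
split.
  apply: lt_le_trans g_gt0 _; apply: le_Rintegral => // x _.
  by rewrite GE mulrACA -!expr2 ler_peMl ?sqr_ge0// exprn_ege1.
rewrite FG; apply: le_trans kg.
rewrite /k' -mulrA ler_wpM2l//.
rewrite -RintegralZl//; apply: le_Rintegral => //.
  by apply: (integrableZl _ _ ig).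
move=> x _; rewrite GE mulrACA -!expr2 -exprVn ler_wpM2r ?sqr_ge0//.
have i0 := ltW (icos_gt0 phi phioo c00 x).
have := icos_le phi phioo c00 x; rewrite ger0_norm// => ic.
by apply: lerXn2r; rewrite ?nnegrE// invr_ge0 ltW.
Qed.

Lemma trial_sequence (b0 k : R) : 0 <= k -> k < 4 * b0 ->
  (exists Z, forall x, Z <= x -> b0 <= x * (phi x - phioo)) ->
  exists F G : nat -> l2fun R, forall i, [/\ solvable phi (F i) (G i),
    0 < l2prod (G i) (G i), k * l2prod (G i) (G i) <= l2prod (F i) (G i) &
    forall j, i != j -> l2prod (F i) (G j) = 0 /\ l2prod (G i) (G j) = 0].
Proof.
move=> k0 kb hZ.
have /choice[q hq] : forall Z : R, exists q : R * R * l2fun R * l2fun R,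
    [/\ Z <= q.1.1.1, q.1.1.1 <= q.1.1.2, solvable phi q.1.2 q.2,
      forall x, ~~ (q.1.1.1 < x <= q.1.1.2) -> q.1.2 x = 0 /\ q.2 x = 0 &
      0 < l2prod q.2 q.2 /\ k * l2prod q.2 q.2 <= l2prod q.1.2 q.2].
  by move=> Z; have [X [Y [F [G h]]]] := trial_exists Z k0 kb hZ; exists (X, Y, F, G).
(* Each pair is placed to the right of the support of the preceding one. *)
pose z n := iter n (fun Z => (q Z).1.1.2) 0.
have zS n m : (n < m)%N -> z n.+1 <= z m.
  elim: m => // m IH; rewrite ltnS leq_eqVlt => /orP[/eqP->//|/IH h].
  apply: le_trans h _; have [h1 h2 _ _ _] := hq (z m).
  exact: le_trans h1 h2.
exists (fun n => (q (z n)).1.2), (fun n => (q (z n)).2) => i.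
have [_ _ sFG F0 [G_gt0 kG]] := hq (z i); split => // j ij.
have [_ _ _ F0' _] := hq (z j).
have disj x : ((q (z i)).1.2 x = 0 /\ (q (z i)).2 x = 0) \/ (q (z j)).2 x = 0.
  have sub m n : (m < n)%N -> x <= (q (z m)).1.1.2 -> ~~ ((q (z n)).1.1.1 < x).
    move=> mn xm; rewrite -leNgt; apply: le_trans xm _; apply: le_trans (zS _ _ mn) _.
    by have [] := hq (z n).
  have [inj|/F0' [_ ->]] := boolP ((q (z j)).1.1.1 < x <= (q (z j)).1.1.2); last by right.
  left; apply: F0; move: inj => /andP[xj jx]; apply/negP => /andP[xi ix].
  move: ij; rewrite neq_ltn => /orP[ij|ji].
    by have := sub _ _ ij ix; rewrite xj.
  by have := sub _ _ ji jx; rewrite xi.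
have zero (u v : l2fun R) : (forall x, u x * v x = 0) -> l2prod u v = 0.
  move=> uv; rewrite /l2prod -[RHS](_ : \int[mu]_(x in D) (0 : R) = 0).
    by apply: eq_Rintegral => x _; exact: uv.
  by rewrite /Rintegral integral0.
by split; apply: zero => x; have [[e1 e2]|->] := disj x; rewrite ?mulr0// ?e1 ?e2 mul0r.
Qed.

End trial_sequence.

(** * The essential spectrum *)

Section essential_spectrum.
Variables (R : realType) (H : R -> 'M[R]_2) (phi : R -> R) (phioo : R).
Hypothesis HC : Cplus H.
Hypothesis Hphi :
  {ae @lebesgue_measure R, forall x : R, 0 < x -> H x = Pmx (phi x)}.
Hypothesis phi_decr : forall x y : R, 0 < x -> x <= y -> phi y <= phi x.
Hypothesis phi_cvgoo : phi x @[x --> +oo] --> phioo.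
Let B := limf_einf (fun x : R => (x * (phi x - phioo))%:E) (pinfty_nbhs R).

Lemma ess_spectrum_real z : ess_spectrum H z ->
  exists2 l : R, z = l%:C%C & 0 <= l.
Proof.
move=> [sz _]; have z0 := HC.2 _ sz; case: z z0 {sz} => a b; rewrite lecE/=.
by move=> /andP[/eqP -> a0]; exists a.
Qed.

Lemma ess_spectrum_le (b0 L : R) : 0 < b0 -> 0 < L -> 1 < 4 * b0 * L ->
  (exists Z, forall x, Z <= x -> b0 <= x * (phi x - phioo)) ->
  exists2 l : R, ess_spectrum H l%:C%C & l <= L.
Proof.
move=> b00 L0 bL hZ; apply: contrapT => none.
(* Strictly between [1 / L] and [4 b0]: large enough for [k L > 1], small enough for the trial pairs
   to exist. *)
pose k := (L^-1 + 4 * b0) / 2.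
have Lb : L^-1 < 4 * b0 by rewrite -[ltLHS]mul1r ltr_pdivrMr.
have L'0 : 0 < L^-1 by rewrite invr_gt0.
have k0 : 0 <= k by rewrite /k; lra.
have kb : k < 4 * b0 by rewrite /k; lra.
have [F [G FG]] := trial_sequence phi_decr phi_cvgoo k0 kb hZ.
apply: (disjoint_trials_absurd _ _ _ (@cprodC R) (@cprodDl R) (@cprodZl R)
  (@cprod_ge0 R) _ (SrV0 phi) (@SrV_lin R phi) (SrV_sym phi_decr) (@SrV_null R phi)
  (@cprod_complete R) L k (ltW L0)).
- move=> l l0; apply/(resolvent_regular Hphi phi_decr); apply: contrapT => nres.
  by have := HC.2 _ nres; rewrite ler0c leNgt l0.
- move=> l /andP[l0 lL]; apply: (not_ess_disc Hphi phi_decr) => ess.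
  by apply: none; exists l.
- by rewrite -ltr_pdivrMr// mul1r /k; lra.
- have l2prod00 : l2prod (0 : l2fun R) 0 = 0.
    by have := l2prodZl 0 (0 : l2fun R) 0; rewrite scale0r mul0r.
  have cE (u v : l2fun R) : cprod (u, 0) (v, 0) = l2prod u v by rewrite /cprod /= l2prod00 addr0.
  (* The trial pairs are real, so their imaginary parts are 0. *)
  move=> n; exists (fun i => (F i, 0)), (fun i => (G i, 0)); split.
  + by move=> i; split; [case: (FG i)|exact: solvable0].
  + by move=> i; rewrite cE; case: (FG i).
  + by move=> i; rewrite !cE; case: (FG i).
  + by move=> i j ij; rewrite !cE; case: (FG i) => _ _ _; apply.
Qed.

Lemma lt_limf_einf (b0 : R) : (b0%:E < B)%E ->
  exists Z, forall x, Z <= x -> b0 <= x * (phi x - phioo).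
Proof.
rewrite /B limf_einfE => /ereal_sup_gt[_ [V [M [_ hM]] <-] b0V].
exists (M + 1) => x Mx; rewrite -lee_fin; apply: le_trans (ltW b0V) _.
by apply: ereal_inf_lbound; exists x => //; apply: hM; lra.
Qed.

Lemma limf_einf_ge0 : (0 <= B)%E.
Proof.
rewrite /B limf_einfE.
apply: (@le_trans _ _ (ereal_inf [set (x * (phi x - phioo))%:E | x in [set x : R | 0 < x]])).
  apply: le_ereal_inf_tmp => _ [x /= x0 <-]; rewrite lee_fin mulr_ge0 ?(ltW x0)//.
  by rewrite subr_ge0; exact: phi_ge x0.
apply: ereal_sup_ubound; exists [set x : R | 0 < x] => //.
by exists 0; split.
Qed.

Lemma ess_spectrum_lt (L : R) : B != 0%E -> ((4%:E * B)^-1 < L%:E)%E ->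
  exists2 l : R, ess_spectrum H l%:C%C & l <= L.
Proof.
move=> B0; have {B0} : (0 < B)%E by rewrite lt_def B0 limf_einf_ge0.
have := @lt_limf_einf; case: B => [b| |]//= hb.
  rewrite lte_fin => b0; rewrite -EFinM inver mulf_eq0 !gt_eqF//= lte_fin => bL.
  have bi0 : 0 < (4 * b)^-1 by rewrite invr_gt0 mulr_gt0.
  have L0 := lt_trans bi0 bL.
  have Lb : (4 * L)^-1 < b.
    rewrite -[ltLHS]mul1r ltr_pdivrMr ?mulr_gt0//.
    by move: bL; rewrite -[ltLHS]mul1r ltr_pdivrMr ?mulr_gt0//; lra.
  have Li0 : 0 < (4 * L)^-1 by rewrite invr_gt0 mulr_gt0.
  (* Below the lower limit, so eventually a lower bound of [x psi], and yet [4 c L > 1]. *)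
  pose c := ((4 * L)^-1 + b) / 2.
  apply: (@ess_spectrum_le c) => //; first by rewrite /c; lra.
    have : (4 * L)^-1 < c by rewrite /c; lra.
    by rewrite -[X in X < _]mul1r ltr_pdivrMr ?mulr_gt0// mulrA [c * 4]mulrC.
  by apply: hb; rewrite lte_fin /c; lra.
(* For [B = +oo] any [b0] is available; [L^-1] gives [4 b0 L = 4]. *)
move=> _; rewrite gt0_muley ?lte_fin// => L0; have {}L0 : 0 < L by rewrite -lte_fin.
apply: (@ess_spectrum_le L^-1) => //; first by rewrite invr_gt0.
  by rewrite mulfVK ?gt_eqF// ltr1n.
by apply: hb; exact: ltry.
Qed.

(** The essential spectrum is closed: if its infimum were not in it, a punctured neighbourhood of
    the infimum would consist of regular points, although it contains points of the essential
    spectrum. *)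
Lemma min_ess_spectrum : exists m, is_min (ess_spectrum H) m.
Proof.
pose E := [set l : R | ess_spectrum H l%:C%C].
have [E0|nE0] := pselect (E !=set0); last first.
  exists +oo%E; apply/seteqP; split=> // z Az; exfalso; apply: nE0.
  by have [l e _] := ess_spectrum_real Az; exists l; rewrite /E/= -e.
have lE : has_lbound E.
  by exists 0 => l /ess_spectrum_real[l' [->]].
exists (inf E)%:E; split; last first.
  move=> z Az; have [l e _] := ess_spectrum_real Az.
  have El : E l by move: Az; rewrite e.
  have le : inf E <= l by exact: ge_inf lE _ El.
  by rewrite e lecR.
apply: contrapT => nA; have [eta eta0 [near _]] := not_ess_disc Hphi phi_decr nA.
have [l El lt] := inf_adherent eta0 (conj E0 lE).
have le : inf E <= l by exact: ge_inf lE _ El.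
have ne : l != inf E by apply/eqP => e; apply: nA; rewrite -e.
case: El => nres _; apply: nres; apply/(resolvent_regular Hphi phi_decr)/near.
by rewrite normr_gt0 subr_eq0 ne ger0_norm ?subr_ge0// ltrBlDl.
Qed.

End essential_spectrum.

Theorem theorem4p2 (R : realType) (H : R -> 'M[R]_2) (phi : R -> R)
    (phi0 phioo : R) (B : \bar R)
    (HC : Cplus H)
    (Hphi : {ae @lebesgue_measure R, forall x, 0 < x -> H x = Pmx (phi x)})
    (phi_decr : forall x y : R, 0 < x -> x <= y -> phi y <= phi x)
    (phi_cvg0 : phi x @[x --> 0^'+] --> phi0)
    (phi_cvgoo : phi x @[x --> +oo] --> phioo)
    (phi_bounds : pi / 2 >= phi0 /\ phi0 >= phioo /\ phioo >= - (pi / 2))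
    (defB : B = limf_einf (fun x : R => (x * (phi x - phioo))%:E) (pinfty_nbhs R)) :
  exists m : \bar R, is_min (ess_spectrum H) m /\ (m <= (4%:E * B)^-1)%E.
Proof.
have [m hm] := min_ess_spectrum HC Hphi phi_decr; exists m; split => //.
have lt := ess_spectrum_lt HC Hphi phi_decr phi_cvgoo.
rewrite -defB in lt.
have [->|B0] := eqVneq B 0%E; first by rewrite mule0 inve0 leey.
rewrite leNgt; apply/negP => Bm.
(* A real number strictly between the two bounds, also when [m] is [+oo]; it forces a point of the
   essential spectrum below [m]. *)
have [L BL Lm] : exists2 L : R, ((4%:E * B)^-1 < L%:E)%E & (L%:E < m)%E.
  move: Bm; case: (_^-1)%E => [v| |]; case: (m) => [r| |]//= vr.
  - by exists ((v + r) / 2); rewrite lte_fin; move: vr; rewrite lte_fin; lra.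
  - by exists (v + 1); rewrite ?ltry// lte_fin; lra.
  - by exists (r - 1); rewrite ?ltNyr// lte_fin; lra.
  - by exists 0; rewrite ?ltNyr ?ltry.
have [l Al lL] := lt L B0 BL.
case: m hm Bm Lm => [m| |]//=; last by move=> A0; rewrite A0 in Al.
move=> [_ /(_ _ Al)]; rewrite lecR lte_fin => ml _ Lm.
by have := le_lt_trans (le_trans ml lL) Lm; rewrite ltxx.
Qed.
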